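(* Let $n>1$. The maximal domain of meromorphy $\mathcal{M}$ of Igusa's zeta function $$Z^{\mathrm{ring}}(s_1,\dots,s_n;\mathbb{Z}[T,T^{-1}])=\sum_{m_1,\dots,m_n\ge 1}\frac{\varphi(m_1\cdots m_n)}{m_1^{s_1}\cdots m_n^{s_n}}$$ is given by $$\mathcal{M}=\Big\{(s_1,\dots,s_n)\in\mathbb{C}^n\ :\ \forall\, I\subseteq\{1,\dots,n\},\ \sum_{i\in I}\sigma_i>-1+\#I\Big\},$$ where $\sigma_i=\Re(s_i)$. In particular, if $(s_1^0,\dots,s_n^0)\in\partial\mathcal{M}$, then there does not exist any meromorphic continuation of $Z^{\mathrm{ring}}(s_1,\dots,s_n;\mathbb{Z}[T,T^{-1}])$ to a domain containing an open ball $\mathcal{B}$ of dimension $n$ centered at $(s_1^0,\dots,s_n^0)$.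
   Context: $\varphi$ is Euler's totient function. For a ring $A$, the multivariate global Igusa zeta function is $Z^{\mathrm{ring}}(s_1,\dots,s_n;A)=\sum_{m_1,\dots,m_n\ge1}\left|\mathrm{Hom}_{\mathrm{ring}}\left(A,\mathbb{Z}/m_1\cdots m_n\mathbb{Z}\right)\right|m_1^{-s_1}\cdots m_n^{-s_n}$; for $A=\mathbb{Z}[T,T^{-1}]$ this is the series displayed in the claim. The series is considered initially where it converges absolutely (all $\Re(s_i)$ large enough). That $\mathcal{M}$ is the maximal domain of meromorphy means that the function so defined extends meromorphically to $\mathcal{M}$ and that it cannot be continued meromorphically beyond $\partial\mathcal{M}$: there is no meromorphic function on a connected open set containing $\mathcal{M}\cup\mathcal{B}$, with $\mathcal{B}$ an open ball centered at a point of $\partial\mathcal{M}$, that coincides with the continuation on $\mathcal{M}$. *)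

(* Defs.v *)
(* MathComp / MathComp-Analysis; C is R[i] for an arbitrary R : realType. *)
From HB Require Import structures.
From mathcomp Require Import all_boot all_order all_algebra.
From mathcomp Require Import all_classical all_reals all_analysis.
From mathcomp Require Import complex finmap fraction.
From mathcomp Require summability.

Set Implicit Arguments.
Unset Strict Implicit.
Unset Printing Implicit Defensive.

Import Order.TTheory GRing.Theory Num.Theory.
Import numFieldNormedType.Exports.

Local Open Scope classical_set_scope.
Local Open Scope ring_scope.

(* The usual topology on R[i]. It makes ['rV[R[i]]_n] a normed space over R[i]
   for the sup norm, so that [ball s r] is a polydisc and
   [differentiable f s] is complex (Frechet) differentiability. *)
HB.instance Definition _ (R : realType) := NormedModule.copy R[i] R[i]^o.

(* Z[T, T^-1], as the subring of Z(T) of the fractions p / T^k. *)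
Section Laurent.

Local Notation "x %:F" := (@tofrac {poly int} x).

Definition is_laurent : {pred {fraction {poly int}}} :=
  fun x => `[< exists (p : {poly int}) (k : nat), x = p%:F / 'X%:F ^+ k >].

Lemma is_laurent_subring : subring_closed is_laurent.
Proof.
have X0 : 'X%:F != 0 by rewrite tofrac_eq0 polyX_eq0.
split.
- by apply/asboolP; exists 1, 0; rewrite rmorph1 expr0 divr1.
- move=> x y /asboolP[p [k ->]] /asboolP[q [l ->]]; apply/asboolP.
  exists (p * 'X ^+ l - q * 'X ^+ k), (k + l)%N.
  rewrite rmorphB !rmorphM !rmorphXn /= exprD mulrBl.
  congr (_ - _); last first.
    by rewrite [_ ^+ k * _]mulrC -mulf_div divff ?mulr1 ?expf_neq0.
  by rewrite -mulf_div divff ?mulr1 ?expf_neq0.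
- move=> x y /asboolP[p [k ->]] /asboolP[q [l ->]]; apply/asboolP.
  by exists (p * q), (k + l)%N; rewrite rmorphM /= exprD mulf_div.
Qed.

HB.instance Definition _ :=
  GRing.isSubringClosed.Build {fraction {poly int}} is_laurent
    is_laurent_subring.

Record laurentZ :=
  LaurentZ { laurentZ_val : {fraction {poly int}}; _ : laurentZ_val \in is_laurent }.

HB.instance Definition _ := [isSub for laurentZ_val].
HB.instance Definition _ := [Choice of laurentZ by <:].
HB.instance Definition _ := [SubChoice_isSubComNzRing of laurentZ by <:].

End Laurent.

(* Unital ring homomorphisms A -> Z/dZ for d > 0, with Z/dZ carried by 'I_d and
   its operations spelled out modulo d: the ring 'Z_d would be wrong for
   d = 1. *)
Definition ring_homs (A : pzRingType) (d : nat) : set (A -> 'I_d) :=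
  [set f : A -> 'I_d | [/\ f 1 = 1 %[mod d],
               forall x y, f (x + y) = (f x + f y)%N %[mod d] &
               forall x y, f (x * y) = (f x * f y)%N %[mod d]]].

Arguments ring_homs : clear implicits.

(* Meaningful when there are finitely many homomorphisms, e.g. for A finitely
   generated; [fset_set] is empty otherwise. *)
Definition nb_ring_homs (A : pzRingType) (d : nat) : nat :=
  #|` fset_set (ring_homs A d)|%fset.

Section MultipleSeries.
Variables (R : realType) (n : nat).

Definition cexp (z : R[i]) : R[i] :=
  (expR (complex.Re z))%:C%C * (cos (complex.Im z) +i* sin (complex.Im z))%C.

(* k ^ z, for k > 0 *)
Definition natpow (k : nat) (z : R[i]) : R[i] := cexp ((ln (k%:R : R))%:C%C * z).

(* The m_i >= 1 of the series are the (m i).+1. *)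
Definition series_term (a : nat -> nat) (s : 'rV[R[i]]_n)
    (m : {ffun 'I_n -> nat}) : R[i] :=
  (a (\prod_(i < n) (m i).+1)%N)%:R
  * \prod_(i < n) natpow (m i).+1 (- s ord0 i).

Definition abs_conv (a : nat -> nat) : set 'rV[R[i]]_n :=
  [set s | summable [set: {ffun 'I_n -> nat}]
             (fun m => (ComplexField.Normc.normc (series_term a s m))%:E)].

(* Limit of the finite partial sums along the directed set of finite subsets
   of the index set. *)
Definition multi_series (a : nat -> nat) (s : 'rV[R[i]]_n) : R[i] :=
  summability.sum (series_term a s).

Definition igusa_zeta (A : pzRingType) : 'rV[R[i]]_n -> R[i] :=
  multi_series (nb_ring_homs A).

Definition igusa_conv (A : pzRingType) : set 'rV[R[i]]_n :=
  abs_conv (nb_ring_homs A).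

End MultipleSeries.

Section Meromorphy.
Variables (R : realType) (n : nat).
Implicit Types (U V M D : set 'rV[R[i]]_n) (f g h : 'rV[R[i]]_n -> R[i]).

Definition holomorphic_on U f := forall z, U z -> differentiable f z.

Definition frontier U := closure U `\` interior U.

Definition is_domain U := [/\ U !=set0, open U & connected U].

(* Near each point of U, f is a quotient g / h of holomorphic functions, where
   h vanishes identically on no nonempty open set. The values of f on {h = 0}
   are irrelevant, so f stands for a meromorphic function up to [mero_eq]. *)
Definition meromorphic_on U f :=
  forall p, U p -> exists V g h,
    [/\ open V, V p & V `<=` U] /\
    [/\ holomorphic_on V g, holomorphic_on V h,
        V `<=` closure [set z | V z /\ h z != 0] &
        forall z, V z -> h z != 0 -> f z = g z / h z].

(* Equality on U of the meromorphic functions represented by f and g. *)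
Definition mero_eq U f g :=
  exists V, [/\ open V, V `<=` U, U `<=` closure V &
                forall z, V z -> f z = g z].

Definition mero_extension D f U g :=
  [/\ D `<=` U, meromorphic_on U g & forall z, D z -> g z = f z].

Definition max_domain_of_meromorphy D f M :=
  is_domain M /\
  exists F, mero_extension D f M F /\
    forall s0 (r : R[i]) U, frontier M s0 -> 0 < r ->
      is_domain U -> M `|` ball s0 r `<=` U ->
      ~ exists G, meromorphic_on U G /\ mero_eq M G F.

End Meromorphy.

(* Main.v *)
Require Import Defs.
From HB Require Import structures.
From mathcomp Require Import all_boot all_order all_algebra.
From mathcomp Require Import all_classical all_reals all_analysis.
From mathcomp Require Import complex ring lra finmap fraction.
Import Order.TTheory GRing.Theory Num.Theory.
Import numFieldNormedType.Exports.
Import ComplexField.Normc.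
Local Open Scope classical_set_scope.
Local Open Scope ring_scope.
Set Implicit Arguments.
Unset Strict Implicit.
Unset Printing Implicit Defensive.

(** The homomorphisms $\mathbb{Z}[T, T^{-1}] \to \mathbb{Z}/d\mathbb{Z}$ correspond to the units of
    $\mathbb{Z}/d\mathbb{Z}$, so $Z$ is the multiple series of $\varphi(m_1 \cdots m_n)$
    ([nb_ring_homs_laurent]). As $\varphi$ is multiplicative, $Z$ has an Euler product
    ([euler_product]); with $y_i = p^{1 - s_i}$, its factor at $p$ is
    $h_p / \prod_i (1 - y_i)$, where $h_p = 1 - p^{-1} + p^{-1} \prod_i (1 - y_i)$.

    Continuation. A monomial $m = \pm p^{-\ell(s)}$ in $p^{-1}$ and the $y_i$ with sign $+$
    has the Euler product $\prod_p (1 - m)^{-1} = \zeta(\ell)$, and with sign $-$ it has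
    $\zeta(2\ell)/\zeta(\ell)$. Multiplying $h_p$ by well chosen factors $1 - m$ kills its
    monomials of lowest degree in $p^{-1}$, again and again ([expansion_exists]); what
    remains is $1$ plus monomials of degree at least [K.+2]. In all of these the
    exponents of the $y_i$ are at most the degree $k$ in $p^{-1}$, whence
    $\Re \ell \ge k (1 - \sum_i \tau_i^+)$ for $\tau_i = 1 - \sigma_i$ and $\tau_i^+ = \max(0, \tau_i)$.
    So the Euler product of the remainder converges where $K$ is large compared with
    $1 / (1 - \sum_i \tau_i^+)$. In the zeta factors $\Re \ell > -1$, also for $m = y_i$,
    where $\ell = s_i - 1$; so it suffices to continue $(w - 1) \zeta(w)$ to $\Re w > -1$
    ([xi_differentiable]). On this region $Z$ is thus
    [numer K / denom K]; the quotients for various $K$ agree by the identity theorem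
    ([cross]), and the regions exhaust $\{\sum_i \tau_i^+ < 1\}$, which is $\mathcal{M}$
    ([subset_sums_load]).

    Natural boundary. The zeros of $h_p$ form the graph of
    $y_i = 1 + (p - 1) / \prod_{j \ne i} (1 - y_j)$. Near a boundary point where no other
    $\tau_j$ vanishes, these graphs are defined on a ball independent of $p$, and as
    $p \to \infty$ they approach the complex hyperplane through the point on which
    $\sum_{j : \tau_j > 0} s_j$ is constant, which lies in the boundary near this point
    ([zero_graph]). The graph meets $\mathcal{M}$: where the $y_j$, $j \ne i$, are
    negative, each $|1 - y_j|$ exceeds both $1$ and $|y_j|$, so that $|y_i|$ is smaller
    than its main term, the value of the boundary ([negative_point_load]). This is where
    $n > 1$ is used; for $n = 1$ the series continues to the whole plane. On the part of
    the graph inside $\mathcal{M}$ the numerators of the continuation vanish, and its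
    denominators do not vanish identically ([denom_graph_neq0]). So if $g/h$ extends
    the function to a ball around the boundary point, $g$ vanishes on all of these
    graphs, hence identically, since on each line in the direction of $s_i$ its zeros
    cluster at the hyperplane ([no_extension]); but $Z \ne 0$ at real points of
    convergence. A continuation to a domain that meets the boundary without containing
    $\mathcal{M}$ is excluded too: the closure of the set where it agrees with that of
    $Z$ is relatively open, hence reaches the boundary point ([no_continuation]).

    The function theory needed, for functions on normed spaces over [R[i]], is
    derived from integrals of continuous functions of a real variable: Goursat's
    bisection gives Cauchy's formula and Taylor expansions on discs
    ([cauchy_taylor]), whose restrictions to complex lines give the identity theorem
    ([identity_theorem]) and the convergence of series of holomorphic functions
    ([weierstrass_mtest]). *)

(** * Moduli and norms *)

Section Modulus.
Context {R : realType}.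
Local Notation C := R[i].
Implicit Types z w : C.

Lemma norm_normc z : `|z| = ((normc z)%:C)%C.
Proof. by rewrite normc_def; case: z. Qed.

Lemma normc_ge0 z : 0 <= normc z.
Proof. by case: z => a b; rewrite /normc sqrtr_ge0. Qed.

Lemma normc_eq0 z : (normc z == 0) = (z == 0).
Proof.
by apply/eqP/eqP => [/eq0_normc //|->]; rewrite normc0.
Qed.

Lemma normc_gt0 z : (0 < normc z) = (z != 0).
Proof. by rewrite lt_def normc_ge0 normc_eq0 andbT. Qed.

Lemma normcR (x : R) : normc (x%:C)%C = `|x|.
Proof. by rewrite /normc /= expr0n /= addr0 sqrtr_sqr. Qed.

Lemma normcX z n : normc (z ^+ n) = normc z ^+ n.
Proof. by elim: n => [|n ih]; rewrite ?expr0 ?normc1 // !exprS normcM ih. Qed.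

Lemma normc_nat n : normc (n%:R : C) = n%:R.
Proof.
have -> : (n%:R : C) = ((n%:R : R)%:C)%C by rewrite rmorph_nat.
by rewrite normcR ger0_norm.
Qed.

Lemma normc_Re z : `|complex.Re z| <= normc z.
Proof.
case: z => a b; rewrite /normc /= -sqrtr_sqr ler_sqrt ?addr_ge0 ?sqr_ge0 //.
by rewrite lerDl sqr_ge0.
Qed.

Lemma normc_Im z : `|complex.Im z| <= normc z.
Proof.
case: z => a b; rewrite /normc /= -sqrtr_sqr ler_sqrt ?addr_ge0 ?sqr_ge0 //.
by rewrite lerDr sqr_ge0.
Qed.

Lemma normc_le z : normc z <= `|complex.Re z| + `|complex.Im z|.
Proof.
case: z => a b /=.
rewrite -[leRHS]ger0_norm ?addr_ge0 // -sqrtr_sqr ler_sqrt ?sqr_ge0 //.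
have ha : a ^+ 2 = `|a| ^+ 2 by rewrite real_normK ?num_real.
have hb : b ^+ 2 = `|b| ^+ 2 by rewrite real_normK ?num_real.
rewrite ha hb.
have := normr_ge0 a; have := normr_ge0 b; set u := `|a|; set v := `|b|.
move=> v0 u0; rewrite sqrrD -addrA lerD2l lerDr mulrn_wge0 ?mulr_ge0 //.
Qed.

Lemma ler_normcD z w : normc (z + w) <= normc z + normc w.
Proof. exact: le_normcD. Qed.

Lemma ler_normcB z w : normc (z - w) <= normc z + normc w.
Proof. by rewrite (le_trans (le_normcD _ _)) // normcN. Qed.

Lemma normc_distC z w : normc (z - w) = normc (w - z).
Proof. by rewrite -normcN opprB. Qed.

Lemma ler_dist_normc z w : normc z - normc w <= normc (z - w).
Proof. by rewrite lerBlDr -{1}(subrK w z) le_normcD. Qed.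

Lemma ler_normc_sum (I : Type) (r : seq I) (P : pred I) (F : I -> C) :
  normc (\sum_(i <- r | P i) F i) <= \sum_(i <- r | P i) normc (F i).
Proof.
elim/big_rec2: _ => [|i x y _ h]; first by rewrite normc0.
by rewrite (le_trans (le_normcD _ _)) // lerD2l.
Qed.

Lemma normc_prod (I : Type) (r : seq I) (P : pred I) (F : I -> C) :
  normc (\prod_(i <- r | P i) F i) = \prod_(i <- r | P i) normc (F i).
Proof.
elim/big_rec2: _ => [|i x y _ h]; first by rewrite normc1.
by rewrite normcM h.
Qed.

Lemma Re_add z w : complex.Re (z + w) = complex.Re z + complex.Re w.
Proof. by case: z w => [a b] [c d]. Qed.
Lemma Im_add z w : complex.Im (z + w) = complex.Im z + complex.Im w.
Proof. by case: z w => [a b] [c d]. Qed.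
Lemma Re_opp z : complex.Re (- z) = - complex.Re z.
Proof. by case: z. Qed.
Lemma Im_opp z : complex.Im (- z) = - complex.Im z.
Proof. by case: z. Qed.
Lemma Re_mul z w : complex.Re (z * w) =
  complex.Re z * complex.Re w - complex.Im z * complex.Im w.
Proof. by case: z w => [a b] [c d]. Qed.
Lemma Im_mul z w : complex.Im (z * w) =
  complex.Re z * complex.Im w + complex.Im z * complex.Re w.
Proof. by case: z w => [a b] [c d]. Qed.
Lemma Re_sum (I : Type) (r : seq I) (P : pred I) (F : I -> C) :
  complex.Re (\sum_(i <- r | P i) F i) = \sum_(i <- r | P i) complex.Re (F i).
Proof. by elim/big_rec2: _ => // i x y _ <-; rewrite Re_add. Qed.
Lemma Im_sum (I : Type) (r : seq I) (P : pred I) (F : I -> C) :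
  complex.Im (\sum_(i <- r | P i) F i) = \sum_(i <- r | P i) complex.Im (F i).
Proof. by elim/big_rec2: _ => // i x y _ <-; rewrite Im_add. Qed.
Lemma Re_nat n : complex.Re (n%:R : C) = n%:R.
Proof. by rewrite -(rmorph_nat (real_complex R)). Qed.
Lemma Im_nat n : complex.Im (n%:R : C) = 0.
Proof. by rewrite -(rmorph_nat (real_complex R)). Qed.
Lemma complex_eq z w : complex.Re z = complex.Re w ->
  complex.Im z = complex.Im w -> z = w.
Proof. by case: z w => [a b] [c d] /= -> ->. Qed.

Lemma posC_real (e : C) : 0 < e -> exists2 e' : R, 0 < e' & e = (e'%:C)%C.
Proof.
by case: e => a b; rewrite ltcE /= => /andP[/eqP -> a0]; exists a.
Qed.

Lemma normc_conj z : normc (conjc z) = normc z.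
Proof. by case: z => a b; rewrite /normc /= sqrrN. Qed.

End Modulus.

(** Norms over [R[i]] take values in [R[i]], where the order is only partial. *)
Definition nrm {R : realType} {V : normedModType R[i]} (v : V) : R :=
  complex.Re `|v|.

Section Nrm.
Context {R : realType}.
Local Notation C := R[i].
Variable V : normedModType C.
Implicit Types u v : V.

Lemma norm_nrm v : `|v| = ((nrm v)%:C)%C.
Proof. by rewrite /nrm RRe_real // normr_real. Qed.

Lemma nrm_ge0 v : 0 <= nrm v.
Proof. by rewrite -ler0c -norm_nrm. Qed.

Lemma nrmZ (c : C) v : nrm (c *: v) = normc c * nrm v.
Proof.
by rewrite {1}/nrm normrZ norm_normc norm_nrm -rmorphM.
Qed.

Lemma ler_nrmD u v : nrm (u + v) <= nrm u + nrm v.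
Proof. by rewrite -lecR rmorphD /= -!norm_nrm ler_normD. Qed.

Lemma nrmN v : nrm (- v) = nrm v.
Proof. by rewrite /nrm normrN. Qed.

Lemma nrm0 : nrm (0 : V) = 0.
Proof. by rewrite /nrm normr0. Qed.

Lemma nrm_eq0 v : (nrm v == 0) = (v == 0).
Proof.
rewrite -[RHS]normr_eq0 norm_nrm; apply/eqP/eqP => [->//|].
by move/(congr1 (@complex.Re R)).
Qed.

Lemma nrm_normc (z : C) : nrm z = normc z.
Proof. by rewrite /nrm norm_normc. Qed.

Lemma nbhs_nrmP (p : V) (A : set V) :
  nbhs p A <-> exists2 e : R, 0 < e & forall q, nrm (q - p) < e -> A q.
Proof.
split=> [/nbhs_normP[e /= e0 eA]|[e e0 eA]].
  have [e' e'0 ee] := posC_real e0; exists e' => // q qe; apply: eA => /=.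
  by rewrite distrC norm_nrm ee ltcR.
apply/nbhs_normP; exists ((e%:C)%C) => /=; first by rewrite ltcR.
by move=> q /=; rewrite distrC norm_nrm ltcR => /eA.
Qed.

Lemma ball_nrm (p q : V) (e : R) : ball p ((e%:C)%C) q <-> nrm (q - p) < e.
Proof. by rewrite -ball_normE /ball_ /= distrC norm_nrm ltcR. Qed.

End Nrm.

Section NearC.
Context {R : realType}.
Local Notation C := R[i].

Lemma cvg_normcP (T : Type) (F : set_system T) (FF : Filter F) (f : T -> C) (l : C) :
  f x @[x --> F] --> l <->
  forall e : R, 0 < e -> \forall x \near F, normc (f x - l) < e.
Proof.
split=> [/cvgrPdist_lt h e e0|h].
  have e0' : 0 < ((e%:C)%C : C) by rewrite ltcR.
  near=> x; rewrite normc_distC -ltcR -norm_normc.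
  by near: x; exact: h.
apply/cvgrPdist_lt => e /posC_real[e' e'0 ->].
by near=> x; rewrite norm_normc ltcR normc_distC; near: x; exact: h.
Unshelve. all: by end_near.
Qed.

Lemma continuous_nrmP (V : normedModType C) (f : V -> C) (p : V) :
  {for p, continuous f} <->
  forall e : R, 0 < e -> exists2 d : R, 0 < d &
    forall q, nrm (q - p) < d -> normc (f q - f p) < e.
Proof.
split=> [/cvg_normcP h e /h/nbhs_nrmP|h]; first by [].
by apply/cvg_normcP => e /h/nbhs_nrmP.
Qed.

Lemma cvg_seq_normcP (f : nat -> C) (l : C) :
  f x @[x --> \oo] --> l <->
  forall e : R, 0 < e -> exists N, forall n, (N <= n)%N -> normc (f n - l) < e.
Proof.
split=> [/cvg_normcP h e /h[N _ hN]|h]; first by exists N => n; exact: hN.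
by apply/cvg_normcP => e /h[N hN]; exists N.
Qed.

End NearC.

(** * The complex exponential along real lines *)

(** Derivative at a real point of a complex-valued function of a real
    variable, taken componentwise because [R[i]] is a normed space over itself
    only. *)
Definition rder {R : realType} (f : R -> R[i]) (x : R) (d : R[i]) : Prop :=
  is_derive x 1 (fun t => complex.Re (f t)) (complex.Re d) /\
  is_derive x 1 (fun t => complex.Im (f t)) (complex.Im d).

Section RealDerivative.
Context {R : realType}.
Local Notation C := R[i].
Implicit Types f g : R -> C.

Lemma rder_eq f x d d' : rder f x d -> d = d' -> rder f x d'.
Proof. by move=> h <-. Qed.

Lemma rder_ext f g x d : f =1 g -> rder f x d -> rder g x d.
Proof. by move=> /funext ->. Qed.

Lemma rder_cst (c : C) x : rder (fun=> c) x 0.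
Proof. by split; exact: is_derive_cst. Qed.

Lemma rder_id x : rder (fun t : R => (t%:C)%C) x 1.
Proof. by split; [exact: is_derive_id|exact: is_derive_cst]. Qed.

Lemma rderD f g x d e : rder f x d -> rder g x e ->
  rder (fun t => f t + g t) x (d + e).
Proof.
move=> [f1 f2] [g1 g2]; split; rewrite ?Re_add ?Im_add.
  under [X in is_derive _ _ X _]funext => t do rewrite Re_add.
  exact: is_deriveD.
under [X in is_derive _ _ X _]funext => t do rewrite Im_add.
exact: is_deriveD.
Qed.

Lemma rderM f g x d e : rder f x d -> rder g x e ->
  rder (fun t => f t * g t) x (d * g x + f x * e).
Proof.
move=> [f1 f2] [g1 g2]; split.
  under [X in is_derive _ _ X _]funext => t do rewrite Re_mul.
  apply: is_derive_eq.
  by rewrite !(Re_opp, Re_add, Re_mul) /GRing.scale /=; ring.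
under [X in is_derive _ _ X _]funext => t do rewrite Im_mul.
apply: is_derive_eq.
by rewrite !(Im_add, Im_mul) /GRing.scale /=; ring.
Qed.

Lemma rderZ (c : C) f x d : rder f x d -> rder (fun t => c * f t) x (c * d).
Proof.
move=> h; apply: rder_eq (rderM (rder_cst c x) h) _.
by rewrite mul0r add0r.
Qed.

Lemma rderN f x d : rder f x d -> rder (fun t => - f t) x (- d).
Proof.
move=> h; apply: (rder_ext (f := fun t => -1 * f t)).
  by move=> t; rewrite mulN1r.
by rewrite -[- d]mulN1r; exact: rderZ.
Qed.

Lemma rderB f g x d e : rder f x d -> rder g x e ->
  rder (fun t => f t - g t) x (d - e).
Proof. by move=> h1 h2; apply: rderD => //; exact: rderN. Qed.

Lemma rder_real (u : R -> R) (x d : R) : is_derive x 1 u d ->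
  rder (fun t => ((u t)%:C)%C) x ((d%:C)%C).
Proof. by move=> h; split => //=; exact: is_derive_cst. Qed.

Lemma is_derive_cont (u : R -> R) (x d : R) : is_derive x 1 u d ->
  {for x, continuous u}.
Proof. by move=> h; apply: differentiable_continuous; apply/derivable1_diffP. Qed.

(** A mean value inequality: project [f] on the direction of [f b - f a] and
    apply the real mean value theorem. *)
Lemma rder_mean_value f (f' : R -> C) (a b M : R) : a <= b ->
  (forall x, a <= x <= b -> rder f x (f' x)) ->
  (forall x, a <= x <= b -> normc (f' x) <= M) ->
  normc (f b - f a) <= M * (b - a).
Proof.
move=> ab df bf; set u := f b - f a.
pose g t := complex.Re u * complex.Re (f t) + complex.Im u * complex.Im (f t).
pose g' t := complex.Re u * complex.Re (f' t) + complex.Im u * complex.Im (f' t).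
have dg x : a <= x <= b -> is_derive x 1 g (g' x).
  move=> /df[h1 h2]; apply: is_derive_eq.
  by rewrite /g' /GRing.scale /=; ring.
have [c cab] : exists2 c, c \in `[a, b] & g b - g a = g' c * (b - a).
  apply: MVT_segment => // [x|].
    by rewrite in_itv /= => /andP[/ltW xa /ltW xb]; apply: dg; rewrite xa xb.
  apply: continuous_in_subspaceT => x /set_mem; rewrite /= in_itv /= => xab.
  by apply: is_derive_cont; exact: dg.
have -> : g b - g a = normc u ^+ 2.
  rewrite /g /u; case: (f b) (f a) => [p q] [p' q'] /=.
  rewrite sqr_sqrtr ?addr_ge0 ?sqr_ge0 //; ring.
move=> h.
have : g' c <= normc u * normc (f' c).
  have -> : g' c = complex.Re (conjc u * f' c).
    by rewrite Re_mul /g'; case: (u) => p q /=; ring.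
  by rewrite -[normc u]normc_conj -normcM (le_trans (ler_norm _)) // normc_Re.
move: cab; rewrite in_itv /= => /bf hM hg.
have [->|u0] := eqVneq (normc u) 0.
  by rewrite mulr_ge0 ?subr_ge0 // (le_trans (normc_ge0 _) hM).
have u1 : 0 < normc u by rewrite lt_def u0 normc_ge0.
rewrite -(ler_pM2l u1) -expr2 h mulrA ler_wpM2r ?subr_ge0 //.
by rewrite (le_trans hg) // ler_wpM2l // ltW.
Qed.

Lemma rder_cont f x d : rder f x d ->
  forall e : R, 0 < e -> exists2 dl : R, 0 < dl &
    forall t, `|t - x| < dl -> normc (f t - f x) < e.
Proof.
move=> [/is_derive_cont c1 /is_derive_cont c2] e e0.
have e2 : 0 < e / 2 by rewrite divr_gt0.
move/cvgrPdist_lt : c1 => /(_ _ e2)/nbhs_normP[d1 /= d10 h1].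
move/cvgrPdist_lt : c2 => /(_ _ e2)/nbhs_normP[d2 /= d20 h2].
exists (Num.min d1 d2); first by rewrite lt_min d10 d20.
move=> t; rewrite lt_min distrC => /andP[t1 t2].
rewrite (le_lt_trans (normc_le _)) // (splitr e) !(Re_add, Re_opp, Im_add, Im_opp).
by rewrite ltrD // distrC; [exact: h1|exact: h2].
Qed.

End RealDerivative.

Section ComplexExponential.
Context {R : realType}.
Local Notation C := R[i].
Implicit Types z w h : C.

Lemma cexpD z w : cexp (z + w) = cexp z * cexp w.
Proof.
case: z w => [a b] [c d]; rewrite /cexp /= expRD cosD sinD.
by apply: complex_eq; rewrite !(Re_mul, Im_mul) /=; ring.
Qed.

Lemma cexp0 : cexp (0 : C) = 1.
Proof. by rewrite /cexp /= expR0 cos0 sin0 mul1r. Qed.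

Lemma cexpNM z : cexp (- z) * cexp z = 1.
Proof. by rewrite -cexpD addNr cexp0. Qed.

Lemma cexp_neq0 z : cexp z != 0.
Proof.
apply/eqP => h; have := cexpNM z; rewrite h mulr0 => /eqP.
by rewrite eq_sym oner_eq0.
Qed.

Lemma cexpN z : cexp (- z) = (cexp z)^-1.
Proof. by apply: (mulIf (cexp_neq0 z)); rewrite cexpNM mulVf ?cexp_neq0. Qed.

Lemma cexp_sum (I : Type) (r : seq I) (P : pred I) (F : I -> C) :
  cexp (\sum_(i <- r | P i) F i) = \prod_(i <- r | P i) cexp (F i).
Proof.
elim/big_rec2: _ => [|i x y _ <-]; first by rewrite cexp0.
by rewrite cexpD.
Qed.

Lemma cexpMn z n : cexp (z *+ n) = cexp z ^+ n.
Proof. by elim: n => [|n ih]; rewrite ?mulr0n ?cexp0 // mulrS exprS cexpD ih. Qed.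

Lemma normc_cexp z : normc (cexp z) = expR (complex.Re z).
Proof.
rewrite /cexp normcM normcR ger0_norm ?expR_ge0 //.
by rewrite /normc /= cos2Dsin2 sqrtr1 mulr1.
Qed.

Lemma cexpR (x : R) : cexp ((x%:C)%C) = ((expR x)%:C)%C.
Proof. by rewrite /cexp /= cos0 sin0 mulr1. Qed.

Lemma rder_cexp h (t : R) :
  rder (fun t : R => cexp ((t%:C)%C * h)) t (h * cexp ((t%:C)%C * h)).
Proof.
case: h => a b.
pose ea t := expR (a * t); pose cb t := cos (b * t); pose sb t := sin (b * t).
have dlin (c : R) : is_derive t 1 (fun t => c * t) c.
  by apply: is_derive_eq (is_deriveZ c (is_derive_id t 1)) _; rewrite /GRing.scale /= mulr1.
have dea : is_derive t 1 ea (ea t * a).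
  by have -> : ea = expR \o (fun t => a * t) by []; exact: is_derive1_comp.
have dcb : is_derive t 1 cb (- sb t * b).
  by have -> : cb = cos \o (fun t => b * t) by []; exact: is_derive1_comp.
have dsb : is_derive t 1 sb (cb t * b).
  by have -> : sb = sin \o (fun t => b * t) by []; exact: is_derive1_comp.
have E u : cexp ((u%:C)%C * (a +i* b)%C) = (ea u * cb u +i* (ea u * sb u))%C.
  rewrite /cexp !(Re_mul, Im_mul) /= !mul0r subr0 addr0 [u * a]mulrC [u * b]mulrC.
  by apply: complex_eq; rewrite !(Re_mul, Im_mul) /= /ea /cb /sb; ring.
split.
  under [X in is_derive _ _ X _]funext => u do rewrite E /=.
  apply: is_derive_eq.
  by rewrite E Re_mul /GRing.scale /=; ring.
under [X in is_derive _ _ X _]funext => u do rewrite E /=.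
apply: is_derive_eq.
by rewrite E Im_mul /GRing.scale /=; ring.
Qed.

Lemma normc_cexp_le h : normc (cexp h) <= expR (normc h).
Proof. by rewrite normc_cexp ler_expR (le_trans (ler_norm _)) // normc_Re. Qed.

(** Both estimates bound the increment of a function of $t$ along the segment
    from $0$ to [h], by the mean value inequality. *)
Lemma cexp_sub1_le h : normc (cexp h - 1) <= normc h * expR (normc h).
Proof.
pose f (t : R) := cexp ((t%:C)%C * h).
have -> : cexp h - 1 = f 1 - f 0 by rewrite /f rmorph1 rmorph0 !mul1r !mul0r cexp0.
have -> : normc h * expR (normc h) = normc h * expR (normc h) * (1 - 0).
  by rewrite subr0 mulr1.
apply: (@rder_mean_value R f (fun t => h * cexp ((t%:C)%C * h))) => // t.
  by move=> _; exact: rder_cexp.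
move=> /andP[t0 t1]; rewrite normcM ler_wpM2l ?normc_ge0 //.
rewrite (le_trans (normc_cexp_le _)) // ler_expR normcM normcR ger0_norm //.
by rewrite -[leRHS]mul1r ler_wpM2r ?normc_ge0.
Qed.

Lemma cexp_sub1_sub_le h :
  normc (cexp h - 1 - h) <= normc h ^+ 2 * expR (normc h).
Proof.
pose f (t : R) := cexp ((t%:C)%C * h) - (t%:C)%C * h.
have -> : cexp h - 1 - h = f 1 - f 0 by rewrite /f rmorph1 rmorph0 !mul1r !mul0r cexp0; ring.
have -> : normc h ^+ 2 * expR (normc h) = normc h ^+ 2 * expR (normc h) * (1 - 0).
  by rewrite subr0 mulr1.
apply: (@rder_mean_value R f (fun t => h * (cexp ((t%:C)%C * h) - 1))) => // t.
  move=> _; apply: rder_eq; last first.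
    instantiate (1 := h * cexp ((t%:C)%C * h) - h); by rewrite mulrBr mulr1.
  apply: rderB; first exact: rder_cexp.
  apply: (rder_ext (f := fun t : R => h * (t%:C)%C)) => [u|]; first by rewrite mulrC.
  by apply: rder_eq (rderZ h (rder_id t)) _; rewrite mulr1.
move=> /andP[t0 t1]; rewrite normcM expr2 -mulrA ler_wpM2l ?normc_ge0 //.
rewrite (le_trans (cexp_sub1_le _)) //.
have th : normc ((t%:C)%C * h) <= normc h.
  by rewrite normcM normcR ger0_norm // -[leRHS]mul1r ler_wpM2r ?normc_ge0.
by apply: ler_pM; rewrite ?normc_ge0 ?expR_ge0 // ler_expR.
Qed.

End ComplexExponential.

(** * Integrals of continuous functions of a real variable *)

Definition rcont {R : realType} (f : R -> R[i]) :=
  forall x e, 0 < e -> exists2 d : R, 0 < d &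
    forall t, `|t - x| < d -> normc (f t - f x) < e.

Section Primitive.
Context {R : realType}.
Local Notation C := R[i].
Implicit Types f g : R -> C.

Lemma rcont_Re f : rcont f -> continuous (fun t => complex.Re (f t)).
Proof.
move=> fc x; apply/cvgrPdist_lt => e e0; have [d d0 h] := fc x e e0.
apply/nbhs_normP; exists d => //= t /=; rewrite distrC => /h.
by rewrite -Re_opp -Re_add normc_distC; apply: le_lt_trans; exact: normc_Re.
Qed.

Lemma rcont_Im f : rcont f -> continuous (fun t => complex.Im (f t)).
Proof.
move=> fc x; apply/cvgrPdist_lt => e e0; have [d d0 h] := fc x e e0.
apply/nbhs_normP; exists d => //= t /=; rewrite distrC => /h.
by rewrite -Im_opp -Im_add normc_distC; apply: le_lt_trans; exact: normc_Im.
Qed.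

Lemma rcont_cst (c : C) : rcont (fun _ : R => c).
Proof. by move=> x e e0; exists 1 => // t _; rewrite subrr normc0. Qed.

Lemma rcontD f g : rcont f -> rcont g -> rcont (fun t => f t + g t).
Proof.
move=> fc gc x e e0; have e2 : 0 < e / 2 by rewrite divr_gt0.
have [d1 d10 h1] := fc x _ e2; have [d2 d20 h2] := gc x _ e2.
exists (Num.min d1 d2); first by rewrite lt_min d10 d20.
move=> t; rewrite lt_min => /andP[/h1 l1 /h2 l2].
by rewrite opprD addrACA (le_lt_trans (ler_normcD _ _)) // (splitr e) ltrD.
Qed.

Lemma rcontM f g : rcont f -> rcont g -> rcont (fun t => f t * g t).
Proof.
move=> fc gc x e e0.
pose A := normc (f x) + 1; pose B := normc (g x) + 1.
have A0 : 0 < A by rewrite ltr_wpDl // normc_ge0.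
have B0 : 0 < B by rewrite ltr_wpDl // normc_ge0.
have [d1 d10 h1] := fc x (e / 2 / B) ltac:(by rewrite !divr_gt0).
have [d2 d20 h2] := gc x (Num.min 1 (e / 2 / A)) ltac:(by rewrite lt_min ltr01 !divr_gt0).
exists (Num.min d1 d2); first by rewrite lt_min d10 d20.
move=> t; rewrite lt_min => /andP[/h1 l1 /h2]; rewrite lt_min => /andP[l2 l3].
have -> : f t * g t - f x * g x = (f t - f x) * g t + f x * (g t - g x) by ring.
have gB : normc (g t) <= B.
  have -> : g t = g x + (g t - g x) by ring.
  by rewrite (le_trans (ler_normcD _ _)) // /B lerD2l ltW.
rewrite (le_lt_trans (ler_normcD _ _)) // !normcM (splitr e) ltr_leD //.
  rewrite (@le_lt_trans _ _ (normc (f t - f x) * B)) ?ler_wpM2l ?normc_ge0 //.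
  by rewrite -ltr_pdivlMr.
rewrite (@le_trans _ _ (A * normc (g t - g x))) //.
  by rewrite ler_wpM2r ?normc_ge0 // /A lerDl.
by rewrite mulrC -ler_pdivlMr // ltW.
Qed.

Lemma rder_rcont f f' : (forall x, rder f x (f' x)) -> rcont f.
Proof. by move=> df x; exact: (rder_cont (df x)). Qed.

Lemma real_primitive_itv (f : R -> R) (a b : R) : continuous f -> a < b ->
  exists F : R -> R, forall x, a < x < b -> is_derive x 1 F (f x).
Proof.
move=> fc ab; eexists => x /andP[ax xb].
have fi : lebesgue_measure.-integrable `[a, b] (EFin \o f).
  apply: continuous_compact_integrable; first exact: segment_compact.
  exact: continuous_subspaceT.
have [h1] := continuous_FTC1_closed xb fi ax (fc x).
rewrite derive1E; exact: DeriveDef h1.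
Qed.

Lemma primitive_unique f (P Q : R -> C) (a b : R) : a <= b ->
  (forall x, a <= x <= b -> rder P x (f x)) ->
  (forall x, a <= x <= b -> rder Q x (f x)) -> P b - P a = Q b - Q a.
Proof.
move=> ab dP dQ; apply/eqP; rewrite -subr_eq0 -normc_eq0 eq_le normc_ge0 andbT.
rewrite -(mul0r (b - a)).
have -> : P b - P a - (Q b - Q a) = (P b - Q b) - (P a - Q a) by ring.
apply: (@rder_mean_value R (fun t => P t - Q t) (fun=> 0)) => // x xab.
  by apply: rder_eq (rderB (dP _ xab) (dQ _ xab)) _; rewrite subrr.
by rewrite normc0.
Qed.

(** Primitives on the growing intervals $(-N, N)$ agree after normalization at
    $0$, so they glue. *)
Lemma primitive_exists f : rcont f -> exists F, forall x, rder F x (f x).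
Proof.
move=> fc.
have HN (N : nat) : exists G : R -> C, forall x, `|x| < N%:R -> rder G x (f x).
  have [->|N0] := eqVneq N 0%N.
    by exists (fun=> 0) => x; rewrite ltNge normr_ge0.
  have ab : - N%:R < N%:R :> R by rewrite gtrN // ltr0n lt0n.
  have [F1 h1] := real_primitive_itv (rcont_Re fc) ab.
  have [F2 h2] := real_primitive_itv (rcont_Im fc) ab.
  exists (fun x => (F1 x +i* F2 x)%C) => x; rewrite ltr_norml => /andP[x1 x2].
  by split=> /=; [apply: h1|apply: h2]; rewrite x1 x2.
have [G hG] := choice HN.
pose N (x : R) := Num.bound `|x|.
have NP (x : R) : `|x| < (N x)%:R.
  exact: archi_boundP (normr_ge0 x).
exists (fun x => G (N x) x - G (N x) 0) => x.
have E t : `|t| < (N x)%:R -> G (N t) t - G (N t) 0 = G (N x) t - G (N x) 0.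
  move=> tx; have [t0|t0] := leP 0 t.
    apply: (primitive_unique (f := f) t0) => y /andP[y0 yt]; apply: hG.
      by rewrite ger0_norm // (le_lt_trans yt) // (le_lt_trans (ler_norm _)).
    by rewrite ger0_norm // (le_lt_trans yt) // (le_lt_trans (ler_norm _)).
  rewrite -[LHS]opprB -[RHS]opprB; congr (- _).
  have yN y : t <= y <= 0 -> `|y| <= `|t|.
    by move=> /andP[y0 yt]; rewrite !ler0_norm ?lerN2 // ltW.
  by apply: (primitive_unique (f := f) (ltW t0)) => y yt; apply: hG;
    rewrite (le_lt_trans (yN _ yt)).
have d1 : rder (fun t => G (N x) t - G (N x) 0) x (f x).
  by apply: rder_eq (rderB (hG _ _ (NP x)) (rder_cst _ _)) _; rewrite subr0.
have near_x : \forall t \near x, `|t| < (N x)%:R.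
  apply/nbhs_normP; exists ((N x)%:R - `|x|) => /=; first by rewrite subr_gt0 NP.
  move=> t /=; rewrite ltrBrDr distrC; apply: le_lt_trans.
  by rewrite -{1}(subrK x t) ler_normD.
case: d1 => d1 d2; split.
  by apply: near_eq_is_derive d1; near=> t; rewrite -E //; near: t.
by apply: near_eq_is_derive d2; near=> t; rewrite -E //; near: t.
Unshelve. all: by end_near.
Qed.

(** Increment of a primitive: for continuous integrands on intervals this spares
    measurability and complex-valued Lebesgue integrals. *)
Definition cint f (a b : R) : C :=
  if pselect (exists F, forall x, rder F x (f x)) is left h
  then projT1 (cid h) b - projT1 (cid h) a else 0.

Lemma cintE f F (a b : R) : (forall x, rder F x (f x)) -> cint f a b = F b - F a.
Proof.
move=> dF; rewrite /cint; case: pselect => [h|[]]; last by exists F.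
case: cid => G dG /=; have [ab|/ltW ba] := leP a b.
  by apply: (primitive_unique (f := f) ab) => x _.
by rewrite -[LHS]opprB -[RHS]opprB; congr (- _); apply: (primitive_unique (f := f) ba) => x _.
Qed.

Lemma cint_cat f (a b c : R) : cint f a b + cint f b c = cint f a c.
Proof. by rewrite /cint; case: pselect => h; [ring|rewrite addr0]. Qed.

Lemma cintD f g a b : rcont f -> rcont g ->
  cint (fun t => f t + g t) a b = cint f a b + cint g a b.
Proof.
move=> /primitive_exists[F dF] /primitive_exists[G dG].
rewrite (cintE _ _ dF) (cintE _ _ dG) (cintE (F := fun t => F t + G t)); first by ring.
by move=> x; exact: rderD.
Qed.

Lemma cintZ (c : C) f a b : rcont f -> cint (fun t => c * f t) a b = c * cint f a b.
Proof.
move=> /primitive_exists[F dF].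
rewrite (cintE _ _ dF) (cintE (F := fun t => c * F t)); first by ring.
by move=> x; exact: rderZ.
Qed.

Lemma cintB f g a b : rcont f -> rcont g ->
  cint (fun t => f t - g t) a b = cint f a b - cint g a b.
Proof.
move=> /primitive_exists[F dF] /primitive_exists[G dG].
rewrite (cintE _ _ dF) (cintE _ _ dG) (cintE (F := fun t => F t - G t)); first by ring.
by move=> x; exact: rderB.
Qed.

Lemma cint_bound f (a b M : R) : rcont f -> a <= b ->
  (forall x, a <= x <= b -> normc (f x) <= M) -> normc (cint f a b) <= M * (b - a).
Proof.
move=> /primitive_exists[F dF] ab fM; rewrite (cintE _ _ dF).
by apply: (@rder_mean_value R F f).
Qed.

Lemma eq_cint f g a b : f =1 g -> cint f a b = cint g a b.
Proof. by move=> /funext ->. Qed.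

End Primitive.

(** * Cauchy integrals *)

Lemma nested_intervals {R : realType} (a b : nat -> R) :
  (forall n, a n <= a n.+1) -> (forall n, b n.+1 <= b n) ->
  (forall n, a n <= b n) -> exists x, forall n, a n <= x <= b n.
Proof.
move=> ha hb hab.
have ma n m : (n <= m)%N -> a n <= a m by apply: (nondecreasing_seqP a).1.
have mb n m : (n <= m)%N -> b m <= b n by apply: (nonincreasing_seqP b).1.
have amb n m : a n <= b m.
  rewrite (le_trans (ma _ _ (leq_maxl n m))) // (le_trans (hab _)) //.
  by rewrite mb // leq_maxr.
have ne : (range a) !=set0 by exists (a 0%N); exists 0%N.
exists (sup (range a)) => n; apply/andP; split.
  apply: sup_ubound; last by exists n.
  by exists (b 0%N) => _ [m _ <-].
by apply: sup_le_ub => // _ [m _ <-].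
Qed.

Section RectangleBoundary.
Context {R : realType}.
Local Notation C := R[i].
Variables p q : R -> R -> C.

(** The integral of the form $p\,ds + q\,dy$ over the boundary of the rectangle
    $[a, b] \times [c, d]$. *)
Definition bdint (a b c d : R) : C :=
  cint (p^~ c) a b + cint (q b) c d - cint (p^~ d) a b - cint (q a) c d.

Lemma bdint_split_s a m b c d :
  bdint a b c d = bdint a m c d + bdint m b c d.
Proof.
rewrite /bdint -(cint_cat (p^~ c) a m b) -(cint_cat (p^~ d) a m b); ring.
Qed.

Lemma bdint_split_y a b c m d :
  bdint a b c d = bdint a b c m + bdint a b m d.
Proof.
rewrite /bdint -(cint_cat (q a) c m d) -(cint_cat (q b) c m d); ring.
Qed.

(** Goursat's bisection: a rectangle with nonzero boundary integral contains
    arbitrarily small ones whose integral is of the order of their area. *)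
Lemma bdint_eq0 (s1 s2 y1 y2 : R) : s1 < s2 -> y1 < y2 ->
  (forall s0 y0, s1 <= s0 <= s2 -> y1 <= y0 <= y2 ->
    forall e, 0 < e -> exists2 dl : R, 0 < dl & forall a b c d,
      s1 <= a -> a <= s0 <= b -> b <= s2 ->
      y1 <= c -> c <= y0 <= d -> d <= y2 -> (b - a) + (d - c) < dl ->
      normc (bdint a b c d) <= e * ((b - a) + (d - c)) ^+ 2) ->
  bdint s1 s2 y1 y2 = 0.
Proof.
move=> s12 y12 loc; apply/eqP/negPn/negP => B0.
pose h n : R := (s2 - s1) / 2 ^+ n; pose k n : R := (y2 - y1) / 2 ^+ n.
have p2 n : 0 < (2 : R) ^+ n by rewrite exprn_gt0.
have hS n : h n = h n.+1 + h n.+1.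
  by rewrite /h exprS; field; rewrite expf_neq0.
have kS n : k n = k n.+1 + k n.+1.
  by rewrite /k exprS; field; rewrite expf_neq0.
have h0 n : 0 < h n by rewrite divr_gt0 // subr_gt0.
have k0 n : 0 < k n by rewrite divr_gt0 // subr_gt0.
pose cell n (P : R * R) := bdint P.1 (P.1 + h n) P.2 (P.2 + k n).
have step (nP : nat * (R * R)) : exists Q : R * R,
    [/\ nP.2.1 <= Q.1, Q.1 + h nP.1.+1 <= nP.2.1 + h nP.1,
        nP.2.2 <= Q.2, Q.2 + k nP.1.+1 <= nP.2.2 + k nP.1 &
     normc (cell nP.1 nP.2) <= 4 * normc (cell nP.1.+1 Q)].
  case: nP => n [s y] /=.
  pose M1 := cell n.+1 (s, y); pose M2 := cell n.+1 (s + h n.+1, y).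
  pose M3 := cell n.+1 (s, y + k n.+1).
  pose M4 := cell n.+1 (s + h n.+1, y + k n.+1).
  (* one of the four quarters carries a quarter of the integral *)
  have E : cell n (s, y) = M1 + M2 + (M3 + M4).
    rewrite /M1 /M2 /M3 /M4 /cell /= (hS n) (kS n) (addrA s) (addrA y).
    rewrite (bdint_split_s _ (s + h n.+1)) (bdint_split_y s _ _ (y + k n.+1)).
    rewrite (bdint_split_y (s + h n.+1) _ _ (y + k n.+1)).
    by rewrite addrACA.
  have hn := h0 n.+1; have kn := k0 n.+1; have hs := hS n; have ks := kS n.
  have [l1|l1] := leP (normc (cell n (s, y))) (4 * normc M1).
    by exists (s, y); split => //=; lra.
  have [l2|l2] := leP (normc (cell n (s, y))) (4 * normc M2).
    by exists (s + h n.+1, y); split => //=; lra.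
  have [l3|l3] := leP (normc (cell n (s, y))) (4 * normc M3).
    by exists (s, y + k n.+1); split => //=; lra.
  exists (s + h n.+1, y + k n.+1); split => //=; [lra|lra|lra|lra|].
  have := ler_normcD (M1 + M2) (M3 + M4); rewrite -E.
  have := ler_normcD M1 M2; have := ler_normcD M3 M4.
  by rewrite -/M4; lra.
have [nxt nxtP] := choice step.
pose u := fix u n := if n is m.+1 then nxt (m, u m) else (s1, y1).
have uP n := nxtP (n, u n).
have [s0 s0P] : exists x, forall n, (u n).1 <= x <= (u n).1 + h n.
  apply: nested_intervals => n; first by case: (uP n).
    by case: (uP n).
  by rewrite lerDl ltW.
have [y0 y0P] : exists x, forall n, (u n).2 <= x <= (u n).2 + k n.
  apply: nested_intervals => n; first by case: (uP n).
    by case: (uP n).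
  by rewrite lerDl ltW.
have inS n : s1 <= (u n).1 /\ (u n).1 + h n <= s2.
  elim: n => [|n [ih1 ih2]]; first by rewrite /= /h expr0 divr1; split; lra.
  by case: (uP n) => /= l1 l2 _ _ _; split; [exact: le_trans l1|exact: le_trans ih2].
have inY n : y1 <= (u n).2 /\ (u n).2 + k n <= y2.
  elim: n => [|n [ih1 ih2]]; first by rewrite /= /k expr0 divr1; split; lra.
  by case: (uP n) => /= _ _ l1 l2 _; split; [exact: le_trans l1|exact: le_trans ih2].
pose B := normc (bdint s1 s2 y1 y2).
have Bpos : 0 < B by rewrite normc_gt0.
have big n : B <= 4 ^+ n * normc (cell n (u n)).
  elim: n => [|n ih].
    rewrite expr0 mul1r /cell /= /h /k expr0 !divr1.
    by rewrite [s1 + _]addrC [y1 + _]addrC !subrK.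
  rewrite (le_trans ih) // exprSr -mulrA ler_wpM2l ?exprn_ge0 //.
  by case: (uP n).
pose D := (s2 - s1) + (y2 - y1).
have D0 : 0 < D by rewrite addr_gt0 // subr_gt0.
have s0in : s1 <= s0 <= s2.
  by have := s0P 0%N; rewrite /= /h expr0 divr1; lra.
have y0in : y1 <= y0 <= y2.
  by have := y0P 0%N; rewrite /= /k expr0 divr1; lra.
have e0 : 0 < B / 2 / D ^+ 2 by rewrite !divr_gt0 // exprn_gt0.
have [dl dl0 hdl] := loc s0 y0 s0in y0in _ e0.
have [n hn] : exists n : nat, D / 2 ^+ n < dl.
  have [n nP] : exists n : nat, D / dl < n%:R.
    by exists (Num.bound (D / dl)); apply: archi_boundP; rewrite divr_ge0 // ltW.
  exists n; rewrite ltr_pdivrMr // mulrC -ltr_pdivrMr // (lt_trans nP) //.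
  by rewrite -natrX ltr_nat ltn_expl.
have sz : (u n).1 + h n - (u n).1 + ((u n).2 + k n - (u n).2) = D / 2 ^+ n.
  by rewrite /h /k /D mulrDl; ring.
have := hdl (u n).1 ((u n).1 + h n) (u n).2 ((u n).2 + k n).
rewrite sz => /(_ (inS n).1 (s0P n) (inS n).2 (inY n).1 (y0P n) (inY n).2 hn).
have := big n; rewrite /cell; set X := normc _ => l1 l2.
have : B <= 4 ^+ n * (B / 2 / D ^+ 2 * (D / 2 ^+ n) ^+ 2).
  by rewrite (le_trans l1) // ler_wpM2l ?exprn_ge0.
have -> : (4 : R) ^+ n = (2 ^+ n) ^+ 2.
  by rewrite -exprM mulnC exprM; congr (_ ^+ _); ring.
have -> : (2 ^+ n) ^+ 2 * (B / 2 / D ^+ 2 * (D / 2 ^+ n) ^+ 2) = B / 2.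
  by field; rewrite !lt0r_neq0.
by have := Bpos; lra.
Qed.

End RectangleBoundary.

(** Complex differentiability in one variable, in epsilon-delta form. *)
Definition cder {R : realType} (f : R[i] -> R[i]) (z d : R[i]) :=
  forall e : R, 0 < e -> exists2 dl : R, 0 < dl &
    forall h, normc h < dl -> normc (f (z + h) - f z - d * h) <= e * normc h.

Section Cauchy.
Context {R : realType}.
Local Notation C := R[i].

Lemma cder_cont (f : C -> C) z d : cder f z d ->
  forall e : R, 0 < e -> exists2 dl : R, 0 < dl &
    forall w, normc (w - z) < dl -> normc (f w - f z) < e.
Proof.
move=> fz e e0; have [dl dl0 hd] := fz 1 ltr01.
have K0 : 0 < 1 + normc d by rewrite ltr_pwDl // normc_ge0.
exists (Num.min dl (e / (1 + normc d))); first by rewrite lt_min dl0 divr_gt0.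
move=> w; rewrite lt_min ltr_pdivlMr // => /andP[l0 l2].
have := hd _ l0; rewrite (addrC z) subrK mul1r => l1; apply: le_lt_trans l2.
have -> : f w - f z = (f w - f z - d * (w - z)) + d * (w - z) by ring.
by rewrite (le_trans (ler_normcD _ _)) // normcM; move: l1; lra.
Qed.

Lemma eq_cint_in (f g : R -> C) a b : rcont f -> rcont g -> a <= b ->
  (forall x, a <= x <= b -> f x = g x) -> cint f a b = cint g a b.
Proof.
move=> fc gc ab fg; apply/eqP; rewrite -subr_eq0 -cintB // -normc_eq0.
rewrite eq_le normc_ge0 andbT -(mul0r (b - a)); apply: cint_bound => //.
  apply: rcontD => // x e e0; have [d d0 h] := gc x e e0.
  by exists d => // t /h; rewrite -opprD normcN.
by move=> x /fg ->; rewrite subrr normc0.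
Qed.

Lemma rcont_comp (f : C -> C) (g : R -> C) :
  (forall t e, 0 < e -> exists2 dl : R, 0 < dl &
    forall w, normc (w - g t) < dl -> normc (f w - f (g t)) < e) ->
  rcont g -> rcont (f \o g).
Proof.
move=> fc gc x e /(fc x)[d d0 h]; have [d' d'0 h'] := gc x d d0.
by exists d' => // t /h' /h.
Qed.

Lemma expR_lip (s t : R) : s <= 0 -> t <= 0 -> `|expR s - expR t| <= `|s - t|.
Proof.
wlog st : s t / s <= t => [H|] s0 t0.
  case: (leP s t) => [st|/ltW st]; first exact: H.
  by rewrite distrC (distrC s); exact: H.
pose g (x : R) : C := ((expR x)%:C)%C.
rewrite distrC (distrC s) (ger0_norm (x := t - s)) ?subr_ge0 //.
have -> : `|expR t - expR s| = normc (g t - g s) by rewrite /g -rmorphB normcR.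
rewrite -[t - s]mul1r; apply: (@rder_mean_value R g g) => // x xst.
  exact: rder_real.
rewrite normcR ger0_norm ?expR_ge0 // -expR0 ler_expR.
by case/andP: xst => _ /le_trans; apply.
Qed.

Section Kernel.
Variables (rho : R) (z : C).
Hypotheses (rho0 : 0 < rho) (zrho : normc z < rho).

Definition ecirc (y : R) : C := cexp ((y%:C)%C * 'i%C).

(** The circle of radius [rho] centered at the origin, seen from [z]. *)
Definition kc (y : R) : C := (rho%:C)%C * ecirc y - z.
Definition dkc (y : R) : C := (rho%:C)%C * ('i%C * ecirc y).

(** $dw / (w - z)$ on this circle. *)
Definition kappa (y : R) : C := dkc y / kc y.

Lemma normc_ecirc y : normc (ecirc y) = 1.
Proof. by rewrite normc_cexp Re_mul /= mulr0 mul0r subr0 expR0. Qed.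

Lemma normc_i : normc ('i%C : C) = 1.
Proof. by rewrite /normc /= expr0n /= add0r expr1n sqrtr1. Qed.

Lemma rder_ecirc y : rder ecirc y ('i%C * ecirc y).
Proof. exact: rder_cexp. Qed.

Lemma rcont_ecirc : rcont ecirc.
Proof. exact: (rder_rcont rder_ecirc). Qed.

Lemma rder_kc y : rder kc y (dkc y).
Proof.
apply: rder_eq (rderB (rderZ _ (rder_ecirc y)) (rder_cst z y)) _.
by rewrite subr0.
Qed.

Lemma rcont_kc : rcont kc.
Proof. exact: (rder_rcont rder_kc). Qed.

Lemma normc_dkc y : normc (dkc y) = rho.
Proof. by rewrite normcM normcM normc_ecirc normc_i normcR gtr0_norm // !mulr1. Qed.

Lemma normc_kc_ge y : rho - normc z <= normc (kc y).
Proof.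
apply: le_trans (ler_dist_normc _ _).
by rewrite normcM normc_ecirc normcR gtr0_norm // mulr1.
Qed.

Lemma normc_kc_le y : normc (kc y) <= 2 * rho.
Proof.
rewrite (le_trans (ler_normcB _ _)) // normcM normc_ecirc normcR gtr0_norm //.
by move: zrho; lra.
Qed.

Lemma kc_neq0 y : kc y != 0.
Proof. by rewrite -normc_gt0 (lt_le_trans _ (normc_kc_ge y)) // subr_gt0. Qed.

Lemma kappa_bound y : normc (kappa y) <= rho / (rho - normc z).
Proof.
rewrite normcM normcV normc_dkc; apply: ler_wpM2l; first exact: ltW.
rewrite lef_pV2 ?normc_kc_ge //.
  by rewrite posrE normc_gt0 kc_neq0.
by rewrite posrE subr_gt0.
Qed.

Lemma rcont_inv (g : R -> C) : (forall x, g x != 0) -> rcont g ->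
  rcont (fun x => (g x)^-1).
Proof.
move=> g0 gc; have := @rcont_comp (fun w => w^-1) g _ gc; apply=> t e e0.
have gt0 : 0 < normc (g t) by rewrite normc_gt0.
exists (Num.min (normc (g t) / 2) (e * normc (g t) ^+ 2 / 2)).
  by rewrite lt_min !divr_gt0 // mulr_gt0 // exprn_gt0.
move=> w; rewrite lt_min => /andP[l1 l2].
have wg : normc (g t) / 2 < normc w.
  have := ler_dist_normc (g t) w; rewrite normc_distC; move: l1; lra.
have w0 : w != 0 by rewrite -normc_gt0 (lt_trans _ wg) // divr_gt0.
have -> : w^-1 - (g t)^-1 = (g t - w) / (w * g t) by field; rewrite w0 g0.
rewrite normcM normcV normcM ltr_pdivrMr ?mulr_gt0 ?normc_gt0 //.
rewrite normc_distC (lt_trans l2) //.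
have -> : e * normc (g t) ^+ 2 / 2 = e * (normc (g t) / 2 * normc (g t)) by ring.
by rewrite ltr_pM2l // ltr_pM2r.
Qed.

Lemma rcont_kappa : rcont kappa.
Proof.
apply: rcontM; last by apply: rcont_inv rcont_kc; exact: kc_neq0.
by do 2 (apply: rcontM; first exact: rcont_cst); exact: rcont_ecirc.
Qed.

End Kernel.
End Cauchy.

Section CauchyTaylor.
Context {R : realType}.
Local Notation C := R[i].
Variables (f : C -> C) (rho r : R).
Hypotheses (rho0 : 0 < rho) (rhor : rho < r).
Hypothesis fd : forall w, normc w < r -> exists d, cder f w d.

Let f_cont w : normc w < r -> forall e : R, 0 < e ->
  exists2 dl : R, 0 < dl & forall w', normc (w' - w) < dl -> normc (f w' - f w) < e.
Proof. by move=> /fd[d]; exact: cder_cont. Qed.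

Section FixedCenter.
Variable z : C.
Hypothesis zrho : normc z < rho.
Local Notation k := (kc rho z).
Local Notation dk := (dkc rho).
Local Notation ka := (kappa rho z).

Let lam (s : R) : C := ((expR (Num.min s 0))%:C)%C.

(** Shrinks the circle of radius [rho] to [z] as [s] decreases from $0$ to
    $-\infty$; the clamp keeps the image inside the disc for every real [s], so
    that the integrands below are continuous on the whole line. *)
Let W s y : C := z + lam s * k y.
(** The pullback of $f(w)\,dw / (w - z)$ by [W] is $P\,ds + Q\,dy$. *)
Let P s y : C := f (W s y).
Let Q s y : C := f (W s y) * ka y.

Lemma lam_le0 s : s <= 0 -> lam s = ((expR s)%:C)%C.
Proof. by move=> s0; rewrite /lam; congr ((expR _)%:C)%C; apply/min_idPl. Qed.

Let W_in s y : normc (W s y) <= rho.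
Proof.
have l0 : 0 <= expR (Num.min s 0) <= 1.
  by rewrite expR_ge0 -expR0 ler_expR ge_min lexx orbT.
have -> : W s y = (((1 - expR (Num.min s 0))%:C)%C) * z +
    lam s * ((rho%:C)%C * ecirc y).
  by rewrite /W /kc /lam rmorphB rmorph1; ring.
rewrite (le_trans (ler_normcD _ _)) // normcM normcM normcM.
rewrite normc_ecirc !normcR mulr1.
rewrite (gtr0_norm rho0) !ger0_norm ?expR_ge0 ?subr_ge0 //; last by case/andP: l0.
set l := expR _ in l0 *; have zr := ltW zrho; have z0 := normc_ge0 z.
case/andP: l0 => l0 l1; have : (1 - l) * normc z <= (1 - l) * rho.
  by rewrite ler_wpM2l // subr_ge0.
by lra.
Qed.

Let W_in' s y : normc (W s y) < r. Proof. exact: le_lt_trans (W_in s y) rhor. Qed.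

Let rcont_lam : rcont lam.
Proof.
move=> x e e0; exists e => // t tx; rewrite -rmorphB normcR.
rewrite (le_lt_trans (expR_lip _ _)) ?ge_min ?lexx ?orbT // (le_lt_trans _ tx) //.
by rewrite /Num.min; case: ifP; case: ifP; rewrite ler_norml => *;
  case: (lerP t x) => *; rewrite ?(ger0_norm, ltr0_norm) ?subr_ge0 ?subr_lt0 //; lra.
Qed.

Let rcont_P y : rcont (P^~ y).
Proof.
apply: (@rcont_comp R f (W^~ y)); first by move=> t; exact: f_cont.
by apply: rcontD (rcont_cst _) _; apply: rcontM rcont_lam (rcont_cst _).
Qed.

Let rcont_Q s : rcont (Q s).
Proof.
apply: rcontM; last exact: rcont_kappa.
apply: (@rcont_comp R f (W s)); first by move=> t; exact: f_cont.
by apply: rcontD (rcont_cst _) _; apply: rcontM (rcont_cst _) (rcont_kc _ _).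
Qed.

Let K := rho / (rho - normc z).
Let K0 : 0 < K. Proof. by rewrite divr_gt0 // subr_gt0. Qed.

Let W_lip s y s0 y0 : s <= 0 -> s0 <= 0 ->
  normc (W s y - W s0 y0) <= 2 * rho * (`|s - s0| + `|y - y0|).
Proof.
move=> sle s0le.
have -> : W s y - W s0 y0 = (lam s - lam s0) * k y + lam s0 * (k y - k y0).
  by rewrite /W; ring.
rewrite (le_trans (ler_normcD _ _)) // [X in _ <= X]mulrDr lerD // normcM.
  rewrite mulrC ler_pM ?normc_ge0 ?normc_kc_le // !lam_le0 // -rmorphB normcR.
  exact: expR_lip.
rewrite lam_le0 // normcR ger0_norm ?expR_ge0 //.
apply: (@le_trans _ _ (1 * normc (k y - k y0))).
  by rewrite ler_wpM2r ?normc_ge0 // -expR0 ler_expR.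
rewrite mul1r; have kl u v : u <= v -> normc (k v - k u) <= rho * (v - u).
  move=> uv; apply: (@rder_mean_value R k dk) => // x _; first exact: rder_kc.
  by rewrite normc_dkc.
apply: (@le_trans _ _ (rho * `|y - y0|)); last first.
  by rewrite ler_wpM2r //; move: rho0; lra.
have [yy|/ltW yy] := leP y0 y; first by rewrite ger0_norm ?subr_ge0 // kl.
have -> : `|y - y0| = y0 - y by rewrite ler0_norm ?subr_le0 // opprB.
by rewrite normc_distC kl.
Qed.

(** The pullback of $(\alpha + \beta (w - z))\,dw / (w - z)$ has an explicit primitive,
    for any primitive of [kappa] on the line. *)
Let affine_null al be a b c d : a <= b -> b <= 0 ->
  bdint (fun s y => al + be * (lam s * k y))
        (fun s y => al * ka y + be * (lam s * dk y)) a b c d = 0.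
Proof.
move=> ab b0.
have a0 : a <= 0 := le_trans ab b0.
have [Ka dKa] := primitive_exists (rcont_kappa rho0 zrho).
have Es y : cint (fun s => al + be * (lam s * k y)) a b =
    al * ((b - a)%:C)%C + be * (((expR b)%:C)%C - ((expR a)%:C)%C) * k y.
  pose g s : C := al + be * (((expR s)%:C)%C * k y).
  have dg x : rder (fun s => al * (s%:C)%C + be * (((expR s)%:C)%C * k y)) x (g x).
    apply: rder_eq; first apply: rderD; first exact: rderZ (rder_id x).
      apply: rderZ; apply: rderM (rder_cst _ _); first exact: rder_real.
    by rewrite /g; ring.
  rewrite (@eq_cint_in R _ g).
  - by rewrite (cintE _ _ dg) !rmorphB /=; ring.
  - apply: rcontD (rcont_cst _) _; apply: rcontM (rcont_cst _) _.
    exact: rcontM rcont_lam (rcont_cst _).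
  - apply: rcontD (rcont_cst _) _; apply: rcontM (rcont_cst _) _.
    apply: rcontM (rcont_cst _); apply: (rder_rcont (f' := fun x => ((expR x)%:C)%C)).
    by move=> x; exact: rder_real.
  - exact: ab.
  by move=> x /andP[_ xb]; rewrite /g lam_le0 // (le_trans xb).
have Ey s : cint (fun y => al * ka y + be * (lam s * dk y)) c d =
    al * (Ka d - Ka c) + be * lam s * (k d - k c).
  rewrite (cintE (F := fun y => al * Ka y + be * (lam s * k y))); first by ring.
  move=> x; apply: rderD; apply: rderZ => //; apply: rderZ; exact: rder_kc.
rewrite /bdint !Es !Ey !lam_le0 //; ring.
Qed.

(** Goursat: near each point [f] is affine up to $o(w - w_0)$, and the affine part
    contributes nothing. *)
Let bdint_PQ_eq0 S : S < 0 -> bdint P Q S 0 0 (2 * pi) = 0.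
Proof.
move=> S0; apply: bdint_eq0 => //; first by rewrite mulr_gt0 // pi_gt0.
move=> s0 y0 /andP[_ s0le] _ e e0.
have [d0 fd0] := fd (W_in' s0 y0).
set w0 := W s0 y0 in fd0.
pose L := 2 * rho.
have L0 : 0 < L by rewrite mulr_gt0.
pose e' := e / (2 * L * (1 + K)).
have e'0 : 0 < e' by rewrite divr_gt0 // !mulr_gt0 // addr_gt0.
have [dl dl0 hdl] := fd0 _ e'0.
exists (dl / L); first by rewrite divr_gt0.
move=> a b c d Sa /andP[as0 s0b] b0 c0 /andP[cy y0d] dpi sz.
have ab : a <= b := le_trans as0 s0b.
have cd : c <= d := le_trans cy y0d.
pose D := (b - a) + (d - c).
pose E w := f w - f w0 - d0 * (w - w0).
pose al := f w0 - d0 * w0 + d0 * z.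
have EP s y : P s y = (al + d0 * (lam s * k y)) + E (W s y).
  by rewrite /P /E /al /W; ring.
have EQ s y : Q s y = (al * ka y + d0 * (lam s * dk y)) + E (W s y) * ka y.
  have kk : ka y * k y = dk y by rewrite /kappa divfK // (kc_neq0 rho0 zrho).
  by rewrite -kk /Q /E /al /W; ring.
have cE1 y : rcont (fun s => E (W s y)).
  apply: (rcontD (f := fun s => P s y - f w0) (g := fun s => - (d0 * (W s y - w0)))).
    by apply: rcontD (rcont_P y) (rcont_cst _).
  have -> : (fun s => - (d0 * (W s y - w0))) = fun s => (- d0 * (z - w0)) + (- d0 * k y) * lam s.
    by apply/funext => s; rewrite /W; ring.
  by apply: rcontD (rcont_cst _) _; apply: rcontM (rcont_cst _) rcont_lam.
have cE2 s : rcont (fun y => E (W s y) * ka y).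
  have -> : (fun y => E (W s y) * ka y) =
      fun y => Q s y + (al * (-1 * ka y) + (- d0 * lam s) * dk y).
    by apply/funext => y; rewrite EQ; ring.
  apply: rcontD (rcont_Q s) _; apply: rcontD; apply: rcontM (rcont_cst _) _.
    by apply: rcontM (rcont_cst _) (rcont_kappa rho0 zrho).
  by do 2 (apply: rcontM (rcont_cst _) _); exact: rcont_ecirc.
have cA1 y : rcont (fun s => al + d0 * (lam s * k y)).
  apply: rcontD (rcont_cst _) _; apply: rcontM (rcont_cst _) _.
  exact: rcontM rcont_lam (rcont_cst _).
have cA2 s : rcont (fun y => al * ka y + d0 * (lam s * dk y)).
  apply: rcontD; first exact: rcontM (rcont_cst _) (rcont_kappa rho0 zrho).
  by do 4 (apply: rcontM (rcont_cst _) _); exact: rcont_ecirc.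
have -> : bdint P Q a b c d =
    bdint (fun s y => al + d0 * (lam s * k y))
        (fun s y => al * ka y + d0 * (lam s * dk y)) a b c d +
    bdint (fun s y => E (W s y)) (fun s y => E (W s y) * ka y) a b c d.
  have IP y : cint (P^~ y) a b = cint (fun s => al + d0 * (lam s * k y)) a b +
      cint (fun s => E (W s y)) a b.
    by rewrite -cintD //; apply: eq_cint => s; exact: EP.
  have IQ s : cint (Q s) c d = cint (fun y => al * ka y + d0 * (lam s * dk y)) c d +
      cint (fun y => E (W s y) * ka y) c d.
    by rewrite -cintD //; apply: eq_cint => y; exact: EQ.
  by rewrite /bdint !IP !IQ; ring.
rewrite affine_null // add0r.
have D0 : 0 <= D by rewrite addr_ge0 // subr_ge0.
have Ebd s y : a <= s <= b -> c <= y <= d -> normc (E (W s y)) <= e' * L * D.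
  move=> /andP[sa sb] /andP[yc yd].
  have near : `|s - s0| + `|y - y0| <= D.
    by rewrite /D lerD // ler_norml; apply/andP; split; lra.
  have wl : normc (W s y - w0) <= L * D.
    rewrite (le_trans (W_lip _ _ _ _)) ?(le_trans sb) // /L ler_wpM2l //.
    exact: ltW.
  have := hdl (W s y - w0); rewrite (addrC w0) subrK => /(_ _)/le_trans; apply.
    by rewrite (le_lt_trans wl) // mulrC -ltr_pdivlMr.
  by rewrite -mulrA ler_pM2l.
have b1 y : c <= y <= d -> normc (cint (fun s => E (W s y)) a b) <= e' * L * D * (b - a).
  by move=> yy; apply: cint_bound => // s ss; exact: Ebd.
have b2 s : a <= s <= b -> normc (cint (fun y => E (W s y) * ka y) c d) <= e' * L * D * K * (d - c).
  move=> ss; apply: cint_bound => // y yy; rewrite normcM.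
  by apply: ler_pM; rewrite ?normc_ge0 ?Ebd // kappa_bound.
rewrite /bdint (le_trans (ler_normcB _ _)) //.
have := ler_normcB (cint (fun s => E (W s c)) a b + cint (fun y => E (W b y) * ka y) c d)
  (cint (fun s => E (W s d)) a b).
have := ler_normcD (cint (fun s => E (W s c)) a b) (cint (fun y => E (W b y) * ka y) c d).
have := b1 c ltac:(by rewrite lexx cd); have := b1 d ltac:(by rewrite lexx cd).
have := b2 a ltac:(by rewrite lexx ab); have := b2 b ltac:(by rewrite lexx ab).
set X1 := normc _; set X2 := normc _; set X3 := normc _; set X4 := normc _.
set X5 := normc _; set X6 := normc _ => l1 l2 l3 l4 l5 l6.
have : e * D ^+ 2 = e' * L * D * (2 * (1 + K) * D).
  by rewrite /e'; field; rewrite !gt_eqF // addr_gt0.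
rewrite -/D => ->.
have : e' * L * D * (2 * (b - a) + 2 * K * (d - c)) <= e' * L * D * (2 * (1 + K) * D).
  apply: ler_wpM2l; first by rewrite mulr_ge0 // mulr_ge0 // ltW.
  have k0 := ltW K0; have : 0 <= K * (b - a) by rewrite mulr_ge0 // subr_ge0.
  rewrite /D; have : 0 <= d - c by rewrite subr_ge0.
  by lra.
by lra.
Qed.

(** Cauchy's integral formula, up to the value of the integral of [kappa], which
    Taylor's expansion will provide: the integral over the circle equals that
    over the circle shrunk by the factor $e^S$, for every $S < 0$, and the latter
    tends to the right-hand side as $S \to -\infty$. *)
Lemma cauchy_kernel :
  cint (fun y => f ((rho%:C)%C * ecirc y) * ka y) 0 (2 * pi) =
  f z * cint ka 0 (2 * pi).
Proof.
have per S : W S (2 * pi) = W S 0.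
  rewrite /W /kc; congr (_ + _ * (_ * _ - _)).
  by rewrite /ecirc /cexp !(Re_mul, Im_mul) /= !(mul0r, mulr0, mulr1, add0r, subr0, addr0)
    mulr_natl cos2pi sin2pi cos0 sin0.
have W0 y : W 0 y = (rho%:C)%C * ecirc y.
  by rewrite /W lam_le0 // expR0 mul1r /kc; ring.
have main S : S < 0 -> cint (Q 0) 0 (2 * pi) = cint (Q S) 0 (2 * pi).
  move=> /bdint_PQ_eq0; rewrite /bdint.
  have -> : P^~ (2 * pi) = P^~ 0 by apply/funext => s; rewrite /P per.
  by move/eqP; rewrite [_ + cint (Q 0) _ _]addrC addrK subr_eq0 => /eqP.
have E0 : (fun y => f ((rho%:C)%C * ecirc y) * ka y) = Q 0.
  by apply/funext => y; rewrite /Q W0.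
rewrite E0 -cintZ; last exact: rcont_kappa.
apply/eqP; rewrite -subr_eq0 -normc_eq0 eq_le normc_ge0 andbT.
apply/ler_addgt0Pr => e e0; rewrite add0r.
have pi0 : 0 < 2 * pi :> R by rewrite mulr_gt0 // pi_gt0.
have zr : normc z < r := lt_trans zrho rhor.
have eta0 : 0 < e / (K * (2 * pi)) by rewrite divr_gt0 // mulr_gt0.
have [dl dl0 hdl] := f_cont zr eta0.
(* a circle so small that f varies by less than e / (2 pi K) on it *)
pose S := ln (Num.min (2^-1) (dl / (4 * rho))).
have m0 : 0 < Num.min 2^-1 (dl / (4 * rho)).
  by rewrite lt_min invr_gt0 ltr0n divr_gt0 // mulr_gt0.
have S0 : S < 0 by rewrite ln_lt0 // m0 gt_min invf_lt1 ?ltr1n.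
rewrite (main S S0) -cintB //; last by apply: rcontM (rcont_cst _) (rcont_kappa rho0 zrho).
have -> : e = e / (K * (2 * pi)) * K * (2 * pi - 0).
  by rewrite subr0 -mulrA divfK // mulf_neq0 // lt0r_neq0.
apply: cint_bound; last 2 first.
- exact: ltW.
- move=> y _; rewrite /Q -mulrBl normcM; apply: ler_pM; rewrite ?normc_ge0 //.
    apply/ltW/hdl; rewrite /W addrC addKr normcM lam_le0 ?ltW // normcR.
    rewrite ger0_norm ?expR_ge0 // /S lnK ?posrE //.
    apply: (@le_lt_trans _ _ (dl / (4 * rho) * (2 * rho))).
      apply: ler_pM; rewrite ?normc_ge0 ?normc_kc_le //; first exact: ltW.
      by rewrite ge_min lexx orbT.
    have -> : dl / (4 * rho) * (2 * rho) = dl / 2 by field; rewrite gt_eqF.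
    by rewrite ltr_pdivrMr // mulr_natr mulr2n ltrDl.
  exact: kappa_bound.
apply: rcontD (rcont_Q S) _ => x e1 e10.
have [d d0 h] := rcontM (rcont_cst (- f z)) (rcont_kappa rho0 zrho) x e10.
by exists d => // t /h; rewrite !mulNr.
Qed.

End FixedCenter.
End CauchyTaylor.

(** * Taylor expansions *)

Section Taylor.
Context {R : realType}.
Local Notation C := R[i].

Lemma expr_small (q e : R) : 0 <= q < 1 -> 0 < e ->
  exists N, forall n, (N <= n)%N -> q ^+ n < e.
Proof.
move=> /andP[q0 q1] e0.
have /cvgrPdist_lt/(_ e e0)[N _ h] : (fun n => q ^+ n) @ \oo --> (0 : R).
  by apply: cvg_expr; rewrite ger0_norm.
by exists N => n /h /=; rewrite sub0r normrN ger0_norm // exprn_ge0.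
Qed.

Let v (y : R) : C := ecirc (- y).

Lemma ecircN y : v y * ecirc y = 1.
Proof. by rewrite /v /ecirc rmorphN mulNr cexpNM. Qed.

Lemma rder_vpow n y : rder (fun y => v y ^+ n) y (- ('i%C *+ n) * v y ^+ n).
Proof.
have E t : v t ^+ n = cexp ((t%:C)%C * - ('i%C *+ n)).
  by rewrite /v /ecirc -cexpMn rmorphN; congr cexp; rewrite mulrN mulrnAr mulNr mulNrn.
rewrite E; apply: (rder_ext (f := fun t : R => cexp ((t%:C)%C * - ('i%C *+ n)))).
  by move=> t; rewrite E.
exact: rder_cexp.
Qed.

Lemma rcont_vpow n : rcont (fun y => v y ^+ n).
Proof. exact: (rder_rcont (rder_vpow n)). Qed.

Lemma cint_vpow n : cint (fun y => v y ^+ n) 0 (2 * pi) =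
  if n == 0%N then ((2 * pi)%:C)%C else 0.
Proof.
have [->|n0] := eqVneq n 0%N.
  rewrite (cintE (F := fun t : R => (t%:C)%C)); last first.
    by move=> x; rewrite expr0; exact: rder_id.
  by rewrite -rmorphB subr0.
have i0 : - ('i%C *+ n) != 0 :> C.
  by rewrite oppr_eq0 -mulr_natr mulf_neq0 ?pnatr_eq0 // -normc_eq0 normc_i oner_eq0.
rewrite (cintE (F := fun t : R => (- ('i%C *+ n))^-1 * v t ^+ n)).
  rewrite -mulrBr /v /ecirc /cexp !(Re_mul, Im_mul) /=.
  rewrite !(mul0r, mulr0, mulr1, add0r, subr0, addr0, oppr0) /=.
  by rewrite cosN sinN mulr_natl cos2pi sin2pi cos0 sin0 oppr0 subrr mulr0.
move=> x; apply: rder_eq (rderZ _ (rder_vpow n x)) _.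
by rewrite mulrA mulVf // mul1r.
Qed.

(** Geometric series of the Cauchy kernel: $dw/(w - z)$ is $i\,dy / (1 - z/w)$. *)
Lemma kappa_expand (rho : R) (z : C) (H : R -> C) (B : R) N :
  0 < rho -> normc z < rho -> rcont H -> (forall y, normc (H y) <= B) ->
  normc (cint (fun y => H y * kappa rho z y) 0 (2 * pi) -
    'i%C * \sum_(j < N) (z / (rho%:C)%C) ^+ j * cint (fun y => H y * v y ^+ j) 0 (2 * pi))
  <= B * (normc z / rho) ^+ N / (1 - normc z / rho) * (2 * pi).
Proof.
move=> rho0 zrho cH HB; set u := z / _.
have rc0 : ((rho%:C)%C : C) != 0 by rewrite -normc_gt0 normcR normr_gt0 gt_eqF.
have kE y : kappa rho z y * (1 - u * v y) = 'i%C.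
  have k0 := kc_neq0 rho0 zrho y.
  have ke : kc rho z y = (rho%:C)%C * ecirc y * (1 - u * v y).
    have -> : (rho%:C)%C * ecirc y * (1 - u * v y) =
      (rho%:C)%C * ecirc y - u * (rho%:C)%C * (v y * ecirc y) by ring.
    by rewrite ecircN mulr1 /u divfK.
  apply: (mulfI k0); rewrite mulrA /kappa [kc _ _ _ * _]mulrC divfK //.
  by rewrite ke /dkc; ring.
have gE y : kappa rho z y = 'i%C * (\sum_(j < N) (u * v y) ^+ j) +
    kappa rho z y * (u * v y) ^+ N.
  have := subrX1 (u * v y) N; rewrite -(kE y) => h.
  have -> : kappa rho z y * (1 - u * v y) * (\sum_(j < N) (u * v y) ^+ j) =
     - kappa rho z y * ((u * v y - 1) * (\sum_(j < N) (u * v y) ^+ j)) by ring.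
  by rewrite -h; ring.
have cs n : rcont (fun y => \sum_(j < n) u ^+ j * (H y * v y ^+ j)) /\
   cint (fun y => \sum_(j < n) u ^+ j * (H y * v y ^+ j)) 0 (2 * pi) =
   \sum_(j < n) u ^+ j * cint (fun y => H y * v y ^+ j) 0 (2 * pi).
  elim: n => [|n [ih1 ih2]].
    under eq_fun do rewrite big_ord0.
    split; first exact: rcont_cst.
    by rewrite big_ord0 (cintE (F := fun=> 0)) ?subrr // => x; exact: rder_cst.
  have c1 : rcont (fun y => H y * v y ^+ n) by apply: rcontM cH (rcont_vpow n).
  have c2 : rcont (fun y => u ^+ n * (H y * v y ^+ n)) by apply: rcontM (rcont_cst _) c1.
  under eq_fun do rewrite big_ord_recr /=.
  by split; [exact: rcontD|rewrite cintD // ih2 cintZ // big_ord_recr].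
have [c1 c2] := cs N.
have cS : rcont (fun y => 'i%C * \sum_(j < N) u ^+ j * (H y * v y ^+ j)).
  by apply: rcontM (rcont_cst _) _.
have cHk : rcont (fun y => H y * kappa rho z y) by apply: rcontM cH (rcont_kappa _ _).
rewrite -c2 -cintZ // -cintB // -[2 * pi in leRHS]subr0.
have -> : (fun t => H t * kappa rho z t - 'i%C * (\sum_(j < N) u ^+ j * (H t * v t ^+ j)))
   = fun t => H t * (kappa rho z t * (u * v t) ^+ N).
  apply/funext => t; rewrite {1}gE mulrDr addrAC.
  have -> : \sum_(j < N) u ^+ j * (H t * v t ^+ j) = H t * \sum_(j < N) (u * v t) ^+ j.
    by rewrite mulr_sumr; apply: eq_bigr => j _; rewrite (exprMn_comm j (mulrC u (v t))) mulrCA.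
  by ring.
apply: cint_bound.
- apply: rcontM cH _; apply: rcontM; first exact: rcont_kappa.
  have -> : (fun t => (u * v t) ^+ N) = fun t => u ^+ N * v t ^+ N.
    by apply/funext => t; rewrite exprMn.
  by apply: rcontM (rcont_cst _) (rcont_vpow N).
- by rewrite mulr_ge0 // pi_ge0.
move=> y _; rewrite -mulrA normcM; apply: ler_pM; rewrite ?normc_ge0 // mulrC normcM.
have uv : normc ((u * v y) ^+ N) = (normc z / rho) ^+ N.
  rewrite normcX normcM /v normc_ecirc mulr1 /u normcM normcV normcR ger0_norm //.
  exact: ltW.
rewrite uv; apply: ler_pM; rewrite ?normc_ge0 ?exprn_ge0 //.
  by rewrite divr_ge0 ?normc_ge0 // ltW.
rewrite (le_trans (kappa_bound _ _ _)) //.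
have -> : 1 - normc z / rho = (rho - normc z) / rho by field; rewrite gt_eqF.
by rewrite invf_div.
Qed.

(** The coefficients come from integrating the geometric series of the kernel in
    [cauchy_kernel]; applying the same expansion to the constant $1$ gives the
    value $2 i \pi$ of the integral of [kappa]. *)
Theorem cauchy_taylor (f : C -> C) (rho r A : R) : 0 < rho -> rho < r ->
  (forall w, normc w < r -> exists d, cder f w d) ->
  (forall w, normc w = rho -> normc (f w) <= A) ->
  exists c : nat -> C, (forall k, normc (c k) <= A / rho ^+ k) /\
    forall z, normc z < rho -> forall N,
      normc (f z - \sum_(k < N) c k * z ^+ k) <=
        A * (normc z / rho) ^+ N / (1 - normc z / rho).
Proof.
move=> rho0 rhor fd fA.
pose G y := f ((rho%:C)%C * ecirc y).
have nG y : normc ((rho%:C)%C * ecirc y) = rho.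
  by rewrite normcM normc_ecirc normcR gtr0_norm // mulr1.
have cG : rcont G.
  apply: (@rcont_comp R f (fun y => (rho%:C)%C * ecirc y)); last first.
    by apply: rcontM (rcont_cst _) rcont_ecirc.
  by move=> t; have [d] := fd ((rho%:C)%C * ecirc t) ltac:(by rewrite nG); exact: cder_cont.
have GA y : normc (G y) <= A by rewrite fA.
pose P : C := ((2 * pi)%:C)%C.
have P0 : P != 0 by rewrite -normc_gt0 normcR normr_gt0 mulf_neq0 // gt_eqF // pi_gt0.
have nP : normc P = 2 * pi by rewrite normcR ger0_norm // mulr_ge0 // pi_ge0.
have pi0 : 0 < 2 * pi :> R by rewrite mulr_gt0 // pi_gt0.
have rc0 : ((rho%:C)%C : C) != 0 by rewrite -normc_gt0 normcR normr_gt0 gt_eqF.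
have nr : normc (rho%:C)%C = rho by rewrite normcR gtr0_norm.
pose c j := (rho%:C)%C ^- j * cint (fun y => G y * v y ^+ j) 0 (2 * pi) / P.
exists c; split=> [k|z zr N].
  have := @cint_bound R (fun y => G y * v y ^+ k) 0 (2 * pi) A.
  move=> /(_ _ (ltW pi0)) h.
  rewrite /c !normcM normcV normcV normcX nr nP ler_pdivrMr //.
  rewrite [leRHS]mulrAC [leRHS]mulrC ler_pM2l ?invr_gt0 ?exprn_gt0 //.
  rewrite -[X in A * X]subr0; apply: h; first by apply: rcontM cG (rcont_vpow k).
  by move=> y _; rewrite normcM normcX normc_ecirc expr1n mulr1.
have q01 : 0 <= normc z / rho < 1.
  by rewrite divr_ge0 ?normc_ge0 ?(ltW rho0) //= ltr_pdivrMr // mul1r.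
have ck : cint (kappa rho z) 0 (2 * pi) = 'i%C * P.
  apply/eqP; rewrite -subr_eq0 -normc_eq0 eq_le normc_ge0 andbT.
  apply/ler_addgt0Pr => e e0; rewrite add0r.
  set q := normc z / rho in q01.
  have q1 : 0 < 1 - q by rewrite subr_gt0; case/andP: q01.
  have [M hM] := expr_small q01 (divr_gt0 (mulr_gt0 e0 q1) pi0).
  have := kappa_expand M.+1 rho0 zr (@rcont_cst R 1) (B := 1).
  move=> /(_ (fun y => ltac:(by rewrite normc1))).
  under eq_cint do rewrite mul1r.
  have E j : cint (fun y => 1 * v y ^+ j) 0 (2 * pi) = if j == 0%N then P else 0.
    by rewrite -cint_vpow; apply: eq_cint => y; rewrite mul1r.
  rewrite big_ord_recl expr0 mul1r E /= big1 => [|j _]; last by rewrite E mulr0.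
  rewrite addr0 => /le_trans; apply; rewrite mul1r -/q.
  have := hM M.+1 (leqnSn M); rewrite ltr_pdivlMr // => /ltW h.
  by rewrite mulrAC ler_pdivrMr.
have := cauchy_kernel rho0 rhor fd zr; rewrite ck => fz.
have := kappa_expand N rho0 zr cG GA; rewrite fz.
have -> : f z * ('i%C * P) - 'i%C * (\sum_(j < N) (z / (rho%:C)%C) ^+ j *
    cint (fun y => G y * v y ^+ j) 0 (2 * pi)) =
    'i%C * P * (f z - \sum_(k < N) c k * z ^+ k).
  rewrite mulrBr; congr (_ - _); first by ring.
  rewrite -mulrA; congr (_ * _); rewrite mulr_sumr; apply: eq_bigr => j _.
  have aux (a b p q : C) : p != 0 -> q * a * b = p * (a * b / p * q).
    by move=> p0; field.
  by rewrite /c exprMn exprVn -aux.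
by rewrite normcM normcM normc_i mul1r nP mulrC ler_pM2r.
Qed.

End Taylor.

(** * Holomorphic functions of several variables *)

Section Limits.
Context {R : realType}.
Local Notation C := R[i].
Implicit Types u : nat -> C.

Lemma cvg_normc_le u (l : C) (B : R) : u @ \oo --> l ->
  (forall n, normc (u n) <= B) -> normc l <= B.
Proof.
move=> /cvg_seq_normcP h uB; apply/ler_addgt0Pr => e /h[N /(_ N (leqnn N)) hN].
have -> : l = u N - (u N - l) by ring.
by rewrite (le_trans (ler_normcB _ _)) // lerD // ltW.
Qed.

Lemma cvg_uniqueC u (l l' : C) : u @ \oo --> l -> u @ \oo --> l' -> l = l'.
Proof. by move=> h h'; exact: (cvg_unique (@norm_hausdorff _ _) h h'). Qed.

Lemma cvg_Re_Im u (a b : R) : (fun n => complex.Re (u n)) @ \oo --> a ->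
  (fun n => complex.Im (u n)) @ \oo --> b -> u @ \oo --> (a +i* b)%C.
Proof.
move=> /cvgrPdist_lt ha /cvgrPdist_lt hb; apply/cvg_seq_normcP => e e0.
have e2 : 0 < e / 2 by rewrite divr_gt0.
have [N1 _ h1] := ha _ e2; have [N2 _ h2] := hb _ e2.
exists (maxn N1 N2) => n; rewrite geq_max => /andP[/h1 /= l1 /h2 /= l2].
rewrite (le_lt_trans (normc_le _)) // (splitr e) ltrD //.
  by rewrite Re_add Re_opp distrC.
by rewrite Im_add Im_opp distrC.
Qed.

Lemma bounded_series_cvg (a : nat -> R) (B : R) : (forall k, 0 <= a k) ->
  (forall N, \sum_(k < N) a k <= B) -> exists l : R, (fun N => \sum_(k < N) a k) @ \oo --> l.
Proof.
move=> a0 aB; exists (limn (fun N => \sum_(k < N) a k)).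
apply: nondecreasing_is_cvgn; last by exists B => _ [N _ <-].
apply/nondecreasing_seqP => n; by rewrite big_ord_recr /= lerDl.
Qed.

Lemma abs_series_cvg u (B : R) : (forall N, \sum_(k < N) normc (u k) <= B) ->
  exists l : C, (fun N => \sum_(k < N) u k) @ \oo --> l.
Proof.
move=> uB.
have H (w : nat -> R) : (forall k, `|w k| <= normc (u k)) ->
    exists l : R, (fun N => \sum_(k < N) w k) @ \oo --> l.
  move=> wu; have [l1 h1] : exists l : R, (fun N => \sum_(k < N) (w k + normc (u k))) @ \oo --> l.
    apply: (@bounded_series_cvg (fun k => w k + normc (u k)) (B + B)) => [k|N].
      by have := wu k; rewrite ler_norml; lra.
    rewrite big_split /= lerD // (le_trans _ (uB N)) // ler_sum // => k _.
    by rewrite (le_trans (ler_norm _)).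
  have [l2 h2] := bounded_series_cvg (fun k => normc_ge0 (u k)) uB.
  exists (l1 - l2).
  rewrite (_ : (fun N => \sum_(k < N) w k) = (fun N => \sum_(k < N) (w k + normc (u k))) -
     (fun N => \sum_(k < N) normc (u k))); first exact: cvgB.
  by apply/funext => N; rewrite !fctE big_split /=; ring.
have [a ha] := H _ (fun k => normc_Re (u k)).
have [b hb] := H _ (fun k => normc_Im (u k)).
exists (a +i* b)%C; apply: cvg_Re_Im.
  by under eq_fun do rewrite Re_sum.
by under eq_fun do rewrite Im_sum.
Qed.

Lemma cvg_eq_eventually u w (l : C) N : (forall n, (N <= n)%N -> u n = w n) ->
  u @ \oo --> l -> w @ \oo --> l.
Proof.
move=> uw /cvg_seq_normcP h; apply/cvg_seq_normcP => e /h[M hM].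
exists (maxn N M) => n; rewrite geq_max => /andP[/uw <- /hM]; exact.
Qed.

Lemma cvg_cstC (l : C) : (fun _ : nat => l) @ \oo --> l.
Proof. exact: cvg_cst. Qed.

Lemma cvgDC u w (l l' : C) : u @ \oo --> l -> w @ \oo --> l' ->
  (fun n => u n + w n) @ \oo --> l + l'.
Proof.
move=> /cvg_seq_normcP h /cvg_seq_normcP h'; apply/cvg_seq_normcP => e e0.
have e2 : 0 < e / 2 by rewrite divr_gt0.
have [N hN] := h _ e2; have [M hM] := h' _ e2.
exists (maxn N M) => n; rewrite geq_max => /andP[/hN l1 /hM l2].
by rewrite opprD addrACA (le_lt_trans (ler_normcD _ _)) // (splitr e) ltrD.
Qed.

Lemma cvgMC u w (l l' : C) : u @ \oo --> l -> w @ \oo --> l' ->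
  (fun n => u n * w n) @ \oo --> l * l'.
Proof.
move=> /cvg_seq_normcP h /cvg_seq_normcP h'; apply/cvg_seq_normcP => e e0.
pose A := normc l + 1; pose B := normc l' + 1.
have A0 : 0 < A by rewrite ltr_wpDl // normc_ge0.
have B0 : 0 < B by rewrite ltr_wpDl // normc_ge0.
have [N hN] := h (e / 2 / B) ltac:(by rewrite !divr_gt0).
have [M hM] := h' (Num.min 1 (e / 2 / A)) ltac:(by rewrite lt_min ltr01 !divr_gt0).
exists (maxn N M) => n; rewrite geq_max => /andP[/hN l1 /hM].
rewrite lt_min => /andP[l2 l3].
have -> : u n * w n - l * l' = (u n - l) * w n + l * (w n - l') by ring.
have wB : normc (w n) <= B.
  have -> : w n = l' + (w n - l') by ring.
  by rewrite (le_trans (ler_normcD _ _)) // /B lerD2l ltW.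
rewrite (le_lt_trans (ler_normcD _ _)) // !normcM (splitr e) ltr_leD //.
  rewrite (@le_lt_trans _ _ (normc (u n - l) * B)) ?ler_wpM2l ?normc_ge0 //.
  by rewrite -ltr_pdivlMr.
rewrite (@le_trans _ _ (A * normc (w n - l'))) //.
  by rewrite ler_wpM2r ?normc_ge0 // /A lerDl.
by rewrite mulrC -ler_pdivlMr // ltW.
Qed.

Lemma cvgZC u (c l : C) : u @ \oo --> l -> (fun n => c * u n) @ \oo --> c * l.
Proof. by apply: cvgMC; exact: cvg_cstC. Qed.

Lemma cvgBC u w (l l' : C) : u @ \oo --> l -> w @ \oo --> l' ->
  (fun n => u n - w n) @ \oo --> l - l'.
Proof.
move=> h h'; have := cvgDC h (cvgZC (c := -1) h').
by rewrite mulN1r; under eq_fun do rewrite mulN1r.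
Qed.

End Limits.

Section Differentiability.
Context {R : realType}.
Local Notation C := R[i].
Variable V : normedModType C.

(** Passing to the limit in a sequence of holomorphic functions requires explicit
    remainders. *)
Lemma differentiable_epsP (f : V -> C) (p : V) :
  differentiable f p <->
  exists L : {linear V -> C}, continuous L /\
   forall e : R, 0 < e -> exists2 d : R, 0 < d &
     forall v, nrm v < d -> normc (f (p + v) - f p - L v) <= e * nrm v.
Proof.
split.
  move=> /diff_locallyP[Lc /eqaddoP E]; exists 'd f p; split => // e e0.
  have e0' : 0 < ((e%:C)%C : C) by rewrite ltcR.
  have /nbhs_nrmP[d d0 h] := E _ e0'; exists d => // v vd.
  have := h v; rewrite subr0 => /(_ vd); rewrite !fctE /= opprD addrA (addrC v).
  by rewrite norm_normc norm_nrm -rmorphM lecR.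
move=> [L [Lc h]].
have E : f \o shift p = cst (f p) + L +o_ (0 : V) id.
  apply/eqaddoP => _ /posC_real[e e0 ->]; apply/nbhs_nrmP.
  have [d d0 hd] := h _ e0; exists d => // v; rewrite subr0 => /hd.
  rewrite !fctE /= opprD addrA (addrC v) norm_normc norm_nrm -rmorphM lecR.
  exact.
have dE := diff_unique Lc E.
by apply/diff_locallyP; split; rewrite dE.
Qed.

Lemma differentiable_cont (f : V -> C) (p : V) : differentiable f p ->
  forall e : R, 0 < e -> exists2 d : R, 0 < d &
    forall q, nrm (q - p) < d -> normc (f q - f p) < e.
Proof. by move=> /differentiable_continuous/continuous_nrmP. Qed.

Section Pointwise.
Variables (f g : V -> C) (p : V).
Hypotheses (fd : differentiable f p) (gd : differentiable g p).

Lemma hol_add : differentiable (fun v => f v + g v) p.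
Proof. exact: differentiableD. Qed.

Lemma hol_sub : differentiable (fun v => f v - g v) p.
Proof. exact: differentiableB. Qed.

Lemma hol_mul : differentiable (fun v => f v * g v) p.
Proof. exact: differentiableM. Qed.

Lemma hol_opp : differentiable (fun v => - f v) p.
Proof. exact: differentiableN. Qed.

Lemma hol_comp (h : C -> C) : differentiable h (f p) ->
  differentiable (fun v => h (f v)) p.
Proof. by move=> hd; exact: differentiable_comp. Qed.

End Pointwise.

Lemma hol_cst (c : C) p : differentiable (fun _ : V => c) p.
Proof. exact: differentiable_cst. Qed.

Lemma hol_inv (f : V -> C) p : differentiable f p -> f p != 0 ->
  differentiable (fun v => (f v)^-1) p.
Proof. by move=> fd f0; exact: (differentiable_comp fd (differentiable_Rinv f0)). Qed.

Lemma hol_prod (I : Type) (r : seq I) (P : pred I) (f : I -> V -> C) p :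
  (forall i, P i -> differentiable (f i) p) ->
  differentiable (fun v => \prod_(i <- r | P i) f i v) p.
Proof.
move=> fd; elim: r => [|i r ih].
  rewrite (_ : (fun v => _) = fun=> 1); first exact: hol_cst.
  by apply/funext => v; rewrite big_nil.
have [Pi|Pi] := boolP (P i); last first.
  rewrite (_ : (fun v => _) = fun v => \prod_(j <- r | P j) f j v) //.
  by apply/funext => v; rewrite big_cons (negbTE Pi).
rewrite (_ : (fun v => _) = fun v => f i v * \prod_(j <- r | P j) f j v).
  exact: hol_mul (fd _ Pi) ih.
by apply/funext => v; rewrite big_cons Pi.
Qed.

Lemma hol_sum (I : Type) (r : seq I) (P : pred I) (f : I -> V -> C) p :
  (forall i, P i -> differentiable (f i) p) ->
  differentiable (fun v => \sum_(i <- r | P i) f i v) p.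
Proof.
move=> fd; elim: r => [|i r ih].
  rewrite (_ : (fun v => _) = fun=> 0); first exact: hol_cst.
  by apply/funext => v; rewrite big_nil.
have [Pi|Pi] := boolP (P i); last first.
  rewrite (_ : (fun v => _) = fun v => \sum_(j <- r | P j) f j v) //.
  by apply/funext => v; rewrite big_cons (negbTE Pi).
rewrite (_ : (fun v => _) = fun v => f i v + \sum_(j <- r | P j) f j v).
  exact: hol_add (fd _ Pi) ih.
by apply/funext => v; rewrite big_cons Pi.
Qed.

Lemma differentiable_line (f : V -> C) (p v : V) (t0 : C) :
  differentiable f (p + t0 *: v) ->
  exists d, cder (fun t => f (p + t *: v)) t0 d.
Proof.
move=> /differentiable_epsP[L [_ h]]; exists (L v) => e e0.
have v1 : 0 < 1 + nrm v by rewrite ltr_pwDl // nrm_ge0.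
have [d d0 hd] := h (e / (1 + nrm v)) (divr_gt0 e0 v1).
exists (d / (1 + nrm v)); first by rewrite divr_gt0.
move=> k; rewrite ltr_pdivlMr // => kd.
have kv : nrm (k *: v) <= normc k * (1 + nrm v).
  by rewrite nrmZ ler_wpM2l ?normc_ge0 // lerDr.
have := hd (k *: v) (le_lt_trans kv kd).
rewrite linearZ /= scalerDl addrA (mulrC (L v)) => /le_trans; apply.
by rewrite mulrAC ler_pdivrMr // -mulrA ler_pM2l.
Qed.

Lemma line_open (U : set V) (p v : V) (t0 : C) : open U -> U (p + t0 *: v) ->
  exists2 r : R, 0 < r & forall t, normc (t - t0) < r -> U (p + t *: v).
Proof.
move=> oU Ut; have /nbhs_nrmP[d d0 h] := open_nbhs_nbhs (conj oU Ut).
have v1 : 0 < 1 + nrm v by rewrite ltr_pwDl // nrm_ge0.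
exists (d / (1 + nrm v)); first by rewrite divr_gt0.
move=> t; rewrite ltr_pdivlMr // => kd; apply: h; apply: le_lt_trans kd.
have -> : p + t *: v - (p + t0 *: v) = (t - t0) *: v.
  by rewrite scalerBl opprD addrACA subrr add0r.
by rewrite nrmZ ler_wpM2l ?normc_ge0 // lerDr.
Qed.

End Differentiability.

Lemma hol_id {R : realType} (z : R[i]) : differentiable (fun w : R[i] => w) z.
Proof. exact: ex_diff. Qed.

Section IdentityTheorem.
Context {R : realType}.
Local Notation C := R[i].

Lemma cder_shift (f : C -> C) (a z d : C) : cder f (a + z) d ->
  cder (fun w => f (a + w)) z d.
Proof. by move=> h e /h[dl dl0 hd]; exists dl => // k /hd; rewrite addrA. Qed.

(** A function vanishing at points accumulating at $t_0$ has a zero Taylor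
    series there. *)
Lemma zeros_cluster (f : C -> C) (t0 : C) (r : R) : 0 < r ->
  (forall t, normc (t - t0) < r -> exists d, cder f t d) ->
  (forall e : R, 0 < e -> exists t, [/\ t != t0, normc (t - t0) < e & f t = 0]) ->
  exists2 rho : R, 0 < rho & forall t, normc (t - t0) < rho -> f t = 0.
Proof.
move=> r0 fd fz; pose g w := f (t0 + w).
have gd w : normc w < r -> exists d, cder g w d.
  move=> wr; have [|d hd] := fd (t0 + w); first by rewrite addrC addKr.
  by exists d; exact: cder_shift.
have [d0 /cder_cont/(_ 1 ltr01)[dl dl0 hdl]] : exists d, cder g 0 d.
  by apply: gd; rewrite normc0.
pose rho := Num.min dl r / 2.
have rho0 : 0 < rho by rewrite divr_gt0 // lt_min dl0 r0.
have rhor : rho < r.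
  rewrite /rho ltr_pdivrMr // (le_lt_trans (y := r)) ?ge_min ?lexx ?orbT //.
  by move: r0; lra.
have rhod : rho < dl.
  rewrite /rho ltr_pdivrMr // (le_lt_trans (y := dl)) ?ge_min ?lexx //.
  by move: dl0; lra.
pose A := normc (g 0) + 1.
have A0 : 0 < A by rewrite ltr_wpDl // normc_ge0.
have gA w : normc w = rho -> normc (g w) <= A.
  move=> wr; have := hdl w; rewrite subr0 wr => /(_ rhod) l.
  have -> : g w = g 0 + (g w - g 0) by ring.
  by rewrite (le_trans (ler_normcD _ _)) // /A lerD2l ltW.
have [c [_ hc]] := cauchy_taylor rho0 rhor gd gA.
have small w : normc w < rho / 2 -> normc w / rho < 2^-1 /\ normc w < rho.
  move=> wl; have w2 : normc w / rho < 2^-1 by rewrite ltr_pdivrMr // mulrC.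
  by split => //; move: wl rho0; lra.
have c0 k : c k = 0.
  have [m] := ubnP k; elim: m k => // m ih k; rewrite ltnS => km.
  apply/eqP; rewrite -normc_eq0 eq_le normc_ge0 andbT.
  apply/ler_addgt0Pr => e e0; rewrite add0r.
  have B0 : 0 < 2 * A / rho ^+ k.+1 by rewrite divr_gt0 ?mulr_gt0 ?exprn_gt0.
  have [|t [tt0 tl ft]] := fz (Num.min (rho / 2) (e / (2 * A / rho ^+ k.+1))).
    by rewrite lt_min (divr_gt0 rho0) //= (divr_gt0 e0 B0).
  move: tl; rewrite lt_min => /andP[/small[l1 l2] l3].
  set w := t - t0 in l1 l2 l3.
  have gw : g w = 0 by rewrite /g /w addrC subrK.
  have w0 : 0 < normc w by rewrite normc_gt0 subr_eq0.
  have := hc w l2 k.+1; rewrite gw sub0r normcN big_ord_recr /= big1 ?add0r; last first.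
    by move=> j _; rewrite ih ?mul0r // (leq_trans (ltn_ord j)).
  rewrite normcM normcX => l4.
  have wk : 0 < normc w ^+ k by rewrite exprn_gt0.
  rewrite -(ler_pM2r wk) (le_trans l4) // ler_pdivrMr; last by move: l1; lra.
  have -> : A * (normc w / rho) ^+ k.+1 = (2 * A / rho ^+ k.+1 * normc w) * normc w ^+ k * 2^-1.
    by rewrite exprMn exprVn exprS; field; rewrite expf_neq0 // lt0r_neq0.
  apply: ler_pM => //; last by move: l1; lra.
    by rewrite !mulr_ge0 // ?(ltW w0) ?(ltW wk) // ?(ltW A0) // invr_ge0 exprn_ge0 // ltW.
  by rewrite ler_pM2r // mulrC -ler_pdivlMr // ltW.
exists (rho / 2); first by rewrite divr_gt0.
move=> t /small[]; set w := t - t0 => l1 l2.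
have -> : f t = g w by rewrite /g /w addrC subrK.
apply/eqP; rewrite -normc_eq0 eq_le normc_ge0 andbT.
apply/ler_addgt0Pr => e e0; rewrite add0r.
have q0 : 0 <= normc w / rho by rewrite divr_ge0 ?normc_ge0 // ltW.
have q01 : 0 <= normc w / rho < 1 by rewrite q0 /=; move: l1; lra.
have [N hN] := expr_small q01 (divr_gt0 e0 (mulr_gt0 (ltr0n R 2) A0)).
have := hc w l2 N; rewrite big1 ?subr0; last by move=> j _; rewrite c0 mul0r.
move=> /le_trans; apply; rewrite ler_pdivrMr; last by move: l1; lra.
have := hN N (leqnn N); rewrite ltr_pdivlMr ?mulr_gt0 // => l3.
have : e * (1 - normc w / rho) >= e / 2 by rewrite ler_pM2l //; move: l1; lra.
by move: l3; lra.
Qed.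

Variable V : normedModType C.

Definition segment_convex (U : set V) := forall x y, U x -> U y ->
  forall t : R, 0 <= t <= 1 -> U (x + ((t%:C)%C : C) *: (y - x)).

(** Along the segment from a zero to another point, the vanishing propagates
    past every point it reaches, by [zeros_cluster]. *)
Theorem identity_theorem (f : V -> C) (U O : set V) : open U -> segment_convex U ->
  (forall z, U z -> differentiable f z) ->
  open O -> O !=set0 -> O `<=` U -> (forall z, O z -> f z = 0) ->
  forall z, U z -> f z = 0.
Proof.
move=> oU cU fd oO [p Op] OU fO y Uy; have Up := OU _ Op.
pose v := y - p; pose phi (t : C) := f (p + t *: v).
have line t : 0 <= t <= 1 -> U (p + ((t%:C)%C : C) *: v) by exact: cU.
pose S := [set t : R | 0 <= t <= 1 /\ forall s, 0 <= s <= t -> phi (s%:C)%C = 0].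
have [r0 r00 hr0] : exists2 r : R, 0 < r & forall t, normc (t - 0) < r -> O (p + t *: v).
  by apply: line_open; rewrite // scale0r addr0.
pose a := Num.min 1 (r0 / 2).
have a0 : 0 < a by rewrite lt_min ltr01 divr_gt0.
have Sa : S a.
  split; first by rewrite (ltW a0) ge_min lexx.
  move=> s /andP[s0 sa]; apply: fO; apply: hr0; rewrite subr0 normcR ger0_norm //.
  by rewrite (le_lt_trans sa) // gt_min orbC; move: r00; lra.
have ubS : has_sup S.
  by split; [exists a|exists 1 => t [/andP[]]].
pose T := sup S.
have aT : a <= T by exact: sup_ubound ubS.2 _ Sa.
have T0 : 0 < T := lt_le_trans a0 aT.
have T1 : T <= 1 by apply: sup_le_ub => [|t [/andP[]]//]; exists a.
have zT s : 0 <= s < T -> phi (s%:C)%C = 0.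
  move=> /andP[s0 sT]; have Ts : 0 < T - s by rewrite subr_gt0.
  have [t [_ h] st] := sup_adherent Ts ubS.
  apply: h; rewrite s0 /=; move: st; rewrite -/T; lra.
have [r rp hr] := line_open oU (line T ltac:(by rewrite (ltW T0) T1)).
have [rho rho0 hrho] : exists2 rho : R, 0 < rho & forall t, normc (t - (T%:C)%C) < rho -> phi t = 0.
  apply: (@zeros_cluster phi _ r rp) => [t /hr/fd|e e0]; first exact: differentiable_line.
  pose s := T - Num.min T (e / 2) .
  have m0 : 0 < Num.min T (e / 2) by rewrite lt_min T0 divr_gt0.
  have mT : Num.min T (e / 2) <= T by rewrite ge_min lexx.
  exists ((s%:C)%C); split.
  - by apply/eqP => -[] /eqP; rewrite /s; lra.
  - rewrite -rmorphB normcR /s addrC addKr normrN gtr0_norm //.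
    by rewrite (le_lt_trans (y := e / 2)) ?ge_min ?lexx ?orbT //; move: e0; lra.
  - by apply: zT; rewrite /s; apply/andP; split; lra.
have zT' (s : R) : 0 <= s -> s < T + rho -> phi (s%:C)%C = 0.
  move=> s0 sT; have [l|l] := ltP s T; first by apply: zT; rewrite s0.
  by apply: hrho; rewrite -rmorphB normcR ger0_norm ?subr_ge0 //; lra.
have T1' : T = 1.
  apply/eqP; rewrite eq_le T1 /= leNgt; apply/negP => Tl.
  pose b := Num.min 1 (T + rho / 2).
  have Sb : S b.
    split; first by rewrite le_min ler01 ge_min lexx /= andbT; lra.
    move=> s /andP[s0 sb]; apply: zT' => //; apply: le_lt_trans sb _.
    by rewrite gt_min; apply/orP; right; lra.
  have := sup_ubound ubS.2 Sb; rewrite -/T leNgt lt_min Tl /=; lra.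
have := zT' 1 ler01; rewrite T1' => /(_ _); rewrite /phi rmorph1 scale1r /v.
by rewrite (addrC p) subrK; apply; lra.
Qed.

End IdentityTheorem.

Section WeierstrassMTest.
Context {R : realType}.
Local Notation C := R[i].
Variable V : normedModType C.

(** The one-variable Taylor expansion along each line gives a bound on the
    remainder which is uniform in the direction. *)
Lemma bounded_taylor1 (f : V -> C) (p : V) (r A : R) : 0 < r ->
  (forall v, nrm (v - p) < r -> differentiable f v) ->
  (forall v, nrm (v - p) < r -> normc (f v) <= A) ->
  exists L : {linear V -> C},
    (forall v, normc (L v) <= 2 * A / r * nrm v) /\
    forall v, nrm v <= r / 4 ->
      normc (f (p + v) - f p - L v) <= 8 * A / r ^+ 2 * nrm v ^+ 2.
Proof.
move=> r0 fd fA.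
have /fd/differentiable_epsP[L [_ hL]] : nrm (p - p) < r by rewrite subrr nrm0.
have A0 : 0 <= A.
  by apply: le_trans (normc_ge0 (f p)) (fA _ _); rewrite subrr nrm0.
exists L.
have main v : v != 0 ->
  normc (L v) <= 2 * A / r * nrm v /\ (nrm v <= r / 4 ->
      normc (f (p + v) - f p - L v) <= 8 * A / r ^+ 2 * nrm v ^+ 2).
  rewrite -nrm_eq0 => v0.
  have vp : 0 < nrm v by rewrite lt_def v0 nrm_ge0.
  pose phi (t : C) := f (p + t *: v); pose rho := r / 2 / nrm v.
  have rho0 : 0 < rho by rewrite !divr_gt0.
  have rr : rho < r / nrm v by rewrite ltr_pM2r ?invr_gt0 //; move: r0; lra.
  have inball t : normc t < r / nrm v -> nrm (p + t *: v - p) < r.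
    by rewrite addrC addKr nrmZ ltr_pdivlMr.
  have pd w : normc w < r / nrm v -> exists d, cder phi w d.
    by move=> /inball/fd; exact: differentiable_line.
  have pA w : normc w = rho -> normc (phi w) <= A.
    by move=> wr; apply/fA/inball; rewrite wr.
  have [c [cb hc]] := cauchy_taylor rho0 rr pd pA.
  have c0 : c 0%N = phi 0.
    have := hc 0 ltac:(by rewrite normc0) 1%N.
    rewrite normc0 mul0r expr0n /= mulr0 mul0r big_ord1 expr0 mulr1 => h.
    by apply/esym/eqP; rewrite -subr_eq0 -normc_eq0 eq_le normc_ge0 h.
  have quad t : normc t <= rho / 2 ->
      normc (phi t - phi 0 - c 1%N * t) <= 2 * A * (normc t / rho) ^+ 2.
    move=> tr; have tr' : normc t < rho by move: tr rho0; lra.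
    have := hc t tr' 2%N; rewrite big_ord_recl big_ord1 /= expr0 mulr1 expr1 c0.
    rewrite opprD addrA => /le_trans; apply.
    have q2 : normc t / rho <= 2^-1 by rewrite ler_pdivrMr // mulrC.
    rewrite ler_pdivrMr; last by move: q2; lra.
    have -> : 2 * A * (normc t / rho) ^+ 2 * (1 - normc t / rho) =
      A * (normc t / rho) ^+ 2 * (2 * (1 - normc t / rho)) by ring.
    rewrite -[leLHS]mulr1 ler_wpM2l //; last by move: q2; lra.
    by rewrite mulr_ge0 // sqr_ge0.
  have c1 : c 1%N = L v.
    apply/eqP; rewrite -subr_eq0 -normc_eq0 eq_le normc_ge0 andbT.
    apply/ler_addgt0Pr => e e0; rewrite add0r.
    have e2 : 0 < e / 2 / nrm v by rewrite !divr_gt0.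
    have [d d0 hd] := hL _ e2.
    pose B := 2 * A / rho ^+ 2 + 1.
    have B0 : 0 < B.
      by rewrite ltr_wpDl // (divr_ge0 (mulr_ge0 (ler0n R 2) A0) (sqr_ge0 rho)).
    pose t := Num.min (Num.min (rho / 2) (d / nrm v / 2)) (e / 2 / B).
    have t0 : 0 < t by rewrite !lt_min !divr_gt0.
    have [t1 t2 t3] : [/\ t <= rho / 2, t <= d / nrm v / 2 & t <= e / 2 / B].
      by rewrite /t !ge_min !lexx ?orbT.
    have nt : normc ((t%:C)%C : C) = t by rewrite normcR gtr0_norm.
    have := quad (t%:C)%C; rewrite nt => /(_ t1) l1.
    have tv : nrm (((t%:C)%C : C) *: v) < d.
      rewrite nrmZ nt -ltr_pdivlMr // (le_lt_trans t2) //.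
      by rewrite ltr_pdivrMr // mulr_natr mulr2n ltrDl divr_gt0.
    have := hd _ tv; rewrite nrmZ nt linearZ /= => l2.
    have -> : c 1%N - L v = ((f (p + ((t%:C)%C : C) *: v) - f p - ((t%:C)%C : C) * L v)
       - (phi (t%:C)%C - phi 0 - c 1%N * (t%:C)%C)) / (t%:C)%C.
      rewrite /phi scale0r addr0; field.
      by rewrite -normc_eq0 nt gt_eqF.
    rewrite normcM normcV nt ler_pdivrMr // (le_trans (ler_normcB _ _)) //.
    have : 2 * A * (t / rho) ^+ 2 <= e / 2 * t.
      have -> : 2 * A * (t / rho) ^+ 2 = t * (2 * A / rho ^+ 2) * t.
        by field; rewrite gt_eqF.
      rewrite ler_pM2r //; move: t3; rewrite ler_pdivlMr // /B mulrDr mulr1.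
      by apply: le_trans; rewrite lerDl ltW.
    have : e / 2 / nrm v * (t * nrm v) = e / 2 * t by field; rewrite gt_eqF.
    by move: l1 l2; rewrite /GRing.scale /=; lra.
  split.
    have := cb 1%N; rewrite c1 expr1 => /le_trans; apply.
    by rewrite /rho le_eqVlt; apply/orP; left; apply/eqP; field; rewrite !gt_eqF.
  move=> vr; have := quad 1; rewrite normc1 mulr1 c1 /phi scale0r addr0 scale1r.
  move=> h; have -> : 8 * A / r ^+ 2 * nrm v ^+ 2 = 2 * A * (1 / rho) ^+ 2.
    by rewrite /rho; field; rewrite !gt_eqF.
  apply: h; rewrite /rho ler_pdivlMr // ler_pdivlMr // mul1r.
  by move: vr; lra.
split=> v; have [->|v0] := eqVneq v 0; try by case: (main v v0).
  by rewrite linear0 normc0 nrm0 mulr0.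
by rewrite linear0 addr0 subrr subr0 normc0 nrm0 expr0n /= mulr0.
Qed.

(** Weierstrass: by [bounded_taylor1] the derivatives at [p] and the quadratic
    remainders are dominated by the same convergent series as the functions. *)
Theorem weierstrass_mtest (f : nat -> V -> C) (g : V -> C) (p : V) (r B : R)
    (A : nat -> R) : 0 < r ->
  (forall k v, nrm (v - p) < r -> differentiable (f k) v) ->
  (forall k v, nrm (v - p) < r -> normc (f k v) <= A k) ->
  (forall N, \sum_(k < N) A k <= B) ->
  (forall v, nrm (v - p) < r -> (fun N => \sum_(k < N) f k v) @ \oo --> g v) ->
  differentiable g p.
Proof.
move=> r0 fd fA AB fg.
have [L hL] := choice (fun k => bounded_taylor1 r0 (fd k) (fA k)).
have A0 k : 0 <= A k.
  by apply: le_trans (normc_ge0 (f k p)) (fA _ _ _); rewrite subrr nrm0.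
have sumL v N : \sum_(k < N) normc (L k v) <= 2 * B / r * nrm v.
  apply: (@le_trans _ _ (\sum_(k < N) 2 * A k / r * nrm v)).
    by apply: ler_sum => k _; case: (hL k).
  rewrite -mulr_suml -mulr_suml -mulr_sumr ler_wpM2r ?nrm_ge0 //.
  by rewrite ler_pM2r ?invr_gt0 // ler_pM2l.
have [l hl] := choice (fun v => abs_series_cvg (u := fun k => L k v) (sumL v)).
have lin : linear l.
  move=> a u v; apply: cvg_uniqueC (hl _) _.
  have := cvgDC (cvgZC (c := a) (hl u)) (hl v); apply: (cvg_eq_eventually (N := 0)) => N _.
  by rewrite mulr_sumr -big_split /=; apply: eq_bigr => k _; rewrite linearP.
pose LL : {linear V -> C} := HB.pack l (GRing.isLinear.Build _ _ _ _ l lin).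
have lb v : normc (l v) <= 2 * B / r * nrm v.
  apply: cvg_normc_le (hl v) _ => N.
  by rewrite (le_trans (ler_normc_sum _ _ _)) // sumL.
have B0 : 0 <= B by have := AB 0%N; rewrite big_ord0.
apply/differentiable_epsP; exists LL; split.
  move=> v; apply/continuous_nrmP => e e0.
  pose K := 2 * B / r + 1.
  have K0 : 0 < K by rewrite ltr_wpDl // divr_ge0 ?mulr_ge0 // ltW.
  exists (e / K); first by rewrite divr_gt0.
  move=> q; rewrite ltr_pdivlMr // => qv; rewrite -raddfB /=.
  rewrite (le_lt_trans (lb _)) // (le_lt_trans _ qv) // mulrC.
  by rewrite ler_wpM2l ?nrm_ge0 // /K lerDl.
move=> e e0; pose K := 8 * B / r ^+ 2 + 1.
have K0 : 0 < K.
  by rewrite ltr_wpDl // (divr_ge0 (mulr_ge0 (ler0n R 8) B0) (sqr_ge0 r)).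
exists (Num.min (r / 4) (e / K)); first by rewrite lt_min !divr_gt0.
move=> v; rewrite lt_min => /andP[vr ve].
have inr : nrm (p + v - p) < r by rewrite addrC addKr (lt_trans vr) //; move: r0; lra.
have inp : nrm (p - p) < r by rewrite subrr nrm0.
apply: (@le_trans _ _ (8 * B / r ^+ 2 * nrm v ^+ 2)).
  apply: (cvg_normc_le (u := fun N => \sum_(k < N) f k (p + v) - \sum_(k < N) f k p
     - \sum_(k < N) L k v)).
    by apply: cvgBC (hl v); apply: cvgBC; exact: fg.
  move=> N; rewrite -!sumrB (le_trans (ler_normc_sum _ _ _)) //.
  apply: (@le_trans _ _ (\sum_(k < N) 8 * A k / r ^+ 2 * nrm v ^+ 2)).
    by apply: ler_sum => k _; case: (hL k) => _; apply; exact: ltW.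
  rewrite -mulr_suml -mulr_suml -mulr_sumr ler_wpM2r ?sqr_ge0 //.
  by rewrite ler_pM2r ?invr_gt0 ?exprn_gt0 // ler_pM2l.
rewrite expr2 mulrA ler_wpM2r ?nrm_ge0 //.
apply: (@le_trans _ _ (K * nrm v)); first by rewrite ler_wpM2r ?nrm_ge0 // /K lerDl.
by rewrite mulrC -ler_pdivlMr // ltW.
Qed.

End WeierstrassMTest.

(** * Complex powers of natural numbers *)

Section NatPow.
Context {R : realType}.
Local Notation C := R[i].
Implicit Types (z w : C) (k l : nat).

Lemma natpowD k z w : natpow k (z + w) = natpow k z * natpow k w.
Proof. by rewrite /natpow mulrDr cexpD. Qed.

Lemma natpow0 k : natpow k (0 : C) = 1.
Proof. by rewrite /natpow mulr0 cexp0. Qed.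

Lemma natpow1l z : natpow 1 z = 1.
Proof. by rewrite /natpow ln1 mul0r cexp0. Qed.

Lemma natpowN k z : natpow k (- z) = (natpow k z)^-1.
Proof. by rewrite /natpow mulrN cexpN. Qed.

Lemma natpow_neq0 k z : natpow k z != 0.
Proof. exact: cexp_neq0. Qed.

Lemma natpowM k l z : (0 < k)%N -> (0 < l)%N ->
  natpow (k * l) z = natpow k z * natpow l z.
Proof.
move=> k0 l0; rewrite /natpow natrM lnM ?posrE ?ltr0n //.
by rewrite rmorphD mulrDl cexpD.
Qed.

Lemma natpow1 k : (0 < k)%N -> natpow k (1 : C) = k%:R.
Proof.
move=> k0; rewrite /natpow mulr1 cexpR lnK ?posrE ?ltr0n //.
by rewrite rmorph_nat.
Qed.

Lemma natpowX k z n : natpow (k ^ n) z = natpow k z ^+ n.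
Proof.
elim: n => [|n ih]; first by rewrite expn0 expr0 natpow1l.
have [->|k0] := posnP k; last by rewrite expnS natpowM ?expn_gt0 ?k0 // ih exprS.
by rewrite exp0n // /natpow ln0 // mul0r cexp0 expr1n.
Qed.

Lemma natpowMn k z n : natpow k (z *+ n) = natpow k z ^+ n.
Proof. by rewrite /natpow mulrnAr cexpMn. Qed.

Lemma natpow_sum k (I : Type) (r : seq I) (P : pred I) (F : I -> C) :
  natpow k (\sum_(i <- r | P i) F i) = \prod_(i <- r | P i) natpow k (F i).
Proof. by rewrite /natpow mulr_sumr cexp_sum. Qed.

(** The real power $k^x$, which is the modulus of [natpow k z] for $x = \Re z$. *)
Definition npw k (x : R) : R := expR (x * ln k%:R).

Lemma normc_natpow k z : normc (natpow k z) = npw k (complex.Re z).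
Proof. by rewrite /natpow normc_cexp Re_mul /= mul0r subr0 mulrC. Qed.

Lemma npw_gt0 k x : 0 < npw k x. Proof. exact: expR_gt0. Qed.
Lemma npw_ge0 k x : 0 <= npw k x. Proof. exact: expR_ge0. Qed.

Lemma npwD k x y : npw k (x + y) = npw k x * npw k y.
Proof. by rewrite /npw mulrDl expRD. Qed.

Lemma npw0 k : npw k 0 = 1. Proof. by rewrite /npw mul0r expR0. Qed.

Lemma npwN k x : npw k (- x) = (npw k x)^-1.
Proof. by rewrite /npw mulNr expRN. Qed.

Lemma npw1 k : (0 < k)%N -> npw k 1 = k%:R.
Proof. by move=> k0; rewrite /npw mul1r lnK ?posrE ?ltr0n. Qed.

Lemma ln_nat_ge0 k : 0 <= ln k%:R :> R.
Proof. by case: k => [|k]; [rewrite ln0|rewrite ln_ge0 // ler1n]. Qed.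

Lemma ln_nat_gt0 k : (1 < k)%N -> 0 < ln k%:R :> R.
Proof. by move=> k1; rewrite ln_gt0 // ltr1n. Qed.

Lemma ler_npw k x y : x <= y -> npw k x <= npw k y.
Proof. by move=> xy; rewrite ler_expR ler_wpM2r // ln_nat_ge0. Qed.

Lemma npwM k l x : (0 < k)%N -> (0 < l)%N -> npw (k * l) x = npw k x * npw l x.
Proof.
move=> k0 l0; rewrite /npw natrM lnM ?posrE ?ltr0n //.
by rewrite mulrDr expRD.
Qed.

Lemma natpow_real k (x : R) : natpow k ((x%:C)%C) = ((npw k x)%:C)%C.
Proof. by rewrite /natpow -rmorphM cexpR mulrC. Qed.

Lemma npw_le1 k x : x <= 0 -> npw k x <= 1.
Proof. by move=> x0; rewrite -(npw0 k) ler_npw. Qed.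

(** $\sum_k k^{-a}$ converges for $a > 1$: the terms are dominated by the
    increments of $k^{1-a}$, by the mean value theorem. *)
Lemma npw_sum_bound (a : R) : 1 < a ->
  exists B, forall N, \sum_(k < N) npw k.+1 (- a) <= B.
Proof.
move=> a1; have a10 : 0 < a - 1 by rewrite subr_gt0.
exists (1 + (a - 1)^-1) => N.
suff : \sum_(k < N) npw k.+1 (- a) <= 1 + (a - 1)^-1 * (1 - npw N (1 - a)) /\ (0 < N)%N
    \/ N = 0%N.
  case=> [[h _]|->]; last by rewrite big_ord0 addr_ge0 // invr_ge0 ltW.
  apply: (le_trans h); rewrite lerD2l -[leRHS]mulr1 ler_pM2l ?invr_gt0 //.
  by rewrite gerBl npw_ge0.
elim: N => [|N ih]; [by right|left; split=> //].
rewrite big_ord_recr /=; case: ih => [[ih N0]|->]; last first.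
  by rewrite big_ord0 /npw ln1 !mulr0 expR0 subrr mulr0 addr0 add0r.
suff : npw N.+1 (- a) <= (a - 1)^-1 * (npw N (1 - a) - npw N.+1 (1 - a)).
  by move: ih; rewrite !mulrBr; lra.
rewrite mulrC ler_pdivlMr //.
have N1 : (N%:R : R) <= N.+1%:R by rewrite ler_nat.
have Np : 0 < (N%:R : R) by rewrite ltr0n.
pose g (x : R) := expR ((1 - a) * ln x).
have dg (x : R) : 0 < x -> is_derive x 1 g (expR ((1 - a) * ln x) * ((1 - a) * x^-1)).
  move=> x0; have h : is_derive x 1 (fun x => (1 - a) * ln x) ((1 - a) * x^-1).
    by have := is_deriveZ (1 - a) (is_derive1_ln x0).
  have -> : g = expR \o (fun x => (1 - a) * ln x) by [].
  exact: is_derive1_comp.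
have [c] : exists2 c, c \in `[(N%:R : R), N.+1%:R] & g N.+1%:R - g N%:R =
    expR ((1 - a) * ln c) * ((1 - a) * c^-1) * (N.+1%:R - N%:R).
  apply: MVT_segment => // [x|].
    by rewrite in_itv /= => /andP[/(lt_trans Np) x0 _]; exact: dg x0.
  apply: continuous_in_subspaceT => x /set_mem; rewrite /= in_itv /= => /andP[x0 _].
  exact: is_derive_cont (dg _ (lt_le_trans Np x0)).
rewrite in_itv /= => /andP[c1 c2]; rewrite /g -!/(npw _ _).
have c0 : 0 < c := lt_le_trans Np c1.
have -> : N.+1%:R - N%:R = 1 :> R by rewrite -natr1 addrAC subrr add0r.
rewrite mulr1 => h.
have -> : npw N (1 - a) - npw N.+1 (1 - a) = (a - 1) * (expR ((1 - a) * ln c) * c^-1).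
  by rewrite -opprB h; ring.
rewrite mulrC ler_pM2l // -{2}(lnK (x := c)) ?posrE // -expRN -expRD ler_expR.
have -> : (1 - a) * ln c - ln c = - a * ln c by ring.
rewrite !mulNr lerN2 ler_pM2l ?(lt_trans _ a1) //.
by rewrite ler_ln ?posrE ?ltr0n.
Qed.

Lemma npw_small (b e : R) : 0 < b -> 0 < e ->
  exists N, forall n, (N <= n)%N -> npw n.+1 (- b) < e.
Proof.
move=> b0 e0; pose x := expR (- ln e / b).
exists (Num.bound x) => n xn.
have l : x < n.+1%:R.
  have := archi_boundP (expR_ge0 (- ln e / b)); rewrite -/x => /lt_le_trans; apply.
  by rewrite ler_nat (leq_trans xn).
rewrite /npw -[ltRHS](lnK (x := e)) ?posrE // ltr_expR mulNr ltrNl.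
rewrite mulrC -ltr_pdivrMr // -[ltLHS]expRK ltr_ln ?posrE ?ltr0n ?expR_gt0 //.
Qed.

Lemma cder_differentiable (f : C -> C) (z d : C) : cder f z d -> differentiable f z.
Proof.
move=> h; apply/differentiable_epsP.
have lin : linear (fun w : C => d * w).
  by move=> a u v; rewrite /GRing.scale /=; ring.
pose L : {linear C -> C} :=
  HB.pack (fun w : C => d * w) (GRing.isLinear.Build _ _ _ _ (fun w : C => d * w) lin).
exists L.
split=> [x|e /h[dl dl0 hd]] /=.
  apply/continuous_nrmP => e e0; exists (e / (normc d + 1)).
    by rewrite divr_gt0 // ltr_wpDl // normc_ge0.
  move=> q; rewrite nrm_normc ltr_pdivlMr ?ltr_wpDl ?normc_ge0 // => l.
  rewrite -mulrBr normcM; apply: le_lt_trans l.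
  by rewrite mulrC ler_wpM2l ?normc_ge0 // lerDl.
by exists dl => // v; rewrite nrm_normc => /hd.
Qed.

Lemma differentiable_cder (f : C -> C) (z : C) : differentiable f z ->
  exists d, cder f z d.
Proof.
move=> h; have [|d hd] := @differentiable_line R C f 0 1 z.
  by rewrite add0r /GRing.scale /= mulr1.
exists d => e /hd[dl dl0 hdl]; exists dl => // k /hdl.
by rewrite !add0r /GRing.scale /= !mulr1.
Qed.

Lemma cexp_cder z : cder (@cexp R) z (cexp z).
Proof.
move=> e e0; pose K := normc (cexp z) * expR 1 + 1.
have K0 : 0 < K by rewrite ltr_wpDl // mulr_ge0 ?normc_ge0 ?expR_ge0.
exists (Num.min 1 (e / K)); first by rewrite lt_min ltr01 divr_gt0.
move=> h; rewrite lt_min => /andP[h1 h2].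
have -> : cexp (z + h) - cexp z - cexp z * h = cexp z * (cexp h - 1 - h).
  by rewrite cexpD; ring.
rewrite normcM (le_trans (ler_wpM2l (normc_ge0 _) (cexp_sub1_sub_le _))) //.
rewrite expr2 mulrCA !mulrA [e * _]mulrC -!mulrA ler_wpM2l ?normc_ge0 //.
move: h2; rewrite ltr_pdivlMr // => /ltW; apply: le_trans.
rewrite ler_wpM2l ?normc_ge0 // /K.
apply: (@le_trans _ _ (normc (cexp z) * expR 1)); last by rewrite lerDl.
by rewrite ler_wpM2l ?normc_ge0 // ler_expR ltW.
Qed.

Lemma cexp_differentiable z : differentiable (@cexp R) z.
Proof. exact: cder_differentiable (cexp_cder z). Qed.

Variable V : normedModType C.

Lemma natpow_differentiable k (f : V -> C) p : differentiable f p ->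
  differentiable (fun v => natpow k (f v)) p.
Proof.
move=> fd; apply: (differentiable_comp (g := @cexp R)
  (f := fun v => ((ln (k%:R : R))%:C)%C * f v)); last exact: cexp_differentiable.
exact: hol_mul (hol_cst _ _) fd.
Qed.

End NatPow.

(** * The zeta function near its pole *)

Section Xi.
Context {R : realType}.
Local Notation C := R[i].

Lemma rder_comp_real (F : R -> C) (g : R -> R) (x g' : R) (d : C) :
  rder F (g x) d -> is_derive x 1 g g' ->
  rder (fun t => F (g t)) x (d * ((g'%:C)%C)).
Proof.
move=> [h1 h2] hg; split.
  apply: is_derive_eq (is_derive1_comp h1 hg) _.
  by rewrite Re_mul /= mulr0 subr0.
apply: is_derive_eq (is_derive1_comp h2 hg) _.
by rewrite Im_mul /= mulr0 add0r.
Qed.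

(** $(1 + u)^a$ *)
Let P (a : C) (u : R) : C := cexp (((ln (1 + u))%:C)%C * a).

Lemma is_derive_ln1 (u : R) : 0 <= u -> is_derive u 1 (fun u : R => ln (1 + u)) (1 + u)^-1.
Proof.
move=> u0; have u1 : 0 < 1 + u by rewrite ltr_pwDl.
have h : is_derive u 1 (fun u : R => 1 + u) 1.
  by apply: is_derive_eq (is_deriveD (is_derive_cst (1 : R) u 1) (is_derive_id u 1)) _; rewrite add0r.
have -> : (1 + u)^-1 = (1 + u)^-1 * 1 by rewrite mulr1.
exact: (@is_derive1_comp _ (@ln R) (fun u : R => 1 + u) u _ 1 (is_derive1_ln u1) h).
Qed.

Lemma rder_P a (u : R) : 0 <= u -> rder (P a) u (a * P (a - 1) u).
Proof.
move=> u0; have u1 : 0 < 1 + u by rewrite ltr_pwDl.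
apply: rder_eq (rder_comp_real (rder_cexp a _) (is_derive_ln1 u0)) _.
rewrite /P mulrBr mulr1 cexpD cexpN cexpR lnK ?posrE // fmorphV.
by rewrite mulrA.
Qed.

Let P_bound a (u : R) : 0 <= u <= 1 -> normc (P a u) <= expR (normc a).
Proof.
move=> /andP[u0 u1]; rewrite normc_cexp Re_mul /= mul0r subr0 ler_expR.
have l0 : 0 <= ln (1 + u) by rewrite ln_ge0 // lerDl.
have l1 : ln (1 + u) <= 1.
  apply: (le_trans (y := u)) => //; rewrite -[leRHS]expRK ler_ln ?posrE ?expR_gt0 ?ltr_pwDl //.
  exact: expR_ge1Dx.
apply: (le_trans (ler_norm _)); rewrite normrM ger0_norm //.
rewrite -[leRHS]mul1r; apply: ler_pM => //; exact: normc_Re.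
Qed.

Section Quadrature.
Variable s : C.

(** The error of the trapezoid rule for $(s-1) x^{-s}$ on $[1, 1 + u]$. *)
Let q (u : R) : C := (s - 1) / 2 * ((u%:C)%C * (1 + P (- s) u)) - 1 + P (1 - s) u.
Let q1 (u : R) : C := (s - 1) / 2 * (1 - P (- s) u - s * ((u%:C)%C * P (- s - 1) u)).
Let q2 (u : R) : C := (s - 1) * s * (s + 1) / 2 * ((u%:C)%C * P (- s - 1 - 1) u).
Let K : R := (normc s + 1) ^+ 3 * expR (normc s + 2).

Let dq (u : R) : 0 <= u -> rder q u (q1 u).
Proof.
move=> u0; apply: rder_eq.
  apply: rderD; last exact: rder_P.
  apply: rderB; last exact: rder_cst.
  apply: rderZ; apply: rderM (rder_id _) _.
  apply: rderD; [exact: rder_cst|exact: rder_P].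
have -> : 1 - s - 1 = - s by ring.
by rewrite /q1; field.
Qed.

Let dq1 (u : R) : 0 <= u -> rder q1 u (q2 u).
Proof.
move=> u0; apply: rder_eq.
  apply: rderZ; apply: rderB.
    by apply: rderB; [exact: rder_cst|exact: rder_P].
  apply: rderZ; apply: rderM (rder_id _) _; exact: rder_P.
by rewrite /q2; field.
Qed.

Let K0 : 0 <= K. Proof. by rewrite mulr_ge0 ?expR_ge0 // exprn_ge0 // addr_ge0 ?normc_ge0. Qed.

Let q2_bound (u : R) : 0 <= u <= 1 -> normc (q2 u) <= K * u.
Proof.
move=> u01; have /andP[u0 u1] := u01.
have s0 := normc_ge0 s.
have a1 : normc (s - 1) <= normc s + 1 by rewrite (le_trans (ler_normcB _ _)) // normc1.
have a2 : normc (s + 1) <= normc s + 1 by rewrite (le_trans (ler_normcD _ _)) // normc1.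
have a3 : normc (P (- s - 1 - 1) u) <= expR (normc s + 2).
  rewrite (le_trans (P_bound _ u01)) // ler_expR.
  have -> : - s - 1 - 1 = - (s + 2) by ring.
  by rewrite normcN (le_trans (ler_normcD _ _)) // normc_nat.
rewrite /q2; move: (P _ u) a3 => p a3.
rewrite !normcM normcR (ger0_norm u0) normcV normc_nat.
rewrite mulrCA mulrC ler_wpM2r // /K ler_pM ?normc_ge0 ?mulr_ge0 ?normc_ge0 ?invr_ge0 //.
apply: (@le_trans _ _ (normc (s - 1) * normc s * normc (s + 1) * 1)).
  by rewrite ler_wpM2l ?mulr_ge0 ?normc_ge0 // invf_le1 ?ler1n.
rewrite mulr1 exprSr; apply: ler_pM => //; rewrite ?mulr_ge0 ?normc_ge0 //.
by rewrite expr2; apply: ler_pM; rewrite ?normc_ge0 // lerDl.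
Qed.

Let P0 a : P a 0 = 1. Proof. by rewrite /P addr0 ln1 mul0r cexp0. Qed.

Let q_bound (u : R) : 0 <= u <= 1 -> normc (q u) <= K * u ^+ 3.
Proof.
have q1b (x : R) : 0 <= x <= 1 -> normc (q1 x) <= K * x ^+ 2.
  move=> /andP[x0 x1].
  have -> : q1 x = q1 x - q1 0 by rewrite /q1 !P0 mul0r mulr0 subr0 subrr mulr0 subr0.
  have -> : K * x ^+ 2 = K * x * (x - 0) by rewrite subr0 expr2 mulrA.
  apply: (@rder_mean_value R q1 q2 0 x) => //.
    by move=> t /andP[t0 _]; exact: dq1.
  move=> t /andP[t0 tx]; rewrite (le_trans (q2_bound _)) ?t0 ?(le_trans tx) //.
  by rewrite ler_wpM2l.
move=> /andP[u0 u1].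
have -> : q u = q u - q 0 by rewrite /q !P0 mul0r mulr0 sub0r addNr subr0.
have -> : K * u ^+ 3 = K * u ^+ 2 * (u - 0) by rewrite subr0 exprSr mulrA.
apply: (@rder_mean_value R q q1 0 u) => //.
  by move=> t /andP[t0 _]; exact: dq.
move=> t /andP[t0 tx]; rewrite (le_trans (q1b _ _)) ?t0 ?(le_trans tx) //.
by rewrite ler_wpM2l // lerXn2r.
Qed.

(** $(k+1)^{1-s} q(1/(k+1))$, the error of the trapezoid rule on $[k+1, k+2]$. *)
Definition xi_term (k : nat) : C :=
  (s - 1) * ((natpow k.+1 (- s) + natpow k.+2 (- s)) / 2)
  - natpow k.+1 (1 - s) + natpow k.+2 (1 - s).

(** The error [q] vanishes to the third order at $0$. *)
Lemma xi_term_bound k :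
  normc (xi_term k) <= K * npw k.+1 (- complex.Re s - 2).
Proof.
pose u : R := k.+1%:R^-1.
have k0 : 0 < (k.+1%:R : R) by rewrite ltr0n.
have u01 : 0 <= u <= 1 by rewrite invr_ge0 ltW //= invf_le1 // ler1n.
have PE a : natpow k.+2 a = natpow k.+1 a * P a u.
  rewrite /natpow /P -cexpD -mulrDl -rmorphD -lnM ?posrE // ?ltr_pwDl ?invr_ge0 ?ltW //.
  by rewrite mulrDr mulr1 divff ?gt_eqF // natr1.
have pE : natpow k.+1 (- s) = natpow k.+1 (1 - s) * (u%:C)%C.
  have kn0 : (k.+1%:R : C) != 0 by rewrite pnatr_eq0.
  by rewrite natpowD natpow1 // mulrAC /u fmorphV rmorph_nat divff // mul1r.
have -> : xi_term k = natpow k.+1 (1 - s) * q u.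
  by rewrite /xi_term !PE pE /q; field.
rewrite normcM normc_natpow Re_add Re_opp /=.
have -> : npw k.+1 (- complex.Re s - 2) = npw k.+1 (1 - complex.Re s) * u ^+ 3.
  have -> : - complex.Re s - 2 = (1 - complex.Re s) + (- 1 + (- 1 + - 1)) by ring.
  rewrite npwD; congr (_ * _); rewrite npwD npwD npwN npw1 // -/u; ring.
by rewrite mulrCA ler_wpM2l ?npw_ge0 // q_bound.
Qed.

End Quadrature.

(** $(s - 1) \zeta(s)$, continued to $\Re s > -1$: the trapezoid rule compares the
    sum of the $k^{-s}$ with the integral of $x^{-s}$, which is $1/(s - 1)$. The factor
    $s - 1$ removes the pole, so that no meromorphic function of one variable is
    involved. *)
Definition xi (s : C) : C :=
  (s - 1) / 2 + 1 + lim ((fun N => \sum_(k < N) xi_term s k) @ \oo).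

Lemma xi_term_majorant (p : C) (r : R) : 0 < r -> -1 + r < complex.Re p - r ->
  exists A : nat -> R, exists B, (forall N, \sum_(k < N) A k <= B) /\
    forall s, normc (s - p) < r -> forall k, normc (xi_term s k) <= A k.
Proof.
move=> r0 pr; pose M := normc p + r.
pose K : R := (M + 1) ^+ 3 * expR (M + 2).
have M0 : 0 < M by rewrite ltr_wpDl // normc_ge0.
have K0 : 0 <= K by rewrite mulr_ge0 ?expR_ge0 // exprn_ge0 // addr_ge0 // ltW.
have [B hB] := @npw_sum_bound R (1 + r) ltac:(by rewrite ltrDl).
exists (fun k => K * npw k.+1 (- (1 + r))), (K * B); split.
  by move=> N; rewrite -mulr_sumr ler_wpM2l.
move=> s sp k; have sM : normc s <= M.
  have -> : s = p + (s - p) by ring.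
  by rewrite (le_trans (ler_normcD _ _)) // lerD2l ltW.
apply: le_trans (xi_term_bound s k) _.
apply: ler_pM; rewrite ?npw_ge0 ?mulr_ge0 ?expR_ge0 ?exprn_ge0 ?addr_ge0 ?normc_ge0 //.
  apply: ler_pM; rewrite ?exprn_ge0 ?expR_ge0 ?addr_ge0 ?normc_ge0 //.
    by rewrite lerXn2r // ?nnegrE ?lerD2r // addr_ge0 ?normc_ge0 // ltW.
  by rewrite ler_expR lerD2r.
apply: ler_npw; have := le_lt_trans (normc_Re _) sp.
by rewrite Re_add Re_opp ltr_norml => /andP[l _]; move: l pr; lra.
Qed.

Lemma xi_series_cvg (s : C) : -1 < complex.Re s ->
  (fun N => \sum_(k < N) xi_term s k) @ \oo -->
  lim ((fun N => \sum_(k < N) xi_term s k) @ \oo).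
Proof.
move=> s1; pose r := (complex.Re s + 1) / 4.
have r0 : 0 < r by rewrite divr_gt0 // -ltrBlDr sub0r.
have [|A [B [hB hA]]] := @xi_term_majorant s r r0; first by rewrite /r; lra.
have [l hl] : exists l : C, (fun N => \sum_(k < N) xi_term s k) @ \oo --> l.
  apply: (@abs_series_cvg _ _ B) => N; apply: le_trans (hB N).
  by apply: ler_sum => k _; apply: hA; rewrite subrr normc0.
by rewrite (cvg_lim (@norm_hausdorff _ _) hl).
Qed.

Lemma xi_differentiable (s : C) : -1 < complex.Re s -> differentiable xi s.
Proof.
move=> s1; pose r := (complex.Re s + 1) / 4.
have r0 : 0 < r by rewrite divr_gt0 // -ltrBlDr sub0r.
have [|A [B [hB hA]]] := @xi_term_majorant s r r0; first by rewrite /r; lra.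
have h : differentiable (fun s => lim ((fun N => \sum_(k < N) xi_term s k) @ \oo)) s.
  apply: (@weierstrass_mtest R C (fun k s => xi_term s k) _ s r B A r0).
  - move=> k v _; rewrite /xi_term.
    have h1 : differentiable (fun w : C => 1 - w) v by apply: hol_sub (hol_cst _ _) (hol_id _).
    have h2 : differentiable (fun w : C => - w) v by apply: hol_opp (hol_id _).
    apply: hol_add (natpow_differentiable _ h1).
    apply: hol_sub (natpow_differentiable _ h1).
    apply: hol_mul; first by apply: hol_sub (hol_id _) (hol_cst _ _).
    by apply: hol_mul (hol_cst _ _); apply: hol_add; exact: natpow_differentiable.
  - by move=> k v; rewrite nrm_normc => /hA.
  - exact: hB.
  - move=> v; rewrite nrm_normc => vs; apply: xi_series_cvg.
    have := le_lt_trans (normc_Re _) vs.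
    by rewrite Re_add Re_opp ltr_norml => /andP[l _]; move: l s1; rewrite /r; lra.
rewrite /xi; apply: hol_add h; apply: hol_add (hol_cst _ _).
by apply: hol_mul (hol_cst _ _); apply: hol_sub (hol_id _) (hol_cst _ _).
Qed.

Lemma xi_zeta (s : C) : 1 < complex.Re s ->
  (fun N => (s - 1) * \sum_(k < N) natpow k.+1 (- s)) @ \oo --> xi s.
Proof.
move=> s1.
have E N : \sum_(k < N) xi_term s k =
  (s - 1) * (\sum_(k < N.+1) natpow k.+1 (- s) - 1 / 2 - natpow N.+1 (- s) / 2)
   - 1 + natpow N.+1 (1 - s).
  elim: N => [|N ih].
    by rewrite big_ord0 big_ord_recl big_ord0 !natpow1l; field.
  by rewrite big_ord_recr /= ih [\sum_(k < N.+2) _]big_ord_recr /= /xi_term; field.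
have small (w : C) : complex.Re w < 0 -> (fun N => natpow N.+1 w) @ \oo --> (0 : C).
  move=> w0; apply/cvg_seq_normcP => e e0.
  have [|N hN] := @npw_small R (- complex.Re w) e _ e0; first by rewrite oppr_gt0.
  by exists N => n /hN; rewrite opprK subr0 normc_natpow.
have h1 : (fun N => natpow N.+1 (- s)) @ \oo --> (0 : C).
  by apply: small; rewrite Re_opp; lra.
have h2 : (fun N => natpow N.+1 (1 - s)) @ \oo --> (0 : C).
  by apply: small; rewrite Re_add Re_opp /=; lra.
have hx : (fun N => (s - 1) / 2 + 1 + \sum_(k < N) xi_term s k) @ \oo --> xi s.
  have s1' : -1 < complex.Re s by lra.
  exact: cvgDC (@cvg_cstC _ ((s - 1) / 2 + 1)) (xi_series_cvg s1').
have : (fun N => (s - 1) / 2 + 1 + \sum_(k < N) xi_term s k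
   - ((s - 1) / 2 * natpow N.+1 (- s) + natpow N.+1 (1 - s))) @ \oo --> xi s - ((s - 1) / 2 * 0 + 0).
  exact: cvgBC hx (cvgDC (cvgZC h1) h2).
rewrite mulr0 addr0 subr0; apply: (cvg_eq_eventually (N := 0)) => N _.
by rewrite E big_ord_recr /=; field.
Qed.

End Xi.

(** * Unordered sums and Euler products *)

Lemma cvg_normc_le_near {R : realType} (u : nat -> R[i]) (l : R[i]) (B : R) N0 :
  u @ \oo --> l -> (forall n, (N0 <= n)%N -> normc (u n) <= B) -> normc l <= B.
Proof.
move=> /cvg_seq_normcP h uB; apply/ler_addgt0Pr => e /h[N hN].
have l1 := hN _ (leq_maxl N N0); have l2 := uB _ (leq_maxr N N0).
have -> : l = u (maxn N N0) - (u (maxn N N0) - l) by ring.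
by rewrite (le_trans (ler_normcB _ _)) // lerD // ltW.
Qed.

Section UnorderedSums.
Context {R : realType}.
Local Notation C := R[i].
Variable I : choiceType.
Implicit Types (P : pred I) (A : seq I).

(** Unconditional summation of [f] over the indices satisfying [P]. *)
Definition has_sum P (f : I -> C) (S : C) := forall e : R, 0 < e ->
  exists A0, all P A0 /\ forall A, uniq A -> all P A -> {subset A0 <= A} ->
    normc (\sum_(i <- A) f i - S) < e.

Definition abs_bounded P (f : I -> C) (B : R) :=
  forall A, uniq A -> all P A -> \sum_(i <- A) normc (f i) <= B.

Lemma sum_subseq_le (g : I -> R) A0 A : (forall i, 0 <= g i) -> uniq A0 -> uniq A ->
  {subset A0 <= A} -> \sum_(i <- A0) g i <= \sum_(i <- A) g i.
Proof.
move=> g0 u0 u s; rewrite [leRHS](bigID (mem A0)) /=.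
have -> : \sum_(i <- A | i \in A0) g i = \sum_(i <- A0) g i.
  rewrite -big_filter; apply: perm_big; apply: uniq_perm; rewrite ?filter_uniq //.
  by move=> x; rewrite mem_filter; apply/andP/idP => [[]//|xA]; split => //; exact: s.
by rewrite lerDl sumr_ge0.
Qed.

Lemma nonneg_has_sum P (g : I -> R) (B : R) : (forall i, 0 <= g i) ->
  (forall A, uniq A -> all P A -> \sum_(i <- A) g i <= B) ->
  exists S : R, forall e, 0 < e -> exists A0, [/\ uniq A0, all P A0 &
    forall A, uniq A -> all P A -> {subset A0 <= A} ->
      S - e < \sum_(i <- A) g i <= S].
Proof.
move=> g0 gB; pose X := [set x | exists A, [/\ uniq A, all P A & x = \sum_(i <- A) g i]].
have hX : has_sup X.
  split; first by exists 0, [::]; rewrite big_nil.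
  by exists B => _ [A [u a ->]]; exact: gB.
exists (sup X) => e e0; have [_ [A0 [u0 a0 ->]] l0] := sup_adherent e0 hX.
exists A0; split => // A u a s; rewrite (lt_le_trans l0) ?sum_subseq_le //=.
by apply: sup_ubound; [case: hX|exists A].
Qed.

(** Adding the moduli to the real and imaginary parts reduces to nonnegative terms. *)
Lemma abs_has_sum P f B : abs_bounded P f B -> exists S, has_sum P f S.
Proof.
move=> fB.
have H (w : I -> R) : (forall i, `|w i| <= normc (f i)) -> exists S : R, forall e, 0 < e ->
    exists A0, all P A0 /\ forall A, uniq A -> all P A -> {subset A0 <= A} ->
    `|\sum_(i <- A) w i - S| < e.
  move=> wf; have [|A u a|S1 h1] := @nonneg_has_sum P (fun i => w i + normc (f i)) (B + B).
  - by move=> i; have := wf i; rewrite ler_norml; lra.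
  - rewrite big_split lerD ?fB // (le_trans _ (fB A u a)) // ler_sum // => i _.
    by rewrite (le_trans (ler_norm _)).
  have [S2 h2] := @nonneg_has_sum P (fun i => normc (f i)) B (fun i => normc_ge0 _) fB.
  exists (S1 - S2) => e e0.
  have [A1 [u1 a1 hA1]] := h1 _ e0; have [A2 [u2 a2 hA2]] := h2 _ e0.
  exists (A1 ++ A2); split=> [|A u a s]; first by rewrite all_cat a1.
  have /andP[] := hA1 A u a (fun x xA => s x ltac:(by rewrite mem_cat xA)).
  have /andP[] := hA2 A u a (fun x xA => s x ltac:(by rewrite mem_cat xA orbT)).
  rewrite big_split /= ltr_norml; lra.
have [a ha] := H _ (fun i => normc_Re (f i)).
have [b hb] := H _ (fun i => normc_Im (f i)).
exists (a +i* b)%C => e e0; have e2 : 0 < e / 2 by rewrite divr_gt0.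
have [A1 [a1 hA1]] := ha _ e2; have [A2 [a2 hA2]] := hb _ e2.
exists (A1 ++ A2); split=> [|A u al s]; first by rewrite all_cat a1.
rewrite (le_lt_trans (normc_le _)) // (splitr e) ltrD //.
  rewrite Re_add Re_opp Re_sum; apply: hA1 => // x xA; apply: s.
  by rewrite mem_cat xA.
rewrite Im_add Im_opp Im_sum; apply: hA2 => // x xA; apply: s.
by rewrite mem_cat xA orbT.
Qed.

Lemma has_sum_unique P f S T : has_sum P f S -> has_sum P f T -> S = T.
Proof.
move=> hS hT; apply/eqP; rewrite -subr_eq0 -normc_eq0 eq_le normc_ge0 andbT.
apply/ler_addgt0Pr => e e0; rewrite add0r; have e2 : 0 < e / 2 by rewrite divr_gt0.
have [A0 [a0 h0]] := hS _ e2; have [A1 [a1 h1]] := hT _ e2.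
pose A := undup (A0 ++ A1).
have aA : all P A by apply/allP => i; rewrite mem_undup mem_cat => /orP[/(allP a0)|/(allP a1)].
have := h0 A (undup_uniq _) aA ltac:(by move=> i iA; rewrite mem_undup mem_cat iA).
have := h1 A (undup_uniq _) aA ltac:(by move=> i iA; rewrite mem_undup mem_cat iA orbT).
have -> : S - T = (\sum_(i <- A) f i - T) - (\sum_(i <- A) f i - S) by ring.
by move=> l1 l2; apply: le_trans (ler_normcB _ _) _; lra.
Qed.

Lemma eq_has_sum P Q f S : P =1 Q -> has_sum P f S -> has_sum Q f S.
Proof.
move=> PQ h e /h[A0 [a0 hA]]; exists A0; rewrite -(eq_all PQ); split=> // A u.
by rewrite -(eq_all PQ); exact: hA.
Qed.

Lemma has_sum_seq P f S (E : nat -> seq I) : has_sum P f S ->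
  (forall N, uniq (E N)) -> (forall N, all P (E N)) ->
  (forall i, P i -> exists N0, forall N, (N0 <= N)%N -> i \in E N) ->
  (fun N => \sum_(i <- E N) f i) @ \oo --> S.
Proof.
move=> fS uE aE exE; apply/cvg_seq_normcP => e /fS[A0 [a0 h]].
have [N0 hN0] : exists N0, forall N, (N0 <= N)%N -> {subset A0 <= E N}.
  elim: A0 a0 {h} => [_|i A0 ih /= /andP[Pi /ih[N1 h1]]]; first by exists 0%N.
  have [N2 h2] := exE i Pi; exists (maxn N1 N2) => N; rewrite geq_max => /andP[/h1 l1 /h2 l2].
  by move=> j; rewrite inE => /predU1P[->//|/l1].
by exists N0 => N /hN0 s; exact: h.
Qed.

(** Outside a suitable finite set, all finite sums of an absolutely summable
    family are small. *)
Lemma abs_bounded_tail P f B : abs_bounded P f B -> forall e : R, 0 < e ->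
  exists A0, all P A0 /\ forall A, uniq A -> all P A -> (forall i, i \in A -> i \notin A0) ->
    \sum_(i <- A) normc (f i) <= e.
Proof.
move=> fB e e0.
have [S h] := @nonneg_has_sum P (fun i => normc (f i)) B (fun i => normc_ge0 _) fB.
have [A0 [u0 a0 hA0]] := h _ e0; exists A0; split=> // A u a d.
have /andP[l1 _] := hA0 A0 u0 a0 (fun x xA => xA).
have uc : uniq (A0 ++ A).
  by rewrite cat_uniq u0 u andbT /=; apply/hasPn => i /d.
have /andP[_] := hA0 (A0 ++ A) uc ltac:(by rewrite all_cat a0) (fun x xA => ltac:(by rewrite mem_cat xA)).
by rewrite big_cat /=; move: l1; lra.
Qed.

Lemma abs_bounded_sub (P Q : pred I) f B : (forall i, Q i -> P i) -> abs_bounded P f B ->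
  abs_bounded Q f B.
Proof. by move=> QP fB A u /allP a; apply: fB => //; apply/allP => i /a /QP. Qed.

End UnorderedSums.

Section EulerProduct.
Context {R : realType}.
Local Notation C := R[i].
Variable n : nat.
Local Notation V := {ffun 'I_n -> nat}.
Implicit Types (u v k : V).

Definition box N : seq V :=
  [seq [ffun i => val (g i)] | g : {ffun 'I_n -> 'I_N}].

Lemma box_uniq N : uniq (box N).
Proof.
rewrite /box map_inj_uniq ?enum_uniq // => g h /ffunP E; apply/ffunP => i.
by have := E i; rewrite !ffunE => /val_inj.
Qed.

Lemma mem_box N v : (v \in box N) = [forall i, v i < N]%N.
Proof.
apply/mapP/forallP => [[g _ ->] i|h]; first by rewrite ffunE ltn_ord.
exists [ffun i => Ordinal (h i)]; first by rewrite mem_enum.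
by apply/ffunP => i; rewrite !ffunE.
Qed.

Lemma box_exhausts v : exists N0, forall N, (N0 <= N)%N -> v \in box N.
Proof.
exists (\max_i v i).+1 => N lN; rewrite mem_box; apply/forallP => i.
by rewrite (leq_ltn_trans _ lN) // leq_bigmax.
Qed.

Lemma sum_box_prod (T : comPzSemiRingType) N (F : 'I_n -> nat -> T) :
  \sum_(v <- box N) \prod_i F i (v i) = \prod_i \sum_(j < N) F i j.
Proof.
rewrite /box big_map big_enum /= bigA_distr_bigA /=.
by apply: eq_bigr => g _; apply: eq_bigr => i _; rewrite ffunE.
Qed.

Definition pos v := [forall i, 0 < v i]%N.

Definition rough X v :=
  pos v && [forall i, forall p : 'I_X, prime p ==> ~~ (p %| v i)%N].

Definition onev : V := [ffun=> 1%N].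

Definition ppow (p : nat) k : V := [ffun i => p ^ k i]%N.

Definition mulv u v : V := [ffun i => u i * v i]%N.

Lemma roughP X v : reflect ((forall i, 0 < v i)%N /\
  forall i p, (p < X)%N -> prime p -> ~~ (p %| v i)%N) (rough X v).
Proof.
apply: (iffP andP) => [[/forallP h1 /forallP h2]|[h1 h2]]; split=> //.
- move=> i p pX pp; have /forallP/(_ (Ordinal pX)) := h2 i.
  by rewrite /= pp.
- exact/forallP.
- by apply/forallP => i; apply/forallP => p; apply/implyP; exact: h2.
Qed.

(* [loc p k] is the value of [b] at the vector of the powers p ^ k i *)
Variables (b : V -> C) (loc : nat -> V -> C) (B : R).
Hypothesis b_bounded : abs_bounded pos b B.
Hypothesis b1 : b onev = 1.
Hypothesis b_mul : forall p k v, prime p -> pos v -> (forall i, ~~ (p %| v i)%N) ->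
  b (mulv (ppow p k) v) = loc p k * b v.

Let rough_pos X v : rough X v -> pos v. Proof. by case/andP. Qed.

Let rough_bounded X : abs_bounded (rough X) b B.
Proof. exact: abs_bounded_sub (@rough_pos X) b_bounded. Qed.

Let ppow1 p k : mulv (ppow p k) onev = ppow p k.
Proof. by apply/ffunP => i; rewrite !ffunE muln1. Qed.

Let loc_b p k : prime p -> loc p k = b (ppow p k).
Proof.
move=> pp; rewrite -ppow1 b_mul //; first by rewrite b1 mulr1.
  by apply/forallP => i; rewrite ffunE.
by move=> i; rewrite ffunE dvdn1 neq_ltn prime_gt1 // orbT.
Qed.

Lemma loc_bounded p : prime p -> abs_bounded xpredT (loc p) B.
Proof.
move=> pp A u _; have := @b_bounded (map (ppow p) A).
rewrite big_map.
have -> : \sum_(k <- A) normc (loc p k) = \sum_(k <- A) normc (b (ppow p k)).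
  by apply: eq_bigr => k _; rewrite loc_b.
apply.
  rewrite map_inj_uniq // => k l /ffunP E; apply/ffunP => i; have := E i.
  by rewrite !ffunE => /eqP; rewrite eqn_exp2l ?prime_gt1 // => /eqP.
by apply/allP => _ /mapP[k _ ->]; apply/forallP => i; rewrite ffunE expn_gt0 prime_gt0.
Qed.

(** Splitting off the powers of [p], every vector rough below [p] is uniquely a
    product of a vector of powers of [p] and a vector rough up to [p]. *)
Let rough_step_prime p S Lam T : prime p -> has_sum (rough p) b S ->
  has_sum xpredT (loc p) Lam -> has_sum (rough p.+1) b T -> S = Lam * T.
Proof.
move=> pp hS hL hT.
pose TN N := [seq v <- box N | rough p.+1 v].
pose E N := [seq mulv (ppow p k) v | k <- box N, v <- TN N].
have TP N v : v \in TN N -> (forall i, 0 < v i)%N /\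
    forall i q, (q <= p)%N -> prime q -> ~~ (q %| v i)%N.
  by rewrite mem_filter => /andP[/roughP].
have uE N : uniq (E N).
  apply: allpairs_uniq; [exact: box_uniq|by rewrite filter_uniq // box_uniq|].
  move=> [k v] [k' v'] /allpairsP[[k1 v1] /= [_ h1 [-> ->]]].
  move=> /allpairsP[[k2 v2] /= [_ h2 [-> ->]]] /ffunP EE.
  have [p1 q1] := TP _ _ h1; have [p2 q2] := TP _ _ h2.
  have lognE (e v0 : nat) : (0 < v0)%N -> ~~ (p %| v0)%N -> logn p (p ^ e * v0)%N = e.
    move=> v00 h; have pe : (0 < p ^ e)%N by rewrite expn_gt0 prime_gt0.
    have -> : logn p (p ^ e * v0)%N = (logn p (p ^ e)%N + logn p v0)%N by rewrite lognM.
    by rewrite pfactorK // (lognE p v0) pp v00 (negbTE h) addn0.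
  have Ek : k1 = k2.
    apply/ffunP => i; have := congr1 (logn p) (EE i); rewrite !ffunE /=.
    by rewrite !lognE //; [apply: q2|apply: q1].
  congr pair => //; apply/ffunP => i; have := EE i; rewrite !ffunE /= Ek => /eqP.
  by rewrite eqn_pmul2l ?expn_gt0 ?prime_gt0 // => /eqP.
have aE N : all (rough p) (E N).
  apply/allP => _ /allpairsP[[k v] /= [_ vT ->]]; have [v0 vq] := TP _ _ vT.
  apply/roughP; split=> i; first by rewrite !ffunE muln_gt0 expn_gt0 prime_gt0 //= v0.
  move=> q qp qq; rewrite !ffunE Euclid_dvdM // negb_or vq ?(ltnW qp) // andbT.
  apply/negP => h; have : (q %| p)%N by move: h; rewrite Euclid_dvdX // => /andP[].
  by rewrite dvdn_prime2 // => /eqP E0; rewrite E0 ltnn in qp.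
have exE v : rough p v -> exists N0, forall N, (N0 <= N)%N -> v \in E N.
  move=> /roughP[v0 vq].
  pose k : V := [ffun i => logn p (v i)]; pose w : V := [ffun i => (v i)`_p^']%N.
  have Ev : v = mulv (ppow p k) w.
    by apply/ffunP => i; rewrite !ffunE -p_part partnC.
  have [N1 h1] := box_exhausts k; have [N2 h2] := box_exhausts w.
  exists (maxn N1 N2) => N; rewrite geq_max => /andP[/h1 l1 /h2 l2].
  rewrite Ev; apply/allpairsP; exists (k, w); split=> //=.
  rewrite mem_filter l2 andbT; apply/roughP; split=> i; first by rewrite ffunE part_gt0.
  move=> q qp qq; rewrite ffunE; apply/negP => qd.
  move: qp; rewrite ltnS leq_eqVlt => /predU1P[E0|qp].
    rewrite E0 in qq qd.
    by have := part_pnat (p^')%N (v i) => /(pnatP _ (part_gt0 _ _))/(_ p qq qd); rewrite !inE eqxx.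
  have /negP[] := vq i q qp qq; apply: dvdn_trans qd _; exact: dvdn_part.
have c1 := has_sum_seq hS uE aE exE.
have c2 := has_sum_seq hL box_uniq (fun N => all_predT _) (fun v _ => box_exhausts v).
have c3 : (fun N => \sum_(v <- TN N) b v) @ \oo --> T.
  apply: has_sum_seq hT _ _ _ => [N|N|v rv].
  - by rewrite filter_uniq // box_uniq.
  - exact: filter_all.
  by have [N0 h] := box_exhausts v; exists N0 => N /h l; rewrite mem_filter rv.
apply: cvg_uniqueC c1 _; apply: (cvg_eq_eventually (N := 0)) (cvgMC c2 c3) => N _.
rewrite /E big_allpairs_dep /= mulr_suml; apply: eq_bigr => k _.
rewrite mulr_sumr !big_seq; apply: eq_bigr => v /TP[v0 vq].
by rewrite b_mul //; [exact/forallP|move=> i; exact: vq].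
Qed.

Let rough_step_nonprime X v : ~~ prime X -> rough X.+1 v = rough X v.
Proof.
move=> nX; apply/roughP/roughP => -[h1 h2]; split => // i p pX pp.
  by apply: h2 => //; exact: ltnW.
move: pX; rewrite ltnS leq_eqVlt => /predU1P[E|pX]; last exact: h2.
by rewrite E (negbTE nX) in pp.
Qed.

Let rough0 v : rough 0 v = pos v.
Proof.
by rewrite /rough andb_idr // => _; apply/forallP => i; apply/forallP => -[].
Qed.

(** Euler product: removing the primes one at a time factors the sum as a
    finite product of local sums times the sum over rough vectors, which tends
    to the term of $(1, \dots, 1)$. *)
Theorem euler_product S (Lam : nat -> C) : has_sum pos b S ->
  (forall p, prime p -> has_sum xpredT (loc p) (Lam p)) ->
  (fun X => \prod_(p < X | prime p) Lam p) @ \oo --> S /\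
  exists2 A : nat -> C, A @ \oo --> (1 : C) &
    forall X, S = (\prod_(p < X | prime p) Lam p) * A X.
Proof.
move=> hS hL.
have [A hA] := choice (fun X => abs_has_sum (@rough_bounded X)).
have prodE X : S = (\prod_(p < X | prime p) Lam p) * A X.
  elim: X => [|X ->].
    rewrite big_ord0 mul1r.
    have h0 : has_sum (rough 0) b S by apply: eq_has_sum hS => v; rewrite rough0.
    exact: has_sum_unique h0 (hA 0%N).
  rewrite [in RHS]big_mkcond big_ord_recr /= -big_mkcond /=; case: ifP => [pX|/negbT nX].
    by rewrite -mulrA -(rough_step_prime pX (hA X) (hL _ pX) (hA X.+1)).
  rewrite mulr1; congr (_ * _).
  apply: has_sum_unique (hA X) _; apply: eq_has_sum (hA X.+1) => v.
  exact: rough_step_nonprime.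
(* beyond X, a rough vector with an entry > 1 lies outside the finite set A0 *)
have A1 : A @ \oo --> (1 : C).
  apply/cvg_seq_normcP => e e0; have e2 : 0 < e / 2 by rewrite divr_gt0.
  have [A0 [a0 tail]] := abs_bounded_tail b_bounded e2.
  exists (\max_(v <- A0) \max_i v i).+1 => X lX; apply: le_lt_trans (_ : _ <= e / 2) _; last first.
    by rewrite ltr_pdivrMr // mulr_natr mulr2n ltrDl.
  have x1 N : uniq [seq v <- box N | rough X v] by rewrite filter_uniq // box_uniq.
  have x2 N : all (rough X) [seq v <- box N | rough X v] by exact: filter_all.
  have x3 v : rough X v -> exists N0, forall N, (N0 <= N)%N -> v \in [seq v <- box N | rough X v].
    by move=> rv; have [N0 h] := box_exhausts v; exists N0 => N /h l; rewrite mem_filter rv.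
  have c1 := cvgBC (has_sum_seq (hA X) x1 x2 x3) (@cvg_cstC _ 1).
  have r1 : rough X onev.
    apply/roughP; split=> i; first by rewrite ffunE.
    by move=> p _ pp; rewrite ffunE dvdn1 neq_ltn prime_gt1 // orbT.
  have [N0 hN0] := x3 _ r1.
  apply: (cvg_normc_le_near (N0 := N0)) c1 _ => N NN.
  rewrite (bigD1_seq onev) ?hN0 //= b1 addrAC subrr add0r.
  rewrite (le_trans (ler_normc_sum _ _ _)) // -big_filter; apply: tail.
  - by rewrite !filter_uniq // box_uniq.
  - apply/allP => v; rewrite mem_filter => /andP[_]; rewrite mem_filter => /andP[rv _].
    exact: rough_pos rv.
  move=> v; rewrite mem_filter => /andP[v1]; rewrite mem_filter => /andP[/roughP[v0 vq] _].
  apply/negP => vA; move/eqP: v1; apply; apply/ffunP => i; rewrite ffunE.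
  apply/eqP; rewrite eqn_leq v0 andbT leqNgt; apply/negP => vi.
  have pX : (pdiv (v i) < X)%N.
    apply: leq_ltn_trans lX; apply: leq_trans (pdiv_leq (v0 i)) _.
    apply: (@leq_trans (\max_i v i)); first exact: (leq_bigmax (F := fun i => v i)).
    by rewrite (big_rem v vA) /= leq_maxl.
  by have := vq i _ pX (pdiv_prime vi); rewrite pdiv_dvd.
split; last by exists A.
apply/cvg_seq_normcP => e e0.
pose K := 2 * normc S + 1.
have K0 : 0 < K by rewrite ltr_wpDl // mulr_ge0 // normc_ge0.
move/cvg_seq_normcP : A1 => /(_ (Num.min (1 / 2) (e / K))).
move=> []; first by rewrite lt_min !divr_gt0.
move=> N hN; exists N => X /hN; rewrite lt_min => /andP[l1 l2].
set P := \prod_(p < X | prime p) Lam p.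
have A2 : 1 / 2 <= normc (A X).
  by have := ler_dist_normc 1 (A X); rewrite normc1 normc_distC; move: l1; lra.
have PS : normc P <= 2 * normc S.
  rewrite {1}(prodE X) -/P normcM.
  by have := ler_wpM2l (normc_ge0 P) A2; lra.
have -> : P - S = - (P * (A X - 1)) by rewrite {1}(prodE X) -/P; ring.
rewrite normcN normcM; move: l2; rewrite ltr_pdivlMr // mulrC => l2.
apply: le_lt_trans l2; rewrite ler_wpM2r ?normc_ge0 // (le_trans PS) // /K lerDl //.
Qed.

End EulerProduct.

Lemma big_iota0 (T : nmodType) N (F : nat -> T) :
  \sum_(k <- iota 0 N) F k = \sum_(k < N) F k.
Proof. by rewrite -{1}(subn0 N) -/(index_iota 0 N) big_mkord. Qed.

Lemma big_iota1 (T : nmodType) N (F : nat -> T) :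
  \sum_(k <- iota 1 N) F k = \sum_(k < N) F k.+1.
Proof. by rewrite (iotaDl 1 0) big_map big_iota0. Qed.

Section ZetaEuler.
Context {R : realType}.
Local Notation C := R[i].

Lemma geometric_cvg (q : C) : normc q < 1 ->
  (fun N => \sum_(k < N) q ^+ k) @ \oo --> (1 - q)^-1.
Proof.
move=> q1; have q0 : 1 - q != 0.
  by apply: contraTneq q1 => /eqP; rewrite subr_eq0 => /eqP <-; rewrite normc1 ltxx.
have qn : 0 < normc (1 - q) by rewrite normc_gt0.
apply/cvg_seq_normcP => e e0.
have [|N hN] := @expr_small _ (normc q) (e * normc (1 - q)) _ (mulr_gt0 e0 qn).
  by rewrite normc_ge0.
exists N => n /hN; have -> : \sum_(k < n) q ^+ k - (1 - q)^-1 = - (q ^+ n / (1 - q)).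
  apply: (mulIf q0); rewrite mulNr divfK // mulrBl mulVf //.
  have -> : (\sum_(k < n) q ^+ k) * (1 - q) = 1 - q ^+ n.
    by rewrite -[RHS]opprB subrX1; ring.
  by ring.
by rewrite normcN normcM normcV normcX ltr_pdivrMr.
Qed.

Lemma npw_nat_bounded (a : R) : 1 < a -> exists B, forall A : seq nat, uniq A ->
  (forall k, k \in A -> 0 < k)%N -> \sum_(k <- A) npw k (- a) <= B.
Proof.
move=> /npw_sum_bound[B hB]; exists B => A u A0.
pose N := (\max_(k <- A) k).+1.
apply: (@le_trans _ _ (\sum_(k <- iota 1 N) npw k (- a))); last first.
  by rewrite big_iota1.
apply: sum_subseq_le => //; first by move=> k; exact: npw_ge0.
  exact: iota_uniq.
move=> k kA; rewrite mem_iota A0 //= /N add1n !ltnS (leq_trans _ (leqnSn _)) //.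
by rewrite (big_rem k kA) leq_maxl.
Qed.

(** $\zeta(w) \prod_p (1 - p^{-w}) = 1$, multiplied by $w - 1$: the case of a single
    variable and of the constant coefficients $1$ in [euler_product]. *)
Lemma xi_euler (w : C) : 1 < complex.Re w ->
  (fun X => xi w * \prod_(p < X | prime p) (1 - natpow p (- w))) @ \oo --> w - 1.
Proof.
move=> w1; have [B hB] := npw_nat_bounded w1.
pose b (v : {ffun 'I_1 -> nat}) : C := natpow (v ord0) (- w).
pose loc p (k : {ffun 'I_1 -> nat}) : C := natpow p (- w) ^+ (k ord0).
have inj : injective (fun v : {ffun 'I_1 -> nat} => v ord0).
  by move=> u v E; apply/ffunP => i; rewrite ord1.
have bB : abs_bounded (@pos 1) b B.
  move=> A u /allP a; have := hB [seq v ord0 | v : {ffun 'I_1 -> nat} <- A].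
  rewrite big_map (eq_bigr (fun v => normc (b v))); last first.
    by move=> v _; rewrite normc_natpow Re_opp.
  apply; first by rewrite map_inj_uniq.
  by move=> _ /mapP[v /a /forallP v0 ->].
have b1 : b (onev 1) = 1 by rewrite /b ffunE natpow1l.
have bM p (k v : {ffun 'I_1 -> nat}) : prime p -> pos v -> (forall i, ~~ (p %| v i)%N) ->
    b (mulv (ppow p k) v) = loc p k * b v.
  move=> pp /forallP/(_ ord0) v0 _; rewrite /b /loc !ffunE natpowM ?v0 ?expn_gt0 ?prime_gt0 //.
  by rewrite natpowX.
have [S hS] := abs_has_sum bB.
have cS : (fun N => \sum_(k < N) natpow k.+1 (- w)) @ \oo --> S.
  have h := has_sum_seq hS (E := fun N => [seq [ffun=> k.+1] | k <- iota 0 N]).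
  apply: (cvg_eq_eventually (N := 0)) (h _ _ _) => [N _|N|N|v /forallP v0].
  - by rewrite big_map big_iota0; apply: eq_bigr => k _; rewrite /b ffunE.
  - rewrite map_inj_uniq ?iota_uniq // => k l /ffunP/(_ ord0).
    by rewrite !ffunE => -[].
  - by apply/allP => _ /mapP[k _ ->]; apply/forallP => i; rewrite ffunE.
  exists (v ord0) => N vN; apply/mapP; exists (v ord0).-1.
    by rewrite mem_iota /= add0n (leq_trans _ vN) // prednK.
  by apply/ffunP => i; rewrite ffunE ord1 prednK.
have xiE : xi w = (w - 1) * S.
  exact: cvg_uniqueC (xi_zeta w1) (cvgZC cS).
have q1 p : prime p -> normc (natpow p (- w)) < 1.
  move=> pp; rewrite normc_natpow Re_opp -expR0 ltr_expR pmulr_llt0 ?oppr_lt0.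
    by rewrite (lt_trans _ w1).
  by rewrite ln_nat_gt0 // prime_gt1.
have hL p : prime p -> has_sum xpredT (loc p) (1 - natpow p (- w))^-1.
  move=> pp; have [L hL] := abs_has_sum (loc_bounded bB b1 bM pp).
  have c1 := has_sum_seq hL (@box_uniq 1) (fun N => all_predT _) (fun v _ => box_exhausts v).
  have -> // : (1 - natpow p (- w))^-1 = L.
  apply: cvg_uniqueC (geometric_cvg (q1 p pp)) _.
  apply: (cvg_eq_eventually (N := 0)) c1 => N _.
  have := sum_box_prod (n := 1) N (fun _ j => natpow p (- w) ^+ j).
  by rewrite big_ord1 => <-; apply: eq_bigr => v _; rewrite big_ord1.
have [_ [A A1 SA]] := euler_product bB b1 bM hS hL.
rewrite xiE -[w - 1]mulr1; apply: (cvg_eq_eventually (N := 0)) (cvgZC A1) => X _.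
rewrite (SA X) -!mulrA; congr (_ * _).
rewrite mul1r mulrCA -big_split big1 ?mulr1 // => p pp /=.
rewrite mulVf // subr_eq0; apply: contraTneq (q1 p pp) => <-.
by rewrite normc1 ltxx.
Qed.

(** Otherwise the sequence of [xi_euler] is zero, and its limit $w - 1$ is not. *)
Lemma xi_neq0 (w : C) : 1 < complex.Re w -> xi w != 0.
Proof.
move=> w1; apply/eqP => x0; have := xi_euler w1; rewrite x0.
under eq_fun do rewrite mul0r.
move=> h; have := cvg_uniqueC h (@cvg_cstC _ 0) => /eqP.
by rewrite subr_eq0 => /eqP w0; rewrite w0 /= ltxx in w1.
Qed.

Lemma harmonic_unbounded (B : R) : ~ forall N, \sum_(k < N) k.+1%:R^-1 <= B.
Proof.
move=> hB; have [|l hl] := @bounded_series_cvg _ (fun k => k.+1%:R^-1) B _ hB.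
  by move=> k; rewrite invr_ge0.
apply: (@dvg_harmonic R); apply/cvg_ex; exists l.
rewrite (_ : series harmonic = fun N => \sum_(k < N) k.+1%:R^-1) //.
by apply/funext => N; rewrite /series /= big_mkord.
Qed.

(** If $\sum \varphi(m) m^{-\sigma}$ converges then $\sigma > 2$: as
    $m = \sum_{d \mid m} \varphi(d)$, Dirichlet convolution with
    $\sum m^{-\sigma}$ gives $\sum m^{1-\sigma}$. *)
Lemma totient_series_bounded (a B : R) :
  (forall A : seq nat, uniq A -> (forall k, k \in A -> 0 < k)%N ->
     \sum_(k <- A) (totient k)%:R * npw k (- a) <= B) -> 2 < a.
Proof.
move=> hB.
have a1 : 1 < a.
  rewrite ltNge; apply/negP => a1.
  have [N hN] : exists N : nat, 2 * B < N%:R.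
    by exists (Num.bound (2 * B)); apply: archi_boundP; rewrite mulr_ge0 //;
      have := hB [::] isT; rewrite big_nil; apply.
  have := hB [seq 2 ^ e.+1 | e <- iota 0 N]%N.
  rewrite big_map big_iota0 => h.
  suff : (N%:R / 2 : R) <= B by move: hN; lra.
  apply: le_trans (h _ _).
  - rewrite -[leLHS](_ : \sum_(e < N) (2^-1 : R) = _); last first.
      by rewrite sumr_const card_ord -[LHS]mulr_natl.
    apply: ler_sum => e _; rewrite totient_pfactor // mul1n /=.
    have -> : (2 ^ e)%:R = 2^-1 * npw (2 ^ e.+1) 1 :> R.
      by rewrite npw1 ?expn_gt0 // expnS natrM mulrA mulVf ?mul1r.
    rewrite -mulrA -npwD -[leLHS]mulr1 ler_pM2l ?invr_gt0 //.
    by apply: (le_trans (y := npw (2 ^ e.+1)%N 0)); [rewrite npw0|apply: ler_npw; rewrite subr_ge0].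
  - rewrite map_inj_uniq ?iota_uniq // => x y /eqP.
    by rewrite eqn_exp2l // eqSS => /eqP.
  - by move=> _ /mapP[e _ ->]; rewrite expn_gt0.
have [B' hB'] := npw_nat_bounded a1.
have B'0 : 0 <= B' by have := hB' [::] isT; rewrite big_nil; apply.
rewrite ltNge; apply/negP => a2; apply: (@harmonic_unbounded (B * B')) => N.
apply: (@le_trans _ _ (\sum_(m < N) m.+1%:R * npw m.+1 (- a))).
  apply: ler_sum => m _; rewrite -(npw1 (k := m.+1)) // -npwD -npwN ler_npw //.
  by move: a2; lra.
pose F d m : R := if (d %| m.+1)%N then (totient d)%:R * npw m.+1 (- a) else 0.
have E (m : 'I_N) : m.+1%:R * npw m.+1 (- a) = \sum_(d < N.+1) F d m.
  rewrite -{1}(cyclic.sum_totient_dvd m.+1) natr_sum mulr_suml.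
  rewrite -(big_mkord (fun d => (d %| m.+1)%N) (fun d => (totient d)%:R * npw m.+1 (- a))).
  rewrite -(big_mkord xpredT (F ^~ m)) /= big_mkcond /=.
  rewrite [RHS](@big_cat_nat _ _ _ m.+2) //=; last by rewrite !ltnS.
  rewrite [X in _ = _ + X]big_nat_cond [X in _ = _ + X]big1 ?addr0 //.
  move=> d /andP[/andP[md _] _]; rewrite /F; case: ifP => // /dvdn_leq; rewrite leqNgt.
  by move=> /(_ isT); rewrite leqNgt md.
rewrite (eq_bigr _ (fun m _ => E m)) exchange_big /= big_ord_recl /=.
rewrite big1 ?add0r; last by move=> m _; rewrite /F dvd0n.
apply: (@le_trans _ _ (\sum_(d < N) (totient d.+1)%:R * npw d.+1 (- a) * B')).
  apply: ler_sum => d _; rewrite /F /= /bump /= add1n -big_mkcond /=.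
  rewrite (eq_bigr (fun m : 'I_N => (totient d.+1)%:R * npw d.+1 (- a) * npw (m.+1 %/ d.+1) (- a))).
    rewrite -mulr_sumr ler_wpM2l ?mulr_ge0 ?npw_ge0 //.
    rewrite -(big_mkord (fun m => (d.+1 %| m.+1)%N) (fun m => npw (m.+1 %/ d.+1) (- a))) -big_filter.
    rewrite -(big_map (fun m => m.+1 %/ d.+1)%N xpredT (fun m => npw m (- a))).
    apply: hB'.
      rewrite map_inj_in_uniq ?filter_uniq ?iota_uniq // => x y.
      rewrite !mem_filter => /andP[dx _] /andP[dy _] exy.
      by have := divnK dx; rewrite exy divnK // => -[].
    move=> k /mapP[m]; rewrite mem_filter => /andP[dm _] ->.
    by rewrite divn_gt0 // dvdn_leq.
  move=> m dm; rewrite -mulrA; congr (_ * _).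
  rewrite -[in LHS](divnK dm) mulnC npwM //.
  by rewrite divn_gt0 // dvdn_leq.
rewrite -mulr_suml ler_wpM2r //.
have := hB (iota 1 N) (iota_uniq _ _).
rewrite big_iota1; apply.
by move=> k; rewrite mem_iota => /andP[].
Qed.

End ZetaEuler.

(** * The multiple totient series *)

Section MultipleTotientSeries.
Context {R : realType}.
Local Notation C := R[i].

Lemma has_sum_summability (I : choiceType) (f : I -> C) S :
  has_sum xpredT f S -> summability.sum f = S.
Proof.
move=> h; apply: cvg_lim; [exact: norm_hausdorff|exact: summability.totally_filter|].
apply/(@cvg_normcP R _ summability.totally (@filter_filter _ _ (@summability.totally_filter I)) (summability.partial_sum f) S) => e /h[A0 [_ hA]]; exists [fset x in A0]%fset => // A /= sA.
rewrite /summability.partial_sum -(big_seq_fsetE _ A xpredT f).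
apply: hA; [exact: fset_uniq|exact: all_predT|].
by move=> x xA; move/fsubsetP: sA; apply; rewrite !inE.
Qed.

Lemma summable_abs_bounded (I : choiceType) (f : I -> C) :
  summable [set: I] (fun m => (normc (f m))%:E) <-> exists B, abs_bounded xpredT f B.
Proof.
have absE m : `|(normc (f m))%:E|%E = (normc (f m))%:E.
  by rewrite gee0_abs // lee_fin normc_ge0.
rewrite /summable; under eq_esum do rewrite absE.
split=> [|[B hB]].
  case E : (\esum_(x in _) _)%E => [r||] // _; last first.
    have : (0 <= \esum_(x in [set: I]) (normc (f x))%:E)%E.
    by apply: esum_ge0 => m _; rewrite lee_fin normc_ge0.
  by rewrite E.
  exists r => A u _; rewrite -lee_fin -E -sumEFin.
  apply: esum_ge; exists [set` A]; last by rewrite (fsbig_seq _ _ u).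
  by split=> //; exact: finite_seq.
apply: (@le_lt_trans _ _ B%:E); last exact: ltry.
apply: ge_ereal_sup => _ [F [/finite_seqP[A ->] _] <-].
rewrite (_ : [set` A] = [set` undup A]); last first.
  by apply/seteqP; split=> x /=; rewrite mem_undup.
rewrite -(fsbig_seq _ _ (undup_uniq A)) sumEFin lee_fin.
by apply: hB; rewrite ?undup_uniq ?all_predT.
Qed.

Variable n : nat.
Local Notation V := {ffun 'I_n -> nat}.
Implicit Types (s : 'rV[C]_n) (v m : V).

Lemma abs_convP (a : nat -> nat) s :
  abs_conv a s <-> exists B, abs_bounded xpredT (series_term a s) B.
Proof. exact: summable_abs_bounded. Qed.

(** The terms of the totient series, indexed by the vectors of positive
    integers themselves. *)
Definition tot_term s v : C :=
  (totient (\prod_i v i)%N)%:R * \prod_i natpow (v i) (- s ord0 i).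

Definition succv m : V := [ffun i => (m i).+1].

Lemma succv_inj : injective succv.
Proof.
by move=> u v /ffunP E; apply/ffunP => i; have := E i; rewrite !ffunE => -[].
Qed.

Lemma series_termE s m : series_term totient s m = tot_term s (succv m).
Proof.
rewrite /series_term /tot_term; congr ((totient _)%:R * _).
  by apply: eq_bigr => i _; rewrite ffunE.
by apply: eq_bigr => i _; rewrite ffunE.
Qed.

Lemma predv_succ v : pos v -> succv [ffun i => (v i).-1] = v.
Proof. by move=> /forallP v0; apply/ffunP => i; rewrite !ffunE prednK. Qed.

Lemma normc_tot_term s v : normc (tot_term s v) =
  (totient (\prod_i v i)%N)%:R * \prod_i npw (v i) (- complex.Re (s ord0 i)).
Proof.
rewrite normcM normc_nat normc_prod; congr (_ * _).
by apply: eq_bigr => i _; rewrite normc_natpow Re_opp.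
Qed.

Section AtPoint.
Variables (s : 'rV[C]_n) (B : R).
Hypothesis sB : abs_bounded xpredT (series_term totient s) B.

Let predA (A : seq V) : all (@pos n) A -> map (succv \o (fun v => [ffun i => (v i).-1])) A = A.
Proof.
by move=> /allP a; rewrite -[RHS]map_id; apply/eq_in_map => v /a /predv_succ.
Qed.

Lemma tot_term_bounded : abs_bounded (@pos n) (tot_term s) B.
Proof.
move=> A u a; rewrite -(predA a) map_comp big_map.
under eq_bigr do rewrite -series_termE.
apply: sB; last exact: all_predT.
by rewrite -(map_inj_uniq succv_inj) -map_comp predA.
Qed.

Lemma multi_series_has_sum : has_sum (@pos n) (tot_term s) (multi_series totient s).
Proof.
have [S hS] := abs_has_sum sB; rewrite /multi_series (has_sum_summability hS).
move=> e /hS[A0 [_ h]]; exists (map succv A0); split.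
  by apply/allP => _ /mapP[m _ ->]; apply/forallP => i; rewrite ffunE.
move=> A u a sA; rewrite -(predA a) map_comp big_map.
under eq_bigr do rewrite -series_termE.
apply: h; [by rewrite -(map_inj_uniq succv_inj) -map_comp predA|exact: all_predT|].
move=> m mA; have := sA _ (map_f succv mA) => mA'.
apply/mapP; exists (succv m) => //; apply/ffunP => i; by rewrite !ffunE.
Qed.

(** Restrict the summation to the vectors with a single entry different from $1$. *)
Lemma abs_conv_Re_gt2 i : 2 < complex.Re (s ord0 i).
Proof.
apply: (@totient_series_bounded R _ B) => A u A0.
pose single (k : nat) : V := [ffun j => if j == i then k else 1%N].
have := @tot_term_bounded [seq single k | k <- A]; rewrite big_map => h.
apply: le_trans (h _ _).
- rewrite le_eqVlt; apply/orP; left; apply/eqP; apply: eq_bigr => k _.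
  rewrite normc_tot_term (bigD1 i) //= big1 => [|j /negbTE ji]; last by rewrite ffunE ji.
  rewrite muln1 [\prod_(j < n) npw _ _](bigD1 i) //= big1 => [|j /negbTE ji]; last first.
    by rewrite ffunE ji /npw ln1 mulr0 expR0.
  by rewrite ffunE eqxx mulr1.
- rewrite map_inj_uniq // => k l /ffunP/(_ i); by rewrite !ffunE eqxx.
- apply/allP => _ /mapP[k /A0 k0 ->]; apply/forallP => j; rewrite ffunE.
  by case: ifP.
Qed.

(** $y_i = p^{1 - s_i}$ *)
Local Notation y p i := (natpow p (1 - s ord0 i)).

(** The sum of $\varphi(p^{k_1 + \dots + k_n}) \prod_i p^{-k_i s_i}$ over all $k$:
    $\varphi(p^m) = (1 - p^{-1}) p^m$ for all $m$ but $m = 0$, for which $p^{-1}$ is missing. *)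
Definition loc_factor (p : nat) : C :=
  p%:R^-1 + (1 - p%:R^-1) * \prod_i (1 - y p i)^-1.

Let loc p (k : V) : C := (totient (p ^ \sum_i k i)%N)%:R * \prod_i natpow p (- s ord0 i) ^+ k i.

Let tot_term_mul p k v : prime p -> pos v -> (forall i, ~~ (p %| v i)%N) ->
  tot_term s (mulv (ppow p k) v) = loc p k * tot_term s v.
Proof.
move=> pp /forallP v0 pv; rewrite /tot_term /loc.
have -> : (\prod_i mulv (ppow p k) v i = p ^ (\sum_i k i) * \prod_i v i)%N.
  under eq_bigr do rewrite !ffunE.
  by rewrite big_split /= expn_sum.
rewrite totient_coprime; last first.
  apply: coprimeXl; elim/big_ind: _ => [|a b ha hb|i _]; first exact: coprimen1.
    by rewrite coprimeMr ha.
  by rewrite prime_coprime.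
rewrite natrM mulrACA; congr (_ * _); rewrite -big_split; apply: eq_bigr => i _ /=.
by rewrite !ffunE natpowM ?v0 ?expn_gt0 ?prime_gt0 // natpowX.
Qed.

Let tot_term1 : tot_term s (onev n) = 1.
Proof.
rewrite /tot_term big1 => [|i _]; last by rewrite ffunE.
by rewrite mul1r big1 // => i _; rewrite ffunE natpow1l.
Qed.

Lemma normc_y_lt1 p i : prime p -> normc (y p i) < 1.
Proof.
move=> pp; rewrite normc_natpow Re_add Re_opp /= -[ltRHS]expR0 ltr_expR.
rewrite nmulr_rlt0 ?ln_nat_gt0 ?prime_gt1 //.
by have := abs_conv_Re_gt2 i; lra.
Qed.

Let loc_has_sum p : prime p -> has_sum xpredT (loc p) (loc_factor p).
Proof.
move=> pp; have [L hL] := abs_has_sum (loc_bounded tot_term_bounded tot_term1 tot_term_mul pp).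
have c1 := has_sum_seq hL (@box_uniq n) (fun N => all_predT _) (fun v _ => box_exhausts v).
have -> // : loc_factor p = L.
apply: cvg_uniqueC c1.
have cP : (fun N => \prod_i \sum_(j < N) y p i ^+ j) @ \oo --> \prod_i (1 - y p i)^-1.
  have H (r : seq 'I_n) : (fun N => \prod_(i <- r) \sum_(j < N) y p i ^+ j) @ \oo -->
      \prod_(i <- r) (1 - y p i)^-1.
    elim: r => [|i r ih].
      rewrite big_nil; apply: (cvg_eq_eventually (N := 0)) (@cvg_cstC _ 1) => N _.
      by rewrite big_nil.
    rewrite big_cons; apply: (cvg_eq_eventually (N := 0)) (cvgMC (geometric_cvg (normc_y_lt1 i pp)) ih) => N _.
    by rewrite big_cons.
  exact: H.
have p0 : (p%:R : C) != 0 by rewrite pnatr_eq0 -lt0n prime_gt0.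
apply: (cvg_eq_eventually (N := 1)) (cvgDC (@cvg_cstC _ p%:R^-1) (cvgZC (c := 1 - p%:R^-1) cP)) => N N0.
rewrite -(sum_box_prod N (fun i j => y p i ^+ j)) mulr_sumr.
have in0 : [ffun=> 0%N] \in box n N.
  by rewrite mem_box; apply/forallP => i; rewrite ffunE.
rewrite !(bigD1_seq [ffun=> 0%N] in0 (box_uniq n N)) /= addrA; congr (_ + _).
  rewrite /loc (big1 _ _ (fun i => [ffun=> 0%N] i)) => [|i _]; last by rewrite ffunE.
  rewrite expn0 !big1 => [|i _|i _]; rewrite ?ffunE ?expr0 //.
  by rewrite !mulr1 addrC subrK.
apply: eq_bigr => k k0; rewrite /loc.
have sk : (0 < \sum_i k i)%N.
  rewrite lt0n; apply: contraNneq k0 => /eqP; rewrite sum_nat_eq0 => /forallP h.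
  by apply/eqP/ffunP => i; rewrite ffunE; apply/eqP; exact: h.
rewrite totient_pfactor //.
under eq_bigr do rewrite natpowD natpow1 ?prime_gt0 // exprMn.
rewrite big_split /= prodrXr mulrA; congr (_ * _).
rewrite natrM natrX -[in LHS](prednK sk) exprS mulrA mulrBl mulVf // mul1r.
by congr (_ * _); rewrite -subn1 natrB ?prime_gt0.
Qed.

Theorem multi_series_euler :
  (fun X => \prod_(p < X | prime p) loc_factor p) @ \oo --> multi_series totient s.
Proof.
by have [] := euler_product tot_term_bounded tot_term1 tot_term_mul
  multi_series_has_sum loc_has_sum.
Qed.

End AtPoint.

(** As $\varphi(m) \le m$, the series is dominated by a product of $n$ zeta series. *)
Lemma abs_conv_gt2 s : (forall i, 2 < complex.Re (s ord0 i)) -> abs_conv totient s.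
Proof.
move=> s2; apply/abs_convP.
have h i : exists B, forall N, \sum_(k < N) npw k.+1 (- (complex.Re (s ord0 i) - 1)) <= B.
  by apply: npw_sum_bound; have := s2 i; lra.
have [B hB] := choice h; exists (\prod_i B i) => A u _.
have [N AN] : exists N, {subset A <= box n N}.
  elim: A {u} => [|v A [N1 h1]]; first by exists 0%N.
  have [N2 h2] := box_exhausts v; exists (maxn N1 N2) => w; rewrite inE => /predU1P[->|/h1].
    by apply: h2; exact: leq_maxr.
  rewrite !mem_box => /forallP hw; apply/forallP => i.
  by rewrite (leq_trans (hw i)) // leq_maxl.
pose F (i : 'I_n) j : R := npw j.+1 (- (complex.Re (s ord0 i) - 1)).
have tF (m : V) : normc (series_term totient s m) <= \prod_i F i (m i).
  rewrite series_termE normc_tot_term.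
  have le_tot : (totient (\prod_i succv m i)%N)%:R <= \prod_i (m i).+1%:R :> R.
    rewrite -natr_prod ler_nat; apply: leq_trans (_ : _ <= \prod_i succv m i)%N _.
      rewrite totient_count_coprime big_mkord.
      rewrite -[leqRHS]card_ord -sum1_card; apply: leq_sum => k _; exact: leq_b1.
    by rewrite leq_eqVlt; apply/orP; left; apply/eqP/eq_bigr => i _; rewrite ffunE.
  apply: le_trans (ler_wpM2r _ le_tot) _; first by rewrite prodr_ge0 // => i _; exact: npw_ge0.
  rewrite -big_split /=; apply: ler_prod => i _; rewrite mulr_ge0 ?npw_ge0 //= ffunE.
  by rewrite -(npw1 (k := (m i).+1)) // -npwD /F opprB addrC.
apply: (@le_trans _ _ (\sum_(m <- A) \prod_i F i (m i))).
  by apply: ler_sum => m _; exact: tF.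
have F0 i j : 0 <= F i j by exact: npw_ge0.
apply: (@le_trans _ _ (\sum_(m <- box n N) \prod_i F i (m i))).
  apply: sum_subseq_le => //; last exact: box_uniq.
  by move=> m; rewrite prodr_ge0.
rewrite sum_box_prod; apply: ler_prod => i _.
by rewrite hB andbT sumr_ge0.
Qed.

(** At real points the series is a sum of nonnegative terms, the first of which
    is $1$. *)
Lemma multi_series_real_neq0 s : abs_conv totient s ->
  (forall i, complex.Im (s ord0 i) = 0) -> multi_series totient s != 0.
Proof.
move=> /abs_convP[B sB] sr.
have hS := multi_series_has_sum sB.
have term_real v : tot_term s v = ((normc (tot_term s v))%:C)%C.
  rewrite normc_tot_term rmorphM rmorph_prod rmorph_nat; congr (_ * _).
  apply: eq_bigr => i _; rewrite [RHS](_ : _ = ((npw (v i) (- complex.Re (s ord0 i)))%:C)%C) // -natpow_real; congr natpow.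
  by apply: complex_eq; rewrite ?Re_opp ?Im_opp //= sr oppr0.
apply/eqP => S0; have := hS 1 ltr01; rewrite S0 => -[A0 [a0 h]].
have u1 : uniq (undup (onev n :: A0)) by exact: undup_uniq.
have p1 : all (@pos n) (undup (onev n :: A0)).
  apply/allP => v; rewrite mem_undup inE => /predU1P[->|]; last exact: (allP a0).
  by apply/forallP => i; rewrite ffunE.
have := h _ u1 p1 ltac:(by move=> v vA; rewrite mem_undup inE vA orbT).
rewrite subr0 ltNge => /negP; apply.
apply: le_trans (le_trans (ler_norm _) (normc_Re _)); rewrite Re_sum.
rewrite (bigD1_seq (onev n)) ?mem_undup ?inE ?eqxx //=.
rewrite {1}term_real /= normc_tot_term big1 => [|i _]; last by rewrite ffunE.
rewrite big1 ?mulr1 => [|i _]; last by rewrite ffunE /npw ln1 mulr0 expR0.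
by rewrite lerDl sumr_ge0 // => v _; rewrite term_real /= normc_ge0.
Qed.

End MultipleTotientSeries.

(** * Homomorphisms from the ring of Laurent polynomials *)

Section RingHomsOfLaurent.

Local Notation "x %:F" := (@tofrac {poly int} x).

Lemma tofrac_is_laurent (p : {poly int}) : p%:F \in is_laurent.
Proof. by apply/asboolP; exists p, 0%N; rewrite expr0 divr1. Qed.

Lemma inv_polyX_is_laurent : 'X%:F^-1 \in is_laurent.
Proof. by apply/asboolP; exists 1, 1%N; rewrite rmorph1 mul1r expr1. Qed.

Let lp (p : {poly int}) : laurentZ := LaurentZ (tofrac_is_laurent p).
Let Xi : laurentZ := LaurentZ inv_polyX_is_laurent.

Let X0 : 'X%:F != 0. Proof. by rewrite tofrac_eq0 polyX_eq0. Qed.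

Let lpD p q : lp (p + q) = lp p + lp q.
Proof. by apply: val_inj; rewrite /= rmorphD. Qed.

Let lpM p q : lp (p * q) = lp p * lp q.
Proof. by apply: val_inj; rewrite /= rmorphM. Qed.

Let lpC c : lp c%:P = c%:~R.
Proof.
apply: val_inj; rewrite rmorph_int /=.
by rewrite -[c in LHS]intz !rmorph_int.
Qed.

Let lpX_Xi : lp 'X * Xi = 1.
Proof. by apply: val_inj; rewrite /= mulfV. Qed.

Let valX k : val (lp 'X ^+ k) = 'X%:F ^+ k.
Proof. by rewrite rmorphXn. Qed.

Variable e : nat.
Local Notation Zd := 'I_e.+2.

Let ring_homsE (f : laurentZ -> Zd) : ring_homs laurentZ e.+2 f <->
  [/\ f 1 = 1, forall x y, f (x + y) = f x + f y & forall x y, f (x * y) = f x * f y].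
Proof.
have mE (x : Zd) : (x %% e.+2 = x)%N by rewrite modn_small.
split=> -[h1 hD hM]; split.
- by apply: val_inj; rewrite /= -h1 mE.
- by move=> x y; apply: val_inj; rewrite /= -hD mE.
- by move=> x y; apply: val_inj; rewrite /= -hM mE.
- by rewrite mE h1.
- by move=> x y; rewrite mE hD.
- by move=> x y; rewrite mE hM.
Qed.

Let pval (u : Zd) (p : {poly int}) : Zd := (map_poly intr p).[u].

Let pvalD u p q : pval u (p + q) = pval u p + pval u q.
Proof. by rewrite /pval rmorphD hornerD. Qed.

Let pvalM u p q : pval u (p * q) = pval u p * pval u q.
Proof. by rewrite /pval rmorphM hornerM. Qed.

Let pvalXn u k : pval u ('X ^+ k) = u ^+ k.
Proof. by rewrite /pval rmorphXn /= map_polyX hornerXn. Qed.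

Let lrepr (x : laurentZ) :
  {pk : {poly int} * nat | val x = pk.1%:F / 'X%:F ^+ pk.2}.
Proof. by apply/cid; have /asboolP[p [k E]] := valP x; exists (p, k). Qed.

(** $p(T) / T^k \mapsto p(u) u^{-k}$ *)
Let lh (u : Zd) (x : laurentZ) : Zd :=
  pval u (projT1 (lrepr x)).1 * u^-1 ^+ (projT1 (lrepr x)).2.

Let lhE u x p k : u \is a GRing.unit -> val x = p%:F / 'X%:F ^+ k ->
  lh u x = pval u p * u^-1 ^+ k.
Proof.
move=> uU; rewrite /lh; case: lrepr => -[q l] /= -> /eqP.
rewrite eqr_div ?expf_neq0 // -!rmorphXn -!rmorphM /= tofrac_eq => /eqP E.
have := congr1 (pval u) E; rewrite !pvalM !pvalXn => E'.
have uk m : u ^+ m * u^-1 ^+ m = 1 by rewrite -exprMn divrr // expr1n.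
rewrite -[LHS]mulr1 -(uk k) mulrACA E'.
by rewrite [_ ^+ l * _ ^+ k]mulrC mulrACA uk mulr1.
Qed.

Let lh_hom u : u \is a GRing.unit -> ring_homs laurentZ e.+2 (lh u).
Proof.
move=> uU; have uk m : u ^+ m * u^-1 ^+ m = 1 by rewrite -exprMn divrr // expr1n.
apply/ring_homsE; split.
- rewrite (@lhE u 1 1 0) ?expr0 ?rmorph1 ?divr1 // mulr1.
  by rewrite /pval rmorph1 hornerE.
- move=> x y; case: (lrepr x) (lrepr y) => -[p k] /= hx [[q l] /= hy].
  rewrite (lhE uU hx) (lhE uU hy) (@lhE u (x + y) (p * 'X ^+ l + q * 'X ^+ k) (k + l)) //.
    rewrite pvalD !pvalM !pvalXn mulrDl !exprD; congr (_ + _).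
      by rewrite mulrACA uk mulr1.
    by rewrite [_ ^+ k * _ ^+ l]mulrC mulrACA uk mulr1.
  rewrite [LHS]raddfD /= hx hy rmorphD !rmorphM !rmorphXn /= mulrDl exprD; congr (_ + _).
    by rewrite -mulf_div divff ?mulr1 ?expf_neq0.
  by rewrite [_ ^+ k * _ ^+ l]mulrC -mulf_div divff ?mulr1 ?expf_neq0.
- move=> x y; case: (lrepr x) (lrepr y) => -[p k] /= hx [[q l] /= hy].
  rewrite (lhE uU hx) (lhE uU hy) (@lhE u (x * y) (p * q) (k + l)) //.
    by rewrite pvalM exprD mulrACA.
  by rewrite [LHS]rmorphM /= hx hy mulf_div rmorphM exprD.
Qed.

(** A homomorphism is determined by the image of $T$, which is a unit. *)
Let hom_of_X (f : laurentZ -> Zd) : ring_homs laurentZ e.+2 f ->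
  f (lp 'X) \is a GRing.unit /\ f = lh (f (lp 'X)).
Proof.
move=> /ring_homsE[f1 fD fM].
have f0 : f 0 = 0 by apply: (addrI (f 0)); rewrite -fD !addr0.
have fN x : f (- x) = - f x by apply: (addIr (f x)); rewrite -fD !addNr.
have zm : zmod_morphism f by move=> x y; rewrite fD fN.
pose F : {rmorphism laurentZ -> Zd} :=
  HB.pack f (GRing.isZmodMorphism.Build _ _ f zm)
            (GRing.isMonoidMorphism.Build _ _ f (conj f1 fM)).
set u := f (lp 'X).
have uU : u \is a GRing.unit.
  by apply/unitrP; exists (f Xi); split; rewrite -fM; [rewrite mulrC|]; rewrite lpX_Xi.
have fp p : f (lp p) = pval u p.
  elim/poly_ind: p => [|p c ih].
    rewrite (_ : lp 0 = 0) ?f0; last by apply: val_inj; rewrite /= rmorph0.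
    by rewrite /pval rmorph0 horner0.
  rewrite lpD lpM fD fM ih pvalD pvalM lpC -[f c%:~R]/(F _) rmorph_int.
  rewrite /pval map_polyX hornerX map_polyC hornerC.
  by [].
split=> //; apply/funext => x; have [[p k] /= hx] := lrepr x.
rewrite (lhE uU hx) -fp.
have -> : lp p = x * lp 'X ^+ k.
  by apply: val_inj; rewrite [RHS]rmorphM [X in _ * X](valX k) [X in X * _]hx mulfVK ?expf_neq0.
rewrite fM -[f (_ ^+ k)]/(F _) rmorphXn -mulrA -exprMn divrr // expr1n mulr1 //.
Qed.

Lemma nb_ring_homs_laurentSS : nb_ring_homs laurentZ e.+2 = totient e.+2.
Proof.
pose A : set Zd := [set u | u \is a GRing.unit].
have E : ring_homs laurentZ e.+2 = lh @` A.
  apply/seteqP; split=> [f /hom_of_X[uU fE]|_ [u uU <-]]; last exact: lh_hom.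
  by exists (f (lp 'X)).
have finA : finite_set A by exact: finite_finset.
rewrite /nb_ring_homs E fset_set_image // card_in_imfset /=; last first.
  have memA w : w \in fset_set A -> w \is a GRing.unit.
    by rewrite in_fset_set // mem_setE.
  move=> u v /memA uU /memA vU /(congr1 (@^~ (lp 'X))).
  have valX1 : val (lp 'X) = 'X%:F / 'X%:F ^+ 0 by rewrite expr0 divr1.
  by rewrite !(lhE _ valX1) // !expr0 !mulr1 /pval !map_polyX !hornerX.
have -> : fset_set A = [fset u in enum [pred u : Zd | u \is a GRing.unit]]%fset.
  by apply/fsetP => u; rewrite in_fset_set // mem_setE !inE mem_enum.
rewrite [LHS](_ : _ = #|` [fset u in enum [pred u : Zd | u \is a GRing.unit]]|%fset) //.
rewrite card_fseq undup_id ?enum_uniq // -cardE.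
rewrite totient_count_coprime big_mkord -sum1_card big_mkcond /=.
apply: eq_bigr => u _; rewrite inE (_ : (u \is a GRing.unit) = coprime e.+2 u) //.
Qed.

End RingHomsOfLaurent.

(** Homomorphisms correspond to the units of $\mathbb{Z}/d\mathbb{Z}$, the possible images of
    $T$. For $d = 1$ there is one, since $1 \mapsto 0$ is allowed in the zero ring. *)
Lemma nb_ring_homs_laurent d : (0 < d)%N -> nb_ring_homs laurentZ d = totient d.
Proof.
case: d => [|[|e]] // _; last exact: nb_ring_homs_laurentSS.
rewrite /nb_ring_homs (_ : ring_homs laurentZ 1 = [set fun=> ord0]).
  by rewrite fset_set1 cardfs1.
apply/seteqP; split=> [f _ /=|_ ->]; last by split=> *; rewrite !modn1.
by apply/funext => x; rewrite ord1.
Qed.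

Section IgusaIsTotient.
Context {R : realType} {n : nat}.

Lemma series_term_laurent : @series_term R n (nb_ring_homs laurentZ) = series_term totient.
Proof.
apply/funext => s; apply/funext => m; rewrite /series_term nb_ring_homs_laurent //.
by rewrite prodn_gt0.
Qed.

Lemma igusa_zeta_laurent : @igusa_zeta R n laurentZ = multi_series totient.
Proof. by rewrite /igusa_zeta /multi_series series_term_laurent. Qed.

Lemma igusa_conv_laurent : @igusa_conv R n laurentZ = abs_conv totient.
Proof. by rewrite /igusa_conv /abs_conv series_term_laurent. Qed.

End IgusaIsTotient.

(** * Local factors as sums of monomials *)

Section SignedMonomials.
Context {R : realType} {n : nat}.
Local Notation C := R[i].
Implicit Types (s : 'rV[C]_n) (p : nat).

(** The triple $(\varepsilon, k, \alpha)$ stands for the monomial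
    $(-1)^\varepsilon p^{-k} \prod_j y_j^{\alpha_j}$ with $y_j = p^{1-s_j}$. *)
Definition mono := (bool * nat * {ffun 'I_n -> nat})%type.
Implicit Types m : mono.

Definition mdeg m := m.1.2.

(** $m = \pm p^{-\ell(s)}$ *)
Definition ell m s : C := (mdeg m)%:R - \sum_j (1 - s ord0 j) *+ m.2 j.

Definition mval m p s : C := (-1) ^+ m.1.1 * natpow p (- ell m s).

Definition tau s j : R := 1 - complex.Re (s ord0 j).

(** The domain of the theorem is $\{\mathrm{load} < 1\}$. *)
Definition load s : R := \sum_j Num.max 0 (tau s j).

(** On the domain, $\alpha_j \le k$ bounds $\Re \ell$ from below by a multiple of $k$, and
    $\alpha \ne 0$ makes $\ell$ nonconstant. *)
Definition good m := [&& (0 < mdeg m)%N, [forall j, m.2 j <= mdeg m]%N & [exists j, m.2 j != 0%N]].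

Lemma Re_mulrn (z : C) k : complex.Re (z *+ k) = complex.Re z *+ k.
Proof. by rewrite -mulr_natl Re_mul Re_nat Im_nat mul0r subr0 mulr_natl. Qed.

Lemma Re_ell m s : complex.Re (ell m s) = (mdeg m)%:R - \sum_j tau s j *+ m.2 j.
Proof.
rewrite /ell Re_add Re_opp Re_nat Re_sum; congr (_ - _).
by apply: eq_bigr => j _; rewrite Re_mulrn Re_add Re_opp.
Qed.

Lemma Re_ell_good m s : good m -> (mdeg m)%:R * (1 - load s) <= complex.Re (ell m s).
Proof.
move=> /and3P[_ /forallP am _]; rewrite Re_ell mulrBr mulr1 lerD2l lerN2.
rewrite /load mulr_sumr; apply: ler_sum => j _; rewrite -[leLHS]mulr_natl.
apply: (@le_trans _ _ ((m.2 j)%:R * Num.max 0 (tau s j))).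
  by rewrite ler_wpM2l // le_max lexx orbT.
by rewrite ler_wpM2r ?ler_nat ?am // le_max lexx.
Qed.

Definition negmul m m' : mono :=
  (~~ (m.1.1 (+) m'.1.1), (mdeg m + mdeg m')%N, [ffun j => m.2 j + m'.2 j]%N).

Lemma ell_negmul m m' s : ell (negmul m m') s = ell m s + ell m' s.
Proof.
rewrite /ell /negmul /mdeg /= natrD addrACA -opprD -big_split /=; congr (_ - _).
by apply: eq_bigr => j _; rewrite ffunE mulrnDr.
Qed.

Lemma mval_negmul m m' p s : mval (negmul m m') p s = - (mval m p s * mval m' p s).
Proof.
rewrite /mval ell_negmul opprD natpowD [in RHS]mulrACA -[in RHS]mulNr; congr (_ * _).
by rewrite /negmul /=; case: m.1.1; case: m'.1.1; rewrite /= ?expr0 ?expr1; ring.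
Qed.

Lemma good_negmul m m' : good m -> good m' -> good (negmul m m').
Proof.
move=> /and3P[k0 /forallP a1 /existsP[j aj]] /and3P[k0' /forallP a1' _].
apply/and3P; split; rewrite /negmul /mdeg /=.
- by rewrite addn_gt0 k0.
- by apply/forallP => i; rewrite ffunE leq_add ?a1 ?a1'.
- by apply/existsP; exists j; rewrite ffunE addn_eq0 negb_and aj.
Qed.

(** The local factor at $p$ times $\prod_i (1 - y_i)$: a polynomial in $p^{-1}$ and the $y_i$. *)
Definition hfac p s : C := 1 - p%:R^-1 + p%:R^-1 * \prod_i (1 - natpow p (1 - s ord0 i)).

(** The monomials of $p^{-1} \prod_i (1 - y_i)$. *)
Definition subset_mono (I : {set 'I_n}) : mono := (odd #|I|, 1%N, [ffun j => (j \in I) : nat]).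

Lemma hfac_sum p s : prime p ->
  hfac p s = 1 + \sum_(m <- [seq subset_mono J | J <- enum (predC1 (@finset.set0 'I_n))]) mval m p s.
Proof.
move=> pp; have p0 : (p%:R : C) != 0 by rewrite pnatr_eq0 -lt0n prime_gt0.
rewrite big_map big_enum /=.
have E (I : {set 'I_n}) : mval (subset_mono I) p s =
    p%:R^-1 * \prod_i (if i \in I then - natpow p (1 - s ord0 i) else 1).
  rewrite /mval /ell /subset_mono /mdeg /= opprB natpowD natpowN natpow1 ?prime_gt0 //.
  rewrite signr_odd natpow_sum -big_mkcond /= prodrN.
  have -> : \prod_(i < n) natpow p ((1 - s ord0 i) *+ [ffun j => j \in I : nat] i) =
      \prod_(i in I) natpow p (1 - s ord0 i).
    rewrite [RHS]big_mkcond; apply: eq_bigr => i _; rewrite ffunE natpowMn.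
    by case: (i \in I); rewrite ?expr1 ?expr0.
  by rewrite mulrA mulrC.
under eq_bigr do rewrite E.
rewrite -mulr_sumr /hfac.
have -> : \prod_i (1 - natpow p (1 - s ord0 i)) =
    1 + \sum_(I : {set 'I_n} | I != finset.set0) \prod_i (if i \in I then - natpow p (1 - s ord0 i) else 1).
  under eq_bigr do rewrite addrC.
  rewrite bigA_distr (bigD1 finset.set0) //=; congr (_ + _).
  by rewrite big1 // => i _; rewrite inE.
by rewrite mulrDr mulr1 addrA subrK.
Qed.

Lemma good_subset_mono (I : {set 'I_n}) : I != finset.set0 -> good (subset_mono I).
Proof.
move=> /finset.set0Pn[i iI]; apply/and3P; split; rewrite /subset_mono /mdeg //=.
  by apply/forallP => j; rewrite ffunE leq_b1.
by apply/existsP; exists i; rewrite ffunE iI.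
Qed.

(** The monomials of [L] have degree at least [K] in $p^{-1}$, so their Euler product
    converges on a domain growing with [K]; that of the factors $1 - m$ is a
    quotient of zeta functions. *)
Definition expansion (K : nat) (P L : seq mono) :=
  [/\ all good P, all good L, all (fun m => K <= mdeg m)%N L &
    forall p s, prime p ->
      hfac p s * \prod_(m <- P) (1 - mval m p s) = 1 + \sum_(m <- L) mval m p s].

(** Multiplying $1 + \sum_{m \in L} m$ by $1 - m_0$, for $m_0 \in L$, replaces
    $m_0$ by the products $- m_0 m$, of higher degrees. Repeating this with all
    monomials of least degree raises that degree. *)
Lemma expansion_exists K : exists P L, expansion K.+1 P L.
Proof.
elim: K => [|K [P [L e]]].
  exists [::], [seq subset_mono J | J <- enum (predC1 (@finset.set0 'I_n))]; split=> //.
  - by apply/allP => _ /mapP[I I0 ->]; apply: good_subset_mono; move: I0; rewrite mem_enum.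
  - by apply/allP => _ /mapP[I _ ->].
  - by move=> p s pp; rewrite big_nil mulr1 hfac_sum.
have [c hc] := ubnP (count (fun m => mdeg m == K.+1) L).
elim: c => // c ih in P L e hc *.
have [gP gL dL E] := e.
have [/hasP[m mL /eqP dm]|/hasPn nL] := boolP (has (fun m => mdeg m == K.+1) L); last first.
  exists P, L; split=> //; apply/allP => m mL.
  by rewrite ltn_neqAle eq_sym nL //= (allP dL).
have pL := perm_to_rem mL.
apply: (ih (m :: P) (rem m L ++ [seq negmul m m' | m' <- L])).
  split.
  - by rewrite /= gP (allP gL).
  - rewrite all_cat; apply/andP; split; first by apply/allP => x /mem_rem /(allP gL).
    by apply/allP => _ /mapP[x /(allP gL) gx ->]; exact: good_negmul (allP gL m mL) gx.
  - rewrite all_cat; apply/andP; split; first by apply/allP => x /mem_rem /(allP dL).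
    by apply/allP => _ /mapP[x _ ->]; rewrite /negmul /mdeg /= -/(mdeg m) dm leq_addr.
  - move=> p s pp; rewrite big_cons [_ * (_ * _)]mulrCA E // big_cat big_map /=.
    under [X in _ = _ + (_ + X)]eq_bigr do rewrite mval_negmul.
    rewrite sumrN -mulr_sumr !(perm_big _ pL) /= !big_cons; ring.
rewrite count_cat count_map -ltnS.
have -> : count (preim (negmul m) (fun m0 => mdeg m0 == K.+1)) L = 0%N.
  apply/eqP; rewrite -leqn0 leqNgt -has_count; apply/hasPn => x xL /=.
  have := allP dL x xL; rewrite /negmul /mdeg /= -/(mdeg m) -/(mdeg x) dm => dx.
  by rewrite -[X in _ != X]addn0 eqn_add2l -lt0n (leq_ltn_trans _ dx).
rewrite addn0 (leq_trans _ hc) // !ltnS (permP pL) /= dm eqxx add1n //.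
Qed.

End SignedMonomials.

(** * Coordinates and infinite products *)

Section RowVectors.
Context {R : realType} {n : nat}.
Local Notation C := R[i].
Implicit Types s : 'rV[C]_n.

Lemma nrm_rowP s (e : R) : 0 < e -> (nrm s < e <-> forall j, normc (s ord0 j) < e).
Proof.
move=> e0; have := ball_nrm (0 : 'rV[C]_n) s e; rewrite subr0 => <-.
split=> [[_ h] j|h].
  by have := h ord0 j; rewrite mxE => /ball_nrm; rewrite subr0 nrm_normc.
split=> [|i j]; first by rewrite ltcR.
 rewrite (ord1 i) mxE; apply/ball_nrm; rewrite subr0 nrm_normc; exact: h.
Qed.

Lemma coord_le_nrm s j : normc (s ord0 j) <= nrm s.
Proof.
apply/ler_addgt0Pr => e e0; apply: ltW.
have h : 0 < nrm s + e by rewrite ltr_wpDl // nrm_ge0.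
by apply: (nrm_rowP s h).1; rewrite ltrDl.
Qed.

Lemma coord_differentiable j s : differentiable (fun s => s ord0 j : C) s.
Proof. exact: differentiable_coord. Qed.

Lemma tau_lip s s' j : `|tau s j - tau s' j| <= nrm (s - s').
Proof.
rewrite /tau opprB addrCA addrAC subrr sub0r -Re_opp -Re_add.
apply: le_trans (normc_Re _) _; rewrite normc_distC.
by apply: le_trans (coord_le_nrm _ j); rewrite !mxE.
Qed.

Lemma load_lip s s' : load s <= load s' + n%:R * nrm (s - s').
Proof.
have -> : n%:R * nrm (s - s') = \sum_(j < n) nrm (s - s').
  by rewrite sumr_const card_ord mulr_natl.
rewrite /load -big_split; apply: ler_sum => j _ /=; rewrite ge_max.
have m0 : 0 <= Num.max 0 (tau s' j) by rewrite le_max lexx.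
have m1 : tau s' j <= Num.max 0 (tau s' j) by rewrite le_max lexx orbT.
rewrite addr_ge0 ?nrm_ge0 //=.
by have := le_trans (ler_norm _) (tau_lip s s' j); move: m1; lra.
Qed.

Lemma load_convex s s' (t : R) : 0 <= t <= 1 ->
  load (s + ((t%:C)%C : C) *: (s' - s)) <= (1 - t) * load s + t * load s'.
Proof.
move=> /andP[t0 t1]; rewrite /load !mulr_sumr -big_split; apply: ler_sum => j _ /=.
have -> : tau (s + ((t%:C)%C : C) *: (s' - s)) j = (1 - t) * tau s j + t * tau s' j.
  rewrite /tau !mxE Re_add Re_mul Re_add Re_opp /= mul0r subr0; ring.
have le0m x : 0 <= Num.max 0 x :> R by rewrite le_max lexx.
have lem x : x <= Num.max 0 x :> R by rewrite le_max lexx orbT.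
by rewrite ge_max addr_ge0 ?mulr_ge0 ?subr_ge0 //= lerD // ler_wpM2l // subr_ge0.
Qed.

End RowVectors.

Section HolomorphicProducts.
Context {R : realType}.
Local Notation C := R[i].
Variable V : normedModType C.

(** The partial products are the partial sums of a series whose terms are
    partial products times [a k], to which Weierstrass' theorem applies. *)
Lemma hol_infinite_product (a : nat -> V -> C) (q : V) (r B : R) (A : nat -> R) : 0 < r ->
  (forall k v, nrm (v - q) < r -> differentiable (a k) v) ->
  (forall k v, nrm (v - q) < r -> normc (a k v) <= A k) ->
  (forall N, \sum_(k < N) A k <= B) ->
  (forall v, nrm (v - q) < r -> exists l : C, (fun X => \prod_(k < X) (1 + a k v)) @ \oo --> l) /\
  forall g, (forall v, nrm (v - q) < r -> (fun X => \prod_(k < X) (1 + a k v)) @ \oo --> g v) ->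
    differentiable g q.
Proof.
move=> r0 ad aA AB; pose P X v := \prod_(k < X) (1 + a k v).
have A0 k : 0 <= A k by apply: le_trans (normc_ge0 (a k q)) (aA _ _ _); rewrite subrr nrm0.
have Pb X v : nrm (v - q) < r -> normc (P X v) <= expR B.
  move=> vr; apply: (@le_trans _ _ (expR (\sum_(k < X) A k))); last by rewrite ler_expR.
  rewrite expR_sum normc_prod; apply: ler_prod => k _; rewrite normc_ge0 /=.
  apply: le_trans (ler_normcD _ _) _; rewrite normc1.
  by apply: le_trans (expR_ge1Dx _); rewrite lerD2l aA.
pose f k v := P k v * a k v.
have fP X v : \sum_(k < X) f k v = P X v - 1.
  elim: X => [|X ih]; first by rewrite big_ord0 /P big_ord0 subrr.
  by rewrite big_ord_recr /= ih /f /P [in RHS]big_ord_recr /=; ring.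
have fd k v : nrm (v - q) < r -> differentiable (f k) v.
  move=> vr; apply: hol_mul; last exact: ad.
  by apply: hol_prod => j _; apply: hol_add; [exact: hol_cst|exact: ad].
have fA k v : nrm (v - q) < r -> normc (f k v) <= expR B * A k.
  by move=> vr; rewrite normcM ler_pM ?normc_ge0 ?Pb ?aA.
have fB N : \sum_(k < N) expR B * A k <= expR B * B.
  by rewrite -mulr_sumr ler_wpM2l ?expR_ge0.
split=> [v vr|g gP].
  have [|l hl] := @abs_series_cvg _ (fun k => f k v) (expR B * B).
    by move=> N; apply: le_trans (fB N); apply: ler_sum => k _; exact: fA.
  exists (1 + l); apply: (cvg_eq_eventually (N := 0)) (cvgDC (@cvg_cstC _ 1) hl) => N _.
  by rewrite fP addrC subrK.
have : differentiable (fun v => g v - 1) q.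
  apply: (weierstrass_mtest r0 fd fA fB) => v vr.
  apply: (cvg_eq_eventually (N := 0)) (cvgBC (gP v vr) (@cvg_cstC _ 1)) => N _.
  by rewrite fP.
move=> /hol_add /(_ (hol_cst 1 q)).
by under eq_fun do rewrite subrK.
Qed.

Lemma cvg_factorC (u w : nat -> C) (c d : C) : (fun k => u k * w k) @ \oo --> c ->
  w @ \oo --> d -> d != 0 -> u @ \oo --> c / d.
Proof.
move=> huw hw d0; have [N hN] : exists N, forall k, (N <= k)%N -> w k != 0.
  have nd0 : 0 < normc d by rewrite normc_gt0.
  move/cvg_seq_normcP: (hw) => /(_ _ nd0)[N hN]; exists N => k /hN.
  by apply: contraTneq => ->; rewrite sub0r normcN ltxx.
apply: (cvg_eq_eventually (N := N)) (cvgMC huw (cvgV d0 hw)) => k /hN wk.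
by rewrite /= mulfK.
Qed.

End HolomorphicProducts.

(** * Meromorphic continuation *)

Section Approximants.
Context {R : realType} {n : nat}.
Local Notation C := R[i].
Implicit Types (s : 'rV[C]_n) (p : nat) (m : @mono n).

(** The monomial $y_i$. *)
Definition base_mono (i : 'I_n) : @mono n := (false, 0%N, [ffun j => (j == i) : nat]).

Lemma ell_base i s : ell (base_mono i) s = s ord0 i - 1.
Proof.
rewrite /ell /base_mono /mdeg /= (bigD1 i) //= ffunE eqxx big1 => [|j ji].
  by rewrite addr0 sub0r opprB.
by rewrite ffunE (negbTE ji).
Qed.

Lemma mval_base i p s : mval (base_mono i) p s = natpow p (1 - s ord0 i).
Proof. by rewrite /mval ell_base opprB /= expr0 mul1r. Qed.

(** The factors $1 - y_i$ of the denominators of the local factors behave as good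
    monomials, except that $\Re \ell > -1$ only. *)
Definition admissible m :=
  good m || [exists i, m == base_mono i].

Lemma admissible_exp m : admissible m -> exists j, m.2 j != 0%N.
Proof.
move=> /orP[/and3P[_ _ /existsP[j hj]]|/existsP[i /eqP ->]]; first by exists j.
by exists i; rewrite /= ffunE eqxx.
Qed.

Lemma tau_le_load s j : tau s j <= load s.
Proof.
rewrite /load (bigD1 j) //= (@le_trans _ _ (Num.max 0 (tau s j))) //.
  by rewrite le_max lexx orbT.
by rewrite lerDl sumr_ge0 // => i _; rewrite le_max lexx.
Qed.

Lemma Re_ell_admissible m s : load s < 1 -> admissible m ->
  -1 < complex.Re (ell m s) /\ (m.1.1 -> 0 < complex.Re (ell m s)).
Proof.
move=> s1 /orP[gm|/existsP[i /eqP ->]].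
  have h : 0 < complex.Re (ell m s).
    apply: lt_le_trans (Re_ell_good s gm); rewrite mulr_gt0 ?subr_gt0 //.
    by case/and3P: gm => [d0 _ _]; rewrite ltr0n.
  by split=> //; apply: lt_trans h; rewrite ltrN10.
rewrite ell_base Re_add Re_opp /=; split=> //.
have := le_lt_trans (tau_le_load s i) s1; rewrite /tau; lra.
Qed.

(** Hence every monomial has a convergent Euler product where the series converges. *)
Lemma Re_ell_gt1 m s : (forall i, 2 < complex.Re (s ord0 i)) -> admissible m ->
  1 < complex.Re (ell m s).
Proof.
move=> s2 /admissible_exp[j mj]; rewrite Re_ell -sumrN (bigD1 j) //= addrCA.
have h i : 0 <= - (tau s i *+ m.2 i).
  by rewrite -mulNrn mulrn_wge0 // /tau; have := s2 i; lra.
have : - tau s j <= - (tau s j *+ m.2 j).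
  rewrite -mulNrn -[leLHS]mulr1n ler_wpMn2l ?lt0n //.
  by rewrite /tau; have := s2 j; lra.
have : 0 <= (mdeg m)%:R + \sum_(i < n | i != j) - (tau s i *+ m.2 i).
  by rewrite addr_ge0 ?sumr_ge0.
by have := s2 j; rewrite /tau; lra.
Qed.

Lemma ell_differentiable m s : differentiable (ell m) s.
Proof.
apply: hol_sub; first exact: hol_cst.
apply: hol_sum => j _; under eq_fun do rewrite -mulr_natl.
apply: hol_mul; first exact: hol_cst.
by apply: hol_sub; [exact: hol_cst|exact: coord_differentiable].
Qed.

Lemma mval_differentiable m p s : differentiable (mval m p) s.
Proof.
apply: hol_mul; first exact: hol_cst.
by apply: natpow_differentiable; apply: hol_opp; exact: ell_differentiable.
Qed.

Lemma normc_mval m p s : normc (mval m p s) = npw p (- complex.Re (ell m s)).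
Proof. by rewrite /mval normcM normcX normcN normc1 expr1n mul1r normc_natpow Re_opp. Qed.

(** $\prod_p (1 - m_p)^{-1}$ is $\zeta(\ell)$ or $\zeta(2\ell)/\zeta(\ell)$ according to
    the sign of $m$; these are its numerator and denominator in terms of $\xi$. *)
Definition num m s : C :=
  if m.1.1 then xi (2 * ell m s) * (ell m s - 1) else xi (ell m s).

Definition den m s : C :=
  if m.1.1 then (2 * ell m s - 1) * xi (ell m s) else ell m s - 1.

Lemma num_differentiable m s : load s < 1 -> admissible m -> differentiable (num m) s.
Proof.
move=> s1 am; have [l1 l0] := Re_ell_admissible s1 am; rewrite /num; case: m.1.1 l0 => [/(_ isT) l0|_].
  apply: hol_mul; last by apply: hol_sub; [exact: ell_differentiable|exact: hol_cst].
  have fd : differentiable (fun v => 2 * ell m v) s.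
    by apply: hol_mul; [exact: hol_cst|exact: ell_differentiable].
  apply: (hol_comp fd).
  by apply: xi_differentiable; rewrite Re_mul Re_nat Im_nat; lra.
by apply: hol_comp; [exact: ell_differentiable|exact: xi_differentiable].
Qed.

Lemma den_differentiable m s : load s < 1 -> admissible m -> differentiable (den m) s.
Proof.
move=> s1 am; have [l1 _] := Re_ell_admissible s1 am; rewrite /den; case: m.1.1.
  apply: hol_mul; last by apply: hol_comp; [exact: ell_differentiable|exact: xi_differentiable].
  apply: hol_sub; last exact: hol_cst.
  by apply: hol_mul; [exact: hol_cst|exact: ell_differentiable].
by apply: hol_sub; [exact: ell_differentiable|exact: hol_cst].
Qed.

Lemma Re_gt1_neq (w : C) : 1 < complex.Re w -> w - 1 != 0.
Proof.
by move=> w1; apply/eqP => /(congr1 (@complex.Re R)); rewrite Re_add Re_opp /=; lra.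
Qed.

Lemma den_neq0 m s : (forall i, 2 < complex.Re (s ord0 i)) -> admissible m -> den m s != 0.
Proof.
move=> s2 am; have l1 := Re_ell_gt1 s2 am; rewrite /den; case: m.1.1; last exact: Re_gt1_neq.
by rewrite mulf_neq0 ?xi_neq0 // Re_gt1_neq // Re_mul Re_nat Im_nat; lra.
Qed.

Lemma num_euler m s : (forall i, 2 < complex.Re (s ord0 i)) -> admissible m ->
  (fun X => num m s * \prod_(p < X | prime p) (1 - mval m p s)) @ \oo --> den m s.
Proof.
move=> s2 am; have l1 := Re_ell_gt1 s2 am; have e1 := xi_euler l1.
rewrite /num /den /mval; case: m.1.1; last first.
  by move: e1; under eq_fun do under eq_bigr do rewrite -[natpow _ _]mul1r -(expr0 (-1)).
have w0 := Re_gt1_neq l1; have x0 := xi_neq0 l1.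
move: e1 w0 x0; set w := ell m s => e1 w0 x0.
have w2 : 1 < complex.Re (2 * w) by rewrite Re_mul Re_nat Im_nat; move: l1; rewrite -/w; lra.
have e3 : (fun X => (xi (2 * w) * (w - 1) *
     \prod_(p < X | prime p) (1 - (-1) ^+ true * natpow p (- w))) *
    (xi w * \prod_(p < X | prime p) (1 - natpow p (- w)))) @ \oo -->
    (2 * w - 1) * ((w - 1) * xi w).
  have := cvgMC (xi_euler w2) (@cvg_cstC _ ((w - 1) * xi w)).
  apply: (cvg_eq_eventually (N := 0)) => X _.
  have -> : \prod_(p < X | prime p) (1 - natpow p (- (2 * w))) =
    \prod_(p < X | prime p) (1 - (-1) ^+ true * natpow p (- w)) *
    \prod_(p < X | prime p) (1 - natpow p (- w)).
    rewrite -big_split; apply: eq_bigr => p _ /=.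
    by rewrite mulr_natl -mulNrn natpowMn expr1 expr2; ring.
  ring.
have := cvg_factorC e3 e1 w0.
by rewrite [_ * xi w]mulrC mulrA mulfK.
Qed.

(** Expansion to degree [K.+2], after the factor $\prod_i (1 - y_i)$ has been
    taken out. *)
Definition lists K : {PL : seq (@mono n) * seq (@mono n) | @expansion R n K.+2 PL.1 PL.2}.
Proof. by apply/cid; have [P [L h]] := @expansion_exists R n K.+1; exists (P, L). Qed.

Definition fac K : seq (@mono n) := (projT1 (lists K)).1.
Definition rest K : seq (@mono n) := (projT1 (lists K)).2.
Definition poles K : seq (@mono n) := map base_mono (enum 'I_n) ++ fac K.

Lemma poles_admissible K m : m \in poles K -> admissible m.
Proof.
rewrite mem_cat => /orP[/mapP[i _ ->]|mK].
  by apply/orP; right; apply/existsP; exists i.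
by have [g _ _ _] := projT2 (lists K); rewrite /admissible (allP g).
Qed.

Lemma hfac_expand K p s : prime p ->
  hfac p s * \prod_(m <- fac K) (1 - mval m p s) = 1 + \sum_(m <- rest K) mval m p s.
Proof. by have [_ _ _] := projT2 (lists K); apply. Qed.

(** There $\Re \ell > 1$ for the monomials of degree at least [K.+2]. *)
Definition region K : set 'rV[C]_n := [set s | 1 < K.+2%:R * (1 - load s)].

Lemma region_load K s : region K s -> load s < 1.
Proof.
move=> h; rewrite -subr_gt0 -(@pmulr_rgt0 _ K.+2%:R) ?ltr0n //.
exact: lt_trans ltr01 h.
Qed.

Lemma load_region s : load s < 1 -> exists K, region K s.
Proof.
rewrite -subr_gt0 => h; exists (Num.truncn (1 - load s)^-1).
rewrite /region /= -ltr_pdivrMr // mul1r; apply: lt_trans (truncnS_gt _) _.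
by rewrite ltr_nat.
Qed.

Lemma region_sub K K' : (K <= K')%N -> region K `<=` region K'.
Proof.
move=> KK s h; apply: (lt_le_trans h); rewrite ler_wpM2r ?ler_nat //.
by rewrite subr_ge0 ltW // (region_load h).
Qed.

Lemma region_open K : open (region K).
Proof.
rewrite openE => s hs; apply/nbhs_nrmP.
have d0 : 0 < (K.+2%:R * (1 - load s) - 1) / K.+2%:R / n.+1%:R.
  by rewrite !divr_gt0 ?subr_gt0 ?ltr0n.
exists ((K.+2%:R * (1 - load s) - 1) / K.+2%:R / n.+1%:R) => // q.
rewrite ltr_pdivlMr ?ltr0n // ltr_pdivlMr ?ltr0n // /region /= => h.
have : n%:R * nrm (q - s) * K.+2%:R <= nrm (q - s) * n.+1%:R * K.+2%:R.
  rewrite [n%:R * _]mulrC; rewrite ler_wpM2r ?ler0n // ler_wpM2l ?nrm_ge0 //.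
  by rewrite ler_nat.
have : load q * K.+2%:R <= (load s + n%:R * nrm (q - s)) * K.+2%:R.
  by rewrite ler_wpM2r ?ler0n ?load_lip.
move: h; set k := K.+2%:R.
have -> : k * (1 - load q) = k - load q * k by ring.
have -> : k * (1 - load s) = k - load s * k by ring.
by rewrite [(load s + _) * k]mulrDl; lra.
Qed.

Lemma region_convex K : segment_convex (region K).
Proof.
move=> x y hx hy t t01; rewrite /region /=.
have := load_convex x y t01; move: hx hy; rewrite /region /=.
set k := K.+2%:R; set lx := load x; set ly := load y => hx hy hl.
have k0 : 0 < k by rewrite /k ltr0n.
apply: (@lt_le_trans _ _ (k * (1 - ((1 - t) * lx + t * ly)))); last first.
  by rewrite ler_pM2l // lerD2l lerN2.
have -> : k * (1 - ((1 - t) * lx + t * ly)) = (1 - t) * (k * (1 - lx)) + t * (k * (1 - ly)) by ring.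
have /andP[t0 t1] := t01.
have h1 : 0 <= (1 - t) * (k * (1 - lx) - 1) by rewrite mulr_ge0 // subr_ge0 // ltW.
have h2 : 0 <= t * (k * (1 - ly) - 1) by rewrite mulr_ge0 // subr_ge0 // ltW.
have [t_lt|t_ge] := ltP t 1.
  have : 0 < (1 - t) * (k * (1 - lx) - 1) by rewrite mulr_gt0 // subr_gt0.
  by move: h2; rewrite !mulrBr; lra.
have -> : t = 1 by apply/eqP; rewrite eq_le t1.
by rewrite subrr mul0r mul1r add0r.
Qed.

Lemma region_right K s : (forall i, 2 < complex.Re (s ord0 i)) -> region K s.
Proof.
move=> s2; have -> : region K s = (1 < K.+2%:R * (1 - load s)) by [].
have -> : load s = 0.
  rewrite /load big1 // => j _; apply/max_idPl.
  by rewrite /tau; have := s2 j; lra.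
by rewrite subr0 mulr1 ltr1n.
Qed.

(** The local factor of the residual Euler product. *)
Definition resid K p s : C := if prime p then \sum_(m <- rest K) mval m p s else 0.

Lemma resid_prod K X s : \prod_(p < X) (1 + resid K p s) =
  \prod_(p < X | prime p) (1 + \sum_(m <- rest K) mval m p s).
Proof.
rewrite [RHS]big_mkcond; apply: eq_bigr => p _; rewrite /resid.
by case: ifP; rewrite ?addr0.
Qed.

Definition eprod K s : C := lim ((fun X => \prod_(p < X) (1 + resid K p s)) @ \oo).

Let eprod_near K q : region K q -> exists r A B, [/\ 0 < r,
  forall k v, nrm (v - q) < r -> differentiable (resid K k) v,
  forall k v, nrm (v - q) < r -> normc (resid K k v) <= A k &
  forall N : nat, \sum_(k < N) A k <= (B : R)].
Proof.
move=> hq; pose b := (1 + K.+2%:R * (1 - load q)) / 2.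
have hq1 : 1 < K.+2%:R * (1 - load q) by exact: hq.
have b1 : 1 < b by rewrite /b; lra.
have [B hB] := npw_sum_bound b1.
pose A p : R := (size (rest K))%:R * npw p (- b).
pose r : R := (b - 1) / K.+2%:R / n.+1%:R.
have r0 : 0 < r by rewrite !divr_gt0 ?subr_gt0 ?ltr0n.
exists r, A, ((size (rest K))%:R * (npw 0 (- b) + B)); split=> //.
- move=> k v _; rewrite /resid; case: (prime k); last exact: hol_cst.
  by apply: hol_sum => m _; exact: mval_differentiable.
- move=> k v vr; rewrite /resid /A; case: ifP => pk; last first.
    by rewrite normc0 mulr_ge0 ?npw_ge0.
  apply: le_trans (ler_normc_sum _ _ _) _.
  rewrite -sum1_size natr_sum mulr_suml big_seq [leRHS]big_seq; apply: ler_sum => m mL.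
  rewrite mul1r normc_mval; apply: ler_npw; rewrite lerN2.
  have [_ /allP gL /allP dL _] := projT2 (lists K).
  apply: le_trans (Re_ell_good v (gL m mL)).
  have lv : load v <= load q + r * n%:R.
    by rewrite (le_trans (load_lip v q)) // lerD2l mulrC ler_wpM2r ?ler0n // ltW.
  have rn : r * n%:R <= (b - 1) / K.+2%:R.
    rewrite /r mulrAC ler_pdivrMr ?ltr0n // ler_wpM2l ?ler_nat //.
    by rewrite divr_ge0 ?ler0n // subr_ge0 ltW.
  have : b <= K.+2%:R * (1 - load v).
    have : K.+2%:R * (load v) <= K.+2%:R * (load q + (b - 1) / K.+2%:R).
      by rewrite ler_wpM2l ?ler0n // (le_trans lv) // lerD2l.
    have e : K.+2%:R * ((b - 1) / K.+2%:R) = b - 1 by rewrite mulrC divfK ?pnatr_eq0.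
    rewrite mulrDr e mulrBr mulr1.
    by have : b = (1 + K.+2%:R * (1 - load q)) / 2 by []; rewrite mulrBr mulr1; lra.
  move=> h; apply: (le_trans h); rewrite ler_wpM2r ?ler_nat ?dL //.
  have := lt_le_trans (lt_trans ltr01 b1) h.
  by rewrite pmulr_rgt0 ?ltr0n // => /ltW.
- move=> N; rewrite -mulr_sumr ler_wpM2l ?ler0n //.
  case: N => [|N]; last by rewrite big_ord_recl lerD2l.
  rewrite big_ord0 addr_ge0 ?npw_ge0 //.
  by have := hB 0%N; rewrite big_ord0.
Qed.

Lemma eprod_cvg K s : region K s ->
  (fun X => \prod_(p < X) (1 + resid K p s)) @ \oo --> eprod K s.
Proof.
move=> /eprod_near[r [A [B [r0 h1 h2 h3]]]].
have [h _] := hol_infinite_product r0 h1 h2 h3.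
have [|l hl] := h s; first by rewrite subrr nrm0.
by rewrite /eprod (cvg_lim (@norm_hausdorff _ _) hl).
Qed.

Lemma eprod_differentiable K s : region K s -> differentiable (eprod K) s.
Proof.
move=> hs; have [r [A [B [r0 h1 h2 h3]]]] := eprod_near hs.
have : nbhs s (region K) by apply: open_nbhs_nbhs; split => //; exact: region_open.
move=> /nbhs_nrmP[e e0 he].
have re0 : 0 < Num.min r e by rewrite lt_min r0.
have [_] := @hol_infinite_product _ _ (resid K) s (Num.min r e) B A re0
  ltac:(by move=> k v; rewrite lt_min => /andP[/h1]) ltac:(by move=> k v; rewrite lt_min => /andP[/h2]) h3.
by apply=> v; rewrite lt_min => /andP[_ /he]; exact: eprod_cvg.
Qed.

(** On [region K] the series continues as [numer K / denom K]. *)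
Definition numer K s : C := eprod K s * \prod_(m <- poles K) num m s.
Definition denom K s : C := \prod_(m <- poles K) den m s.

Lemma numer_differentiable K s : region K s -> differentiable (numer K) s.
Proof.
move=> hs; apply: hol_mul; first exact: eprod_differentiable.
rewrite /numer; under eq_fun do rewrite big_seq.
apply: hol_prod => m /poles_admissible; apply: num_differentiable; exact: region_load hs.
Qed.

Lemma denom_differentiable K s : load s < 1 -> differentiable (denom K) s.
Proof.
move=> s1; rewrite /denom; under eq_fun do rewrite big_seq.
by apply: hol_prod => m /poles_admissible; exact: den_differentiable.
Qed.

Lemma denom_neq0 K s : (forall i, 2 < complex.Re (s ord0 i)) -> denom K s != 0.
Proof.
move=> s2; rewrite /denom prodf_seq_neq0; apply/allP => m /poles_admissible am /=.
exact: den_neq0.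
Qed.

(** Where the series converges, all Euler products involved do. *)
Lemma numer_denom K s : abs_conv totient s -> numer K s = denom K s * multi_series totient s.
Proof.
move=> /abs_convP[B sB]; have s2 i := abs_conv_Re_gt2 sB i.
have hE := multi_series_euler sB.
have hP : (fun X => \prod_(m <- poles K) (num m s * \prod_(p < X | prime p) (1 - mval m p s)))
    @ \oo --> denom K s.
  rewrite /denom; have : {subset poles K <= poles K} by [].
  elim: {1 3 4}(poles K) => [|m P ih] sP.
    by rewrite big_nil; apply: (cvg_eq_eventually (N := 0)) (@cvg_cstC _ 1) => X _; rewrite big_nil.
  rewrite big_cons; have mP : m \in poles K by apply: sP; rewrite inE eqxx.
  have h1 := num_euler s2 (poles_admissible mP).
  have h2 := ih ltac:(by move=> x xP; apply: sP; rewrite inE xP orbT).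
  have := cvgMC h1 h2.
  by apply: (cvg_eq_eventually (N := 0)) => X _; rewrite big_cons.
apply: cvg_uniqueC (cvgMC hP hE).
have := cvgMC (eprod_cvg (region_right K s2)) (@cvg_cstC _ (\prod_(m <- poles K) num m s)).
apply: (cvg_eq_eventually (N := 0)) => X _.
rewrite resid_prod big_split /= mulrC -mulrA; congr (_ * _).
rewrite exchange_big -big_split; apply: eq_bigr => p pp /=.
rewrite -hfac_expand // /poles big_cat /= [RHS]mulrAC; congr (_ * _).
rewrite big_map big_enum /= /loc_factor /hfac.
have -> : \prod_(i in 'I_n) (1 - mval (base_mono i) p s) = \prod_i (1 - natpow p (1 - s ord0 i)).
  by apply: eq_bigr => i _; rewrite mval_base.
have yne i : 1 - natpow p (1 - s ord0 i) != 0.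
  apply/eqP => /eqP; rewrite subr_eq0 => /eqP e.
  by have := normc_y_lt1 sB i pp; rewrite -e normc1 ltxx.
rewrite prodfV mulrDr [_ * ((1 - _) * _)]mulrCA divff ?mulr1; last exact/prodf_neq0.
by rewrite addrC [_ * p%:R^-1]mulrC.
Qed.

(** The factor of [eprod K] at [p] is a multiple of [hfac p]. *)
Lemma numer_eq0 K p s : prime p -> region K s -> hfac p s = 0 -> numer K s = 0.
Proof.
move=> pp hs h0; rewrite /numer; have -> : eprod K s = 0; last by rewrite mul0r.
apply: cvg_uniqueC (eprod_cvg hs) _.
apply: (cvg_eq_eventually (N := p.+1)) (@cvg_cstC _ 0) => X pX.
rewrite (bigD1 (Ordinal pX)) //= /resid pp -hfac_expand // h0 mul0r.
by rewrite mul0r.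
Qed.

Definition right_half : set 'rV[C]_n := [set s | forall i, 2 < complex.Re (s ord0 i)].

Lemma right_half_open : open right_half.
Proof.
rewrite openE => s hs; apply/nbhs_nrmP.
exists (\big[Num.min/1]_(i < n) (complex.Re (s ord0 i) - 2)).
  by elim/big_ind: _ => [//|x y x0 y0|i _]; rewrite ?lt_min ?x0 // subr_gt0 hs.
move=> q hq i; have : nrm (q - s) < complex.Re (s ord0 i) - 2.
  by apply: (lt_le_trans hq); exact: bigmin_le_cond.
have := tau_lip q s i; rewrite /tau; move: (ler_norm (1 - complex.Re (q ord0 i) - (1 - complex.Re (s ord0 i)))); lra.
Qed.

Lemma right_half_nonempty : right_half (const_mx (3%:R)).
Proof. by move=> i; rewrite mxE Re_nat ltr_nat. Qed.

(** Both quotients are the sum of the series on the half-space, so the identity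
    theorem on the smaller region applies. *)
Lemma cross K K' s : (K <= K')%N -> region K s ->
  numer K s * denom K' s = numer K' s * denom K s.
Proof.
move=> KK hs; apply/eqP; rewrite -subr_eq0; apply/eqP.
apply: (identity_theorem (f := fun s => numer K s * denom K' s - numer K' s * denom K s)
  (U := region K) (O := right_half)) hs.
- exact: region_open.
- exact: region_convex.
- move=> z hz; have hz' := region_sub KK hz.
  by apply: hol_sub; apply: hol_mul;
    first [exact: numer_differentiable|apply: denom_differentiable; exact: region_load hz].
- exact: right_half_open.
- by exists (const_mx 3%:R); exact: right_half_nonempty.
- by move=> z; exact: region_right.
- move=> z /abs_conv_gt2 hz; rewrite !numer_denom //; ring.
Qed.

End Approximants.

(** * The complex logarithm *)

Section ComplexLogarithm.
Context {R : realType}.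
Local Notation C := R[i].
Implicit Types (z h : C).

(** The principal logarithm of $1 + z$, for $|z| < 1/2$. *)
Definition clog1 z : C :=
  (ln (normc (1 + z)) +i* atan (complex.Im z / (1 + complex.Re z)))%C.

Lemma cexp_clog1 z : -1 < complex.Re z -> cexp (clog1 z) = 1 + z.
Proof.
case: z => a b /= a1; have a0 : 0 < 1 + a by lra.
rewrite /clog1; set N := normc (1 + (a +i* b)%C); rewrite /cexp /=.
have NE : N ^+ 2 = (1 + a) ^+ 2 + b ^+ 2.
  by rewrite /N /= add0r sqr_sqrtr // addr_ge0 ?sqr_ge0.
have N0 : 0 < N.
  rewrite lt_def normc_ge0 andbT -sqrf_eq0 NE gt_eqF // ltr_pwDl ?sqr_ge0 //.
  by rewrite exprn_gt0.
have cosE : cos (atan (b / (1 + a))) = (1 + a) / N.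
  rewrite cos_atan (_ : 1 + _ = (N / (1 + a)) ^+ 2); last first.
    by rewrite [in RHS]expr_div_n NE; field; rewrite gt_eqF.
  by rewrite sqrtr_sqr ger0_norm ?divr_ge0 ?ltW // invf_div.
have sinE : sin (atan (b / (1 + a))) = b / N.
  have c0 : cos (atan (b / (1 + a))) != 0 by rewrite cosE mulf_neq0 ?invr_eq0 ?gt_eqF.
  have := atanK (b / (1 + a)); rewrite /tan => /(congr1 (fun x => x * cos (atan (b / (1 + a))))).
  by rewrite divfK // cosE => ->; field; rewrite !gt_eqF.
rewrite cosE sinE lnK ?posrE //; apply: complex_eq; rewrite /= ?mul0r ?subr0 ?addr0 ?add0r.
  by rewrite mulrC divfK ?gt_eqF.
by rewrite mulrC divfK ?gt_eqF.
Qed.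

Lemma Re_gt_half z : normc z < 2^-1 -> - 2^-1 < complex.Re z.
Proof. by move=> h; have := le_lt_trans (normc_Re z) h; rewrite ltr_norml => /andP[]. Qed.

Lemma normc_1D_half z : normc z < 2^-1 -> 2^-1 < normc (1 + z).
Proof.
move=> h; have := ler_normcB (1 + z) z; rewrite addrK normc1; lra.
Qed.

Lemma normc_clog1 z : normc z < 2^-1 -> normc (clog1 z) <= 1 + pi / 2.
Proof.
move=> h; apply: le_trans (normc_le _) _; rewrite /clog1 /=; apply: lerD.
  have h1 := normc_1D_half h.
  have h2 : normc (1 + z) < 2 by have := ler_normcD 1 z; rewrite normc1; lra.
  have p0 : 0 < normc (1 + z) by lra.
  rewrite ler_norml; apply/andP; split.
    rewrite lerNl -lnV ?posrE // -[_^-1](addrNK 1) addrC; apply: le_trans (le_ln1Dx _) _.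
      by rewrite ltrBrDl addrN invr_gt0.
    rewrite lerBlDr; apply: (@le_trans _ _ (2^-1)^-1); last by rewrite invrK; lra.
    by rewrite lef_pV2 ?posrE ?invr_gt0 // ltW.
  rewrite -[normc _](addrNK 1) addrC; apply: le_trans (le_ln1Dx _) _; lra.
by rewrite ler_norml !ltW ?atan_ltpi2 ?atan_gtNpi2.
Qed.

Let clog1_cont z (e : R) : normc z < 2^-1 -> 0 < e -> exists2 d : R, 0 < d &
  forall h, normc h < d -> normc (z + h) < 2^-1 /\ normc (clog1 (z + h) - clog1 z) < e.
Proof.
move=> z2 e0; have e2 : 0 < e / 2 by rewrite divr_gt0.
have p0 : 0 < normc (1 + z) by have := normc_1D_half z2; lra.
have /cvgrPdist_lt/(_ _ e2) := continuous_ln p0.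
rewrite near_simpl => /nbhs_ballP[d1 /= d10 hd1].
have /cvgrPdist_lt/(_ _ e2) := @continuous_atan _ (complex.Im z / (1 + complex.Re z)).
rewrite near_simpl => /nbhs_ballP[d2 /= d20 hd2].
exists (Num.min (2^-1 - normc z) (Num.min d1 (d2 / 16))).
  by rewrite !lt_min subr_gt0 z2 d10 divr_gt0.
move=> h; rewrite !lt_min => /and3P[h1 h2 h3].
have zh : normc (z + h) < 2^-1 by have := ler_normcD z h; lra.
have main : normc (clog1 (z + h) - clog1 z) < e; last exact: (conj zh main).
apply: (le_lt_trans (normc_le (clog1 (z + h) - clog1 z))).
rewrite Re_add Im_add Re_opp Im_opp /clog1 /= [e]splitr; apply: ltrD.
  rewrite distrC; apply: hd1; rewrite /ball /= distrC.
  apply: le_lt_trans h2; have hE : 1 + (z + h) - (1 + z) = h by ring.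
  have := ler_dist_normc (1 + (z + h)) (1 + z); rewrite hE => i1.
  have := ler_dist_normc (1 + z) (1 + (z + h)); rewrite normc_distC hE => i2.
  by rewrite ler_norml lerNl opprB i1 i2.
rewrite distrC; apply: hd2; rewrite /ball /= distrC.
have /(Re_gt_half) rz := z2; have /(Re_gt_half) rzh := zh.
have := le_trans (normc_Re h) (ltW h3); have := le_trans (normc_Im h) (ltW h3).
have := le_lt_trans (normc_Re z) z2; have := le_lt_trans (normc_Im z) z2.
move: rz rzh; rewrite !Re_add !Im_add.
case: (z) (h) => a b [c d] /= a1 a2; rewrite !ltr_norml !ler_norml => /andP[a3 a4] /andP[a5 a6] /andP[a7 a8] /andP[a9 a10].
have A0 : 0 < 1 + a by lra.
have B0 : 0 < 1 + (a + c) by lra.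
have -> : (b + d) / (1 + (a + c)) - b / (1 + a) = (d * (1 + a) - b * c) / ((1 + (a + c)) * (1 + a)).
  by field; rewrite !gt_eqF.
have q0 : 4^-1 < (1 + (a + c)) * (1 + a).
  apply: le_lt_trans (_ : 2^-1 * 2^-1 < _); first by lra.
  by apply: ltr_pM; lra.
rewrite -ltr_norml normrM normfV [X in _ / X]gtr0_norm ?mulr_gt0 // ltr_pdivrMr ?mulr_gt0 //.
apply: (@lt_le_trans _ _ (d2 * 4^-1)); last by rewrite ler_pM2l // ltW.
apply: le_lt_trans (ler_normB _ _) _; rewrite !normrM.
have n1 : `|d| <= d2 / 16 by rewrite ler_norml a7.
have n2 : `|c| <= d2 / 16 by rewrite ler_norml a9.
have n3 : `|b| < 2^-1 by rewrite ltr_norml a3.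
have n4 : `|1 + a| < 3 / 2 by rewrite gtr0_norm //; lra.
have b1 : `|d| * `|1 + a| <= d2 / 16 * (3 / 2) by rewrite ler_pM // ltW.
have b2 : `|b| * `|c| <= 2^-1 * (d2 / 16) by rewrite ler_pM // ltW.
have -> : 4^-1 = 2^-1 / 2 :> R by field.
by move: b1 b2 d20; lra.
Qed.

(** Inverse of the exponential: $w = o(1)$ and $e^w = 1 + u$ give
    $w = u + O(u^2)$. *)
Lemma clog1_differentiable z : normc z < 2^-1 -> differentiable clog1 z.
Proof.
move=> z2; apply: (@cder_differentiable R clog1 z (1 + z)^-1) => e e0.
pose K : R := expR 1; have K0 : 0 < K by exact: expR_gt0.
have K1 : 1 <= K by rewrite /K -[leLHS]expR0 ler_expR.
have k0 : 0 < (2 * K)^-1 by rewrite invr_gt0 mulr_gt0.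
have [d d0 hd] := clog1_cont z2 k0.
exists (Num.min d (e / (16 * K))); first by rewrite lt_min d0 divr_gt0 ?mulr_gt0.
move=> h; rewrite lt_min => /andP[/hd[zh wh] he].
set w := clog1 (z + h) - clog1 z in wh *.
have a0 : normc (1 + z) > 2^-1 by exact: normc_1D_half.
have z0 : 1 + z != 0 by rewrite -normc_gt0; apply: lt_trans a0; rewrite invr_gt0.
have hn : normc ((1 + z)^-1 * h) <= 2 * normc h.
  rewrite normcM normcV ler_wpM2r ?normc_ge0 // -[leRHS]invrK.
  have p1 : 0 < normc (1 + z) by apply: lt_trans a0; rewrite invr_gt0.
  by rewrite lef_pV2 ?posrE ?invr_gt0 //; exact: ltW.
have ew : cexp w = 1 + (1 + z)^-1 * h.
  rewrite /w cexpD cexpN !cexp_clog1; first by field.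
    by have := Re_gt_half z2; lra.
  by have := Re_gt_half zh; lra.
set u := (1 + z)^-1 * h in hn ew *.
have w1 : normc w <= 1.
  apply: ltW; apply: (lt_le_trans wh); rewrite invf_le1 ?mulr_gt0 //.
  by move: K1; lra.
have wu : normc (u - w) <= normc w ^+ 2 * K.
  have -> : u - w = cexp w - 1 - w by rewrite ew [1 + u]addrC addrK.
  apply: le_trans (cexp_sub1_sub_le w) _.
  by rewrite ler_wpM2l ?sqr_ge0 // ler_expR.
have wu2 : normc w ^+ 2 * K <= normc w / 2.
  have : normc w * (normc w * K) <= normc w * 2^-1.
    rewrite ler_wpM2l ?normc_ge0 // -ler_pdivlMr // -invfM ltW //.
  by rewrite expr2 mulrA.
have w2u : normc w <= 2 * normc u.
  have := ler_normcB u (u - w); rewrite opprB addrC subrK.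
  by move: wu wu2; lra.
rewrite normc_distC; apply: (le_trans wu).
apply: (@le_trans _ _ ((4 * normc h) ^+ 2 * K)).
  rewrite ler_pM2r // lerXn2r ?nnegrE ?mulr_ge0 ?normc_ge0 //.
  by move: w2u hn; lra.
have -> : (4 * normc h) ^+ 2 * K = (normc h * (16 * K)) * normc h by ring.
by rewrite ler_wpM2r ?normc_ge0 // -ler_pdivlMr ?mulr_gt0 // ltW.
Qed.

Lemma cexp_2pi_int (k : int) : cexp ((0 +i* (pi *+ 2 *~ k))%C : C) = 1.
Proof.
have h : cexp ((0 +i* (pi *+ 2))%C : C) = 1.
  by rewrite /cexp /= expR0 cos2pi sin2pi mul1r.
have hn m : cexp ((0 +i* (pi *+ 2 *+ m))%C : C) = 1.
  have -> : (0 +i* (pi *+ 2 *+ m))%C = (0 +i* (pi *+ 2))%C *+ m :> C.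
    elim: m => [|m ih]; first by rewrite !mulr0n.
    by rewrite (mulrS (pi *+ 2) m) (mulrS _ m) -ih; apply: complex_eq; rewrite ?Re_add ?Im_add //= addr0.
  by rewrite cexpMn h expr1n.
case: k => m; first exact: hn.
have -> : (0 +i* (pi *+ 2 *~ Negz m))%C = - (0 +i* (pi *+ 2 *+ m.+1))%C :> C.
  by apply: complex_eq; rewrite ?Re_opp ?Im_opp //= oppr0.
by rewrite cexpN hn invr1.
Qed.

(** Every angle has a representative in any interval of length $2\pi$. *)
Lemma angle_in (x T : R) : exists th : R,
  T <= th <= T + pi *+ 2 /\ cexp ((0 +i* th)%C : C) = cexp ((0 +i* x)%C : C).
Proof.
have p0 : 0 < pi *+ 2 :> R by rewrite pmulrn_lgt0 // pi_gt0.
pose k := Num.floor ((T + pi *+ 2 - x) / (pi *+ 2)).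
have /andP[k1 k2] := floor_itv ((T + pi *+ 2 - x) / (pi *+ 2)).
exists (x + pi *+ 2 *~ k); split.
  move: k1 k2; rewrite ler_pdivlMr // ltr_pdivrMr // -/k rmorphD /= mulrDl mul1r.
  by rewrite -[pi *+ 2 *~ k]mulrzl; set q := k%:~R * _; lra.
have -> : (0 +i* (x + pi *+ 2 *~ k))%C = (0 +i* x)%C + (0 +i* (pi *+ 2 *~ k))%C :> C.
  by apply: complex_eq; rewrite ?Re_add ?Im_add //= addr0.
by rewrite cexpD cexp_2pi_int mulr1.
Qed.

End ComplexLogarithm.

(** * Zeros of the local factors *)

Section ZeroGraph.
Context {R : realType} {n : nat}.
Local Notation C := R[i].
Implicit Types (s : 'rV[C]_n) (p : nat).
Local Notation y p s j := (natpow p (1 - s ord0 j)).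

Variables (c : 'rV[C]_n) (i : 'I_n).

Let J j := (j != i) && (0 < tau c j).

(** The local factor at $p$ vanishes where $y_i = 1 + (p-1)/$[others p s]. *)
Definition others p s : C := \prod_(j | j != i) (1 - y p s j).

(** As $p \to \infty$, $1 - y_j$ behaves like $-y_j$ for $j$ in [J] and like $1$ otherwise, so
    the zeros approach the complex hyperplane where $\sum_{j \in J \cup \{i\}} (1 - s_j)$ has the
    same value as at [c]; this is the value of $s_i$ on it. *)
Definition boundary_coord s : C := c ord0 i - \sum_(j | J j) (s ord0 j - c ord0 j).

Hypothesis tau_neq0 : forall j, j != i -> tau c j != 0.
Hypothesis tau_i : 0 < tau c i.
Hypothesis tau_sum : tau c i + \sum_(j | J j) tau c j = 1.

Let gap : exists2 e : R, 0 < e & 2 * e <= tau c i /\ forall j, j != i -> 2 * e <= `|tau c j|.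
Proof.
pose m := \big[Num.min/tau c i]_(j < n | j != i) `|tau c j|.
have m0 : 0 < m.
  apply: (big_ind (fun x => 0 < x)) => // [x x' h h'|j ji]; first by rewrite lt_min h.
  by rewrite normr_gt0 tau_neq0.
exists (m / 2); first by rewrite divr_gt0.
have -> : 2 * (m / 2) = m by field.
split; first exact: bigmin_le_id.
by move=> j ji; exact: bigmin_le_cond.
Qed.

Section AtPrime.
Variables (e : R) (p : nat).
Hypothesis (e0 : 0 < e) (gap_i : 2 * e <= tau c i).
Hypothesis (gap_j : forall j, j != i -> 2 * e <= `|tau c j|).
Hypothesis (p3 : (2 < p)%N) (psmall : 2 ^+ n.+1 * npw p (- e) < 2^-1).

Let ln0 : 0 < ln (p%:R : R). Proof. by rewrite ln_nat_gt0 // ltnW. Qed.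

Let ball_e s := nrm (s - c) < e / n.+1%:R.

Let near_tau s j : ball_e s -> `|tau s j - tau c j| < e.
Proof.
move=> h; apply: le_lt_trans (tau_lip s c j) _; apply: (lt_le_trans h).
rewrite ler_pdivrMr ?ltr0n // ler_peMr //; [exact: ltW|by rewrite ler1n].
Qed.

Let tau_J s j : ball_e s -> J j -> e <= tau s j.
Proof.
move=> /(@near_tau s j) h /andP[ji tj]; have := gap_j ji; rewrite gtr0_norm //.
by move: h; rewrite ltr_norml; lra.
Qed.

Let tau_N s j : ball_e s -> j != i -> ~~ (0 < tau c j) -> tau s j <= - e.
Proof.
move=> /(@near_tau s j) h ji; rewrite -leNgt => tj; have := gap_j ji; rewrite ler0_norm //.
by move: h; rewrite ltr_norml; lra.
Qed.

Let normc_y s j : normc (y p s j) = npw p (tau s j).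
Proof. by rewrite normc_natpow Re_add Re_opp. Qed.

(** $1 - y_j$ is $-y_j (1 + z_j)$ for $j$ in [J] and $1 + z_j$ otherwise. *)
Let z s j : C := if 0 < tau c j then - (y p s j)^-1 else - y p s j.

Let npw_half : npw p (- e) < 2^-1.
Proof. by apply: le_lt_trans psmall; rewrite ler_peMl ?npw_ge0 // exprn_ege1 // ler1n. Qed.

Let z_small s j : ball_e s -> j != i -> normc (z s j) < 2^-1.
Proof.
move=> hs ji; apply: le_lt_trans npw_half; rewrite /z.
have [tj|tj] := boolP (0 < tau c j); rewrite normcN ?normcV normc_y.
  by rewrite -npwN ler_npw // lerN2; apply: tau_J => //; rewrite /J ji.
by rewrite ler_npw //; exact: tau_N.
Qed.

Let normc_others s : ball_e s -> normc (others p s) <= 2 ^+ n * npw p (1 - e).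
Proof.
move=> hs; rewrite /others normc_prod.
have b j : j != i -> normc (1 - y p s j) <= 2 * npw p (if 0 < tau c j then tau s j else 0).
  move=> ji; apply: le_trans (ler_normcB _ _) _; rewrite normc1 normc_y.
  have [tj|tj] := boolP (0 < tau c j).
    have : 1 <= npw p (tau s j).
      rewrite -[leLHS](npw0 p); apply: ler_npw; apply: le_trans (ltW e0) _.
      by apply: tau_J => //; rewrite /J ji.
    lra.
  have := npw_le1 p (le_trans (tau_N hs ji tj) _); rewrite oppr_le0 => /(_ (ltW e0)).
  rewrite npw0; lra.
apply: (@le_trans _ _ (\prod_(j | j != i) (2 * npw p (if 0 < tau c j then tau s j else 0)))).
  by apply: ler_prod => j ji; rewrite normc_ge0 b.
rewrite big_split /= prodr_const; apply: ler_pM; rewrite ?exprn_ge0 //.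
- by apply: prodr_ge0 => j _; exact: npw_ge0.
- by rewrite ler_weXn2l ?ler1n // (leq_trans (max_card _)) // card_ord.
have -> : \prod_(j | j != i) npw p (if 0 < tau c j then tau s j else 0) =
    npw p (\sum_(j | j != i) (if 0 < tau c j then tau s j else 0)).
  by rewrite /npw mulr_suml expR_sum.
apply: ler_npw; rewrite -big_mkcondr /=.
have : \sum_(j | J j) tau s j <= \sum_(j | J j) tau c j + e.
  apply: (@le_trans _ _ (\sum_(j | J j) (tau c j + nrm (s - c)))).
    apply: ler_sum => j _; rewrite -lerBlDl; apply: le_trans (ler_norm _) _.
    exact: tau_lip.
  rewrite big_split /= lerD2l sumr_const -[leLHS]mulr_natr.
  apply: (@le_trans _ _ (e / n.+1%:R * n.+1%:R)); last by rewrite divfK ?pnatr_eq0.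
  apply: ler_pM; [exact: nrm_ge0|exact: ler0n|exact: ltW|rewrite ler_nat].
  by rewrite ltnW // ltnS (leq_trans (max_card _)) // card_ord.
by move: tau_sum gap_i; lra.
Qed.

Let p1R : 0 < (p%:R : R) - 1.
Proof. by rewrite subr_gt0 ltr1n ltnW. Qed.

Let p0C : (p%:R : C) != 0.
Proof. by rewrite pnatr_eq0 -lt0n ltnW // ltnW. Qed.

Let normc_p1 : normc ((p%:R : C) - 1) = p%:R - 1.
Proof.
rewrite -(rmorph_nat (real_complex R)) -(rmorph1 (real_complex R)) -rmorphB normcR.
by rewrite gtr0_norm.
Qed.

Let p1C : (p%:R : C) - 1 != 0.
Proof. by rewrite -normc_gt0 normc_p1. Qed.

Let zW s : C := others p s / (p%:R - 1).

Let zW_small s : ball_e s -> normc (zW s) < 2^-1.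
Proof.
move=> hs; apply: le_lt_trans psmall; rewrite normcM normcV normc_p1.
rewrite ler_pdivrMr //; apply: le_trans (normc_others hs) _.
rewrite npwD npw1 ?(ltnW (ltnW p3)) // exprS -!mulrA.
have p2 : p%:R <= 2 * (p%:R - 1) :> R.
  by have : (2 <= p)%N; [exact: ltnW|rewrite -(ler_nat R); lra].
have -> : 2 * (2 ^+ n * (npw p (- e) * (p%:R - 1))) =
   2 ^+ n * ((2 * (p%:R - 1)) * npw p (- e)) by ring.
by rewrite ler_pM2l ?exprn_gt0 // ler_wpM2r ?npw_ge0.
Qed.

Let invp_small : normc (- (p%:R^-1) : C) < 2^-1.
Proof.
by rewrite normcN normcV normc_nat ltf_pV2 ?posrE ?ltr0n ?ltr_nat // ltnW // ltnW.
Qed.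

Let one_z s j : ball_e s -> j != i -> 1 + z s j != 0.
Proof.
move=> hs ji; rewrite -normc_gt0; apply: lt_trans (normc_1D_half (z_small hs ji)).
by rewrite invr_gt0.
Qed.

Let y_J s : C := \prod_(j | J j) y p s j.

Let y_J_neq0 s : y_J s != 0.
Proof. by apply/prodf_neq0 => j _; exact: natpow_neq0. Qed.

Let sg : C := (-1) ^+ #|[pred j | J j]|.

Let others_z s : others p s = sg * y_J s * \prod_(j | j != i) (1 + z s j).
Proof.
have -> : sg * y_J s = \prod_(j | j != i) (if 0 < tau c j then - y p s j else 1).
  by rewrite -big_mkcondr /sg /y_J -prodrN.
rewrite /others -big_split; apply: eq_bigr => j _ /=; rewrite /z.
case: ifP => _; last by rewrite mul1r.
by have := natpow_neq0 p (1 - s ord0 j); set Y := natpow _ _ => Y0; field.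
Qed.

Let sg2 : sg * sg = 1.
Proof. by rewrite /sg -expr2 sqrr_sign. Qed.

Let others_neq0 s : ball_e s -> others p s != 0.
Proof.
move=> hs; rewrite others_z !mulf_neq0 ?signr_eq0 //.
by apply/prodf_neq0 => j ji; exact: one_z.
Qed.

(** The logarithm of the ratio of $1 + (p-1)/\prod_{j \ne i} (1 - y_j)$ to its main term
    $\pm p / \prod_J y_j$. *)
Let Lam s : C := clog1 (- p%:R^-1) + clog1 (zW s) - \sum_(j | j != i) clog1 (z s j).

Let cexp_half w : normc w < 2^-1 -> cexp (clog1 w) = 1 + w :> C.
Proof. by move=> /Re_gt_half h; rewrite cexp_clog1 //; lra. Qed.

Let cexp_Lam s : ball_e s -> cexp (Lam s) =
  (1 - p%:R^-1) * (1 + zW s) / \prod_(j | j != i) (1 + z s j).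
Proof.
move=> hs; rewrite /Lam !cexpD cexpN cexp_sum !cexp_half ?invp_small ?zW_small //.
by congr (_ / _); apply: eq_bigr => j ji; rewrite cexp_half ?z_small.
Qed.

Let LB : R := n.+2%:R * (1 + pi / 2).

Let normc_Lam s : ball_e s -> normc (Lam s) <= LB.
Proof.
move=> hs; have b w := @normc_clog1 R w.
have b0 : 0 <= 1 + pi / 2 :> R by rewrite addr_ge0 // divr_ge0 // pi_ge0.
apply: le_trans (ler_normcB _ _) _; rewrite /LB -addn2 natrD mulrDl addrC; apply: lerD.
  apply: le_trans (ler_normc_sum _ _ _) _.
  apply: (@le_trans _ _ (\sum_(j < n | j != i) (1 + pi / 2))).
    by apply: ler_sum => j ji; apply: b; exact: z_small.
  rewrite sumr_const -[leLHS]mulr_natl ler_wpM2r // ler_nat.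
  by rewrite (leq_trans (max_card _)) // card_ord.
rewrite mulr_natl mulr2n; apply: le_trans (ler_normcD _ _) _.
by apply: lerD; apply: b; [exact: invp_small|exact: zW_small].
Qed.

Let Lam_differentiable s : ball_e s -> differentiable Lam s.
Proof.
have yd j : differentiable (fun s => y p s j) s.
  by apply: natpow_differentiable; apply: hol_sub; [exact: hol_cst|exact: coord_differentiable].
move=> hs; rewrite /Lam; apply: hol_sub.
  apply: hol_add; first exact: hol_cst.
  apply: hol_comp; last by apply: clog1_differentiable; exact: zW_small.
  apply: hol_mul; last exact: hol_cst.
  by apply: hol_prod => j _; apply: hol_sub; [exact: hol_cst|exact: yd].
apply: hol_sum => j ji; apply: hol_comp; last by apply: clog1_differentiable; exact: z_small.
rewrite /z; case: (0 < tau c j); apply: hol_opp; last exact: yd.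
by apply: hol_inv; [exact: yd|exact: natpow_neq0].
Qed.

Let beta : R := complex.Im (\sum_(j | (j == i) || J j) (1 - c ord0 j)).

Let kappaE : (1 - c ord0 i) + \sum_(j | J j) (1 - c ord0 j) = 1 + (0 +i* beta)%C.
Proof.
have -> : (1 - c ord0 i) + \sum_(j | J j) (1 - c ord0 j) =
    \sum_(j | (j == i) || J j) (1 - c ord0 j).
  rewrite [RHS](bigD1 i) ?eqxx //=; congr (_ + _); apply: eq_bigl => j.
  by rewrite /J; case: eqVneq => //=; rewrite andbT.
apply: complex_eq; rewrite ?Re_add ?Im_add /= ?addr0 ?add0r //.
rewrite -tau_sum [LHS]Re_sum (bigD1 i) ?eqxx //=; congr (_ + _).
  by rewrite Re_add Re_opp.
have E j : complex.Re (1 - c ord0 j) = tau c j by rewrite Re_add Re_opp.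
under eq_bigr do rewrite E.
by apply: eq_bigl => j; rewrite /J; case: eqVneq => //=; rewrite andbT.
Qed.

Let natpow_boundary s : natpow p (1 - boundary_coord s) * y_J s =
  p%:R * cexp (0 +i* (beta * ln p%:R))%C.
Proof.
rewrite /y_J -natpow_sum -natpowD /boundary_coord.
have -> : 1 - (c ord0 i - \sum_(j | J j) (s ord0 j - c ord0 j)) +
     \sum_(j | J j) (1 - s ord0 j) = (1 - c ord0 i) + \sum_(j | J j) (1 - c ord0 j).
  have -> : \sum_(j | J j) (1 - c ord0 j) =
      \sum_(j | J j) (s ord0 j - c ord0 j) + \sum_(j | J j) (1 - s ord0 j).
    by rewrite -big_split; apply: eq_bigr => j _ /=; ring.
  ring.
rewrite kappaE natpowD natpow1 ?(ltnW (ltnW p3)) //; congr (_ * cexp _).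
by apply: complex_eq; rewrite ?Re_mul ?Im_mul /= ?mulr0 ?mul0r ?subr0 ?addr0 ?add0r // mulrC.
Qed.

(** Dividing the logarithms by $\log p$, the correction to [boundary_coord] is
    $O(1/\log p)$. A multiple of $2 i \pi$ is added to it so that it does not vanish. *)
Lemma graph_at_prime : exists phi : 'rV[C]_n -> C, [/\
  forall s, ball_e s -> differentiable phi s,
  forall s, ball_e s -> [/\ phi s != boundary_coord s,
    normc (phi s - boundary_coord s) <= (2 * LB + 1 + pi *+ 2) / ln p%:R,
    others p s != 0 &
    natpow p (1 - phi s) = 1 + (p%:R - 1) / others p s] &
  forall s s', (forall j, j != i -> s ord0 j = s' ord0 j) -> phi s = phi s'].
Proof.
have LB0 : 0 <= LB by rewrite mulr_ge0 // addr_ge0 // divr_ge0 // pi_ge0.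
have [th [/andP[t1 t2] hth]] :=
  angle_in (- (beta * ln p%:R + pi *+ #|[pred j | J j]|)) (LB + 1).
pose ith : C := (0 +i* th)%C; pose l : C := ((ln p%:R)%:C)%C.
have l0 : l != 0 by rewrite -normc_gt0 normcR gtr0_norm.
have nl : normc l = ln p%:R by rewrite normcR gtr0_norm.
have nth : normc ith <= LB + 1 + pi *+ 2.
  apply: le_trans (normc_le _) _; rewrite /= normr0 add0r ger0_norm //.
  by apply: le_trans t1; rewrite addr_ge0.
have ethE : cexp ith * cexp (0 +i* (beta * ln p%:R))%C = sg.
  rewrite hth -cexpD.
  have -> : (0 +i* - (beta * ln p%:R + pi *+ #|[pred j | J j]|))%C +
      (0 +i* (beta * ln p%:R))%C = - ((0 +i* pi)%C *+ #|[pred j | J j]|) :> C.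
    have h m : (0 +i* pi)%C *+ m = (0 +i* (pi *+ m))%C :> C.
      elim: m => [|m ih]; first by rewrite !mulr0n.
      by rewrite (mulrS _ m) ih (mulrS pi m); apply: complex_eq; rewrite ?Re_add ?Im_add //= addr0.
    rewrite h; apply: complex_eq; rewrite ?Re_add ?Im_add ?Re_opp ?Im_opp /= ?addr0 ?oppr0 //.
    by rewrite opprD addrAC addNr add0r.
  rewrite cexpN cexpMn.
  have -> : cexp (0 +i* pi)%C = -1 :> C.
    by rewrite /cexp /= expR0 mul1r cospi sinpi; apply: complex_eq; rewrite ?Re_opp ?Im_opp //= oppr0.
  by rewrite -exprVn invrN1.
exists (fun s => boundary_coord s - (Lam s + ith) / l); split.
- move=> s hs; apply: hol_sub.
    apply: hol_sub; first exact: hol_cst.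
    by apply: hol_sum => j _; apply: hol_sub; [exact: coord_differentiable|exact: hol_cst].
  apply: hol_mul; last exact: hol_cst.
  by apply: hol_add; [exact: Lam_differentiable|exact: hol_cst].
- move=> s hs; have Lb := normc_Lam hs.
  have W0 := others_neq0 hs; split=> //.
  + rewrite -subr_eq0 addrC addrA addNr sub0r oppr_eq0 mulf_neq0 ?invr_eq0 //.
    apply/eqP => /eqP; rewrite addr_eq0 => /eqP E.
    have := normc_Im ith; rewrite -[normc ith]normcN -E /=.
    by have := ler_norm th; move: t1 Lb; lra.
  + rewrite addrC addrA addNr sub0r normcN normcM normcV nl ler_pM2r ?invr_gt0 //.
    by apply: le_trans (ler_normcD _ _) _; move: Lb nth; lra.
  have -> : 1 - (boundary_coord s - (Lam s + ith) / l) =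
     (1 - boundary_coord s) + (Lam s + ith) / l by ring.
  rewrite natpowD.
  have -> : natpow p ((Lam s + ith) / l) = cexp (Lam s) * cexp ith.
    by rewrite /natpow -/l mulrC divfK // cexpD.
  have hb := natpow_boundary s; have hz := others_z s.
  have hL := cexp_Lam hs; have yJ := y_J_neq0 s.
  have Z0 : \prod_(j | j != i) (1 + z s j) != 0.
    by apply/prodf_neq0 => j ji; exact: one_z.
  have sg0 : sg != 0 by rewrite signr_eq0.
  have sgV : sg = sg^-1 by apply: (mulIf sg0); rewrite sg2 mulVf.
  apply: (mulIf yJ); rewrite mulrAC hb.
  have -> : p%:R * cexp (0 +i* (beta * ln p%:R))%C * (cexp (Lam s) * cexp ith) =
      p%:R * cexp (Lam s) * sg by rewrite -ethE; ring.
  rewrite [X in _ * X = _]sgV hL /zW hz.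
  by field; rewrite p1C p0C yJ Z0 sg0.
- move=> s s' ss; have ys j : j != i -> y p s j = y p s' j by move=> ji; rewrite ss.
  congr (_ - (_ + _) / _).
    by congr (_ - _); apply: eq_bigr => j /andP[ji _]; rewrite ss.
  have E1 : others p s = others p s' by apply: eq_bigr => j ji; rewrite ys.
  have E2 : \sum_(j | j != i) clog1 (z s j) = \sum_(j | j != i) clog1 (z s' j).
    by apply: eq_bigr => j ji; rewrite /z ys.
  by rewrite /Lam /zW E1 E2.
Qed.

End AtPrime.

(** Uniformity in [p]: the ball on which [phi] is defined does not shrink. *)
Lemma zero_graph : exists (r B : R) (P0 : nat), 0 < r /\ forall p, prime p -> (P0 <= p)%N ->
  exists phi : 'rV[C]_n -> C, [/\
    forall s, nrm (s - c) < r -> differentiable phi s,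
    forall s, nrm (s - c) < r -> [/\ phi s != boundary_coord s,
      normc (phi s - boundary_coord s) <= B / ln p%:R,
      others p s != 0 &
      natpow p (1 - phi s) = 1 + (p%:R - 1) / others p s] &
    forall s s', (forall j, j != i -> s ord0 j = s' ord0 j) -> phi s = phi s'].
Proof.
have [e e0 [gi gj]] := gap.
have [N hN] := npw_small e0 (e := 2^-1 / 2 ^+ n.+1) ltac:(by rewrite divr_gt0 ?exprn_gt0 ?invr_gt0).
exists (e / n.+1%:R), (2 * (n.+2%:R * (1 + pi / 2)) + 1 + pi *+ 2), (maxn N.+1 3).
split; first by rewrite divr_gt0 ?ltr0n.
move=> p pp; rewrite geq_max => /andP[pN p3].
apply: (graph_at_prime e0 gi gj p3).
have := hN p.-1; rewrite -ltnS prednK ?(ltnW (ltnW p3)) // => /(_ pN).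
by rewrite ltr_pdivlMr ?exprn_gt0 // mulrC.
Qed.


End ZeroGraph.

(** * Zeros inside the domain *)

Section GraphInRegion.
Context {R : realType} {n : nat}.
Local Notation C := R[i].
Implicit Types (s : 'rV[C]_n) (p : nat).
Local Notation y p s j := (natpow p (1 - s ord0 j)).

Definition upd (i : 'I_n) s (x : C) : 'rV[C]_n := s + (x - s ord0 i) *: delta_mx ord0 i.

Lemma updE i s x j : upd i s x ord0 j = if j == i then x else s ord0 j.
Proof.
rewrite !mxE eqxx /=; case: eqVneq => [->|_]; last by rewrite mulr0 addr0.
by rewrite mulr1 addrC subrK.
Qed.

Lemma upd_id i s : upd i s (s ord0 i) = s.
Proof. by rewrite /upd subrr scale0r addr0. Qed.

Lemma upd_near i s c x (r : R) : nrm (s - c) < r -> normc (x - c ord0 i) < r ->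
  nrm (upd i s x - c) < r.
Proof.
move=> sr xr; have r0 : 0 < r := le_lt_trans (nrm_ge0 _) sr.
apply/(nrm_rowP _ r0) => j; rewrite mxE updE mxE; case: eqVneq => [->//|_].
by have := (nrm_rowP _ r0).1 sr j; rewrite !mxE.
Qed.

Lemma upd_differentiable i (phi : 'rV[C]_n -> C) s : differentiable phi s ->
  differentiable (fun s => upd i s (phi s)) s.
Proof.
move=> phid.
have hd : differentiable (fun s => phi s - s ord0 i) s.
  by apply: hol_sub; [exact: phid|exact: coord_differentiable].
apply: differentiableD; first exact: ex_diff.
exact: (@differentiableZl _ _ _ (fun s => phi s - s ord0 i) (delta_mx ord0 i) s hd).
Qed.

Lemma upd_comp_differentiable i (f phi : 'rV[C]_n -> C) s : differentiable phi s ->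
  differentiable f (upd i s (phi s)) -> differentiable (fun s => f (upd i s (phi s))) s.
Proof.
move=> phid fd.
have gd : differentiable (fun s => upd i s (phi s)) s by exact: upd_differentiable.
exact: (differentiable_comp gd fd).
Qed.

Lemma upd1_differentiable i (f : 'rV[C]_n -> C) s x :
  differentiable f (upd i s x) -> differentiable (fun x => f (upd i s x)) x.
Proof.
move=> fd; have hd : differentiable (fun x : C => x - s ord0 i) x.
  by apply: hol_sub; [exact: hol_id|exact: hol_cst].
have gd : differentiable (fun x => upd i s x) x.
  apply: differentiableD; first exact: differentiable_cst.
  exact: (@differentiableZl _ _ _ (fun x => x - s ord0 i) (delta_mx ord0 i) x hd).
exact: (differentiable_comp gd fd).
Qed.

Lemma prod_upd i s x p : \prod_j (1 - y p (upd i s x) j) = (1 - natpow p (1 - x)) * others i p s.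
Proof.
rewrite (bigD1 i) //= updE eqxx; congr (_ * _).
by apply: eq_bigr => j ji; rewrite updE (negbTE ji).
Qed.

Lemma hfac_graph i s x p : prime p -> others i p s != 0 ->
  natpow p (1 - x) = 1 + (p%:R - 1) / others i p s -> hfac p (upd i s x) = 0.
Proof.
move=> pp W0 E; have p0 : (p%:R : C) != 0 by rewrite pnatr_eq0 -lt0n prime_gt0.
by rewrite /hfac prod_upd E; field; rewrite p0 W0.
Qed.

(** The phase of $y_j$ makes a full turn when $s_j$ moves by $2 i \pi / \log p$. *)
Lemma negative_point (c : 'rV[C]_n) p : (1 < p)%N -> exists s,
  (forall j, y p s j = - ((npw p (tau c j))%:C)%C) /\
  forall j, normc (s ord0 j - c ord0 j) <= pi *+ 2 / ln p%:R.
Proof.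
move=> p1; have l0 : 0 < ln (p%:R : R) by rewrite ln_nat_gt0.
have h j := angle_in (pi - complex.Im (1 - c ord0 j) * ln (p%:R : R)) 0.
have [th hth] := choice h.
pose l : C := ((ln p%:R)%:C)%C; have nl : normc l = ln p%:R by rewrite normcR gtr0_norm.
have ln0 : l != 0 by rewrite -normc_gt0 nl.
exists (\row_j (c ord0 j - (0 +i* th j)%C / l)); split=> j; rewrite mxE; last first.
  rewrite addrC addrA addNr sub0r normcN normcM normcV nl ler_pM2r ?invr_gt0 //.
  have [/andP[t0 t1] _] := hth j; apply: le_trans (normc_le _) _.
  by rewrite /= normr0 add0r ger0_norm // -[leRHS]add0r.
have -> : 1 - (c ord0 j - (0 +i* th j)%C / l) = (1 - c ord0 j) + (0 +i* th j)%C / l by ring.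
rewrite natpowD {2}/natpow -/l [l * _]mulrC divfK //.
have [_ ->] := hth j; rewrite /natpow -cexpD.
have -> : ((ln p%:R)%:C)%C * (1 - c ord0 j) +
    (0 +i* (pi - complex.Im (1 - c ord0 j) * ln p%:R))%C =
    ((tau c j * ln p%:R)%:C)%C + (0 +i* pi)%C :> C.
  apply: complex_eq; rewrite ?Re_add ?Im_add ?Re_mul ?Im_mul /= ?Re_opp ?Im_opp.
    by rewrite /tau Re_add Re_opp /=; ring.
  by rewrite Im_add Im_opp /=; ring.
rewrite cexpD cexpR.
have -> : cexp (0 +i* pi)%C = -1 :> C.
  by rewrite /cexp /= expR0 mul1r cospi sinpi; apply: complex_eq; rewrite ?Re_opp ?Im_opp //= oppr0.
by rewrite mulrN1.
Qed.

Lemma prod_ge1 (I : Type) (r : seq I) (P : pred I) (F : I -> R) :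
  (forall j, P j -> 1 <= F j) -> 1 <= \prod_(j <- r | P j) F j.
Proof.
by move=> F1; apply: (big_ind (fun x => 1 <= x)) => // x x'; exact: mulr_ege1.
Qed.

Lemma ltr_npw p (x x' : R) : npw p x < npw p x' -> x < x'.
Proof. by move=> h; rewrite ltNge; apply/negP => /(ler_npw p); rewrite leNgt h. Qed.

Variables (c : 'rV[C]_n) (i : 'I_n).
Hypothesis tau_neq0 : forall j, j != i -> tau c j != 0.
Hypothesis tau_i : 0 < tau c i.
Hypothesis tau_sum : tau c i + \sum_(j | (j != i) && (0 < tau c j)) tau c j = 1.

(** At points with negative $y_j$ ($j \ne i$), the zero of the local factor lies
    in the domain: the inequality
    $|y_i| \prod_{J} |y_j| < p$ to be shown follows from
    $\prod_{j \ne i} |1 - y_j| \ge (1 + x) \prod_J |y_j|$, for [x] as below. *)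
Lemma negative_point_load (j0 : 'I_n) p s w : (1 < p)%N -> j0 != i ->
  (0 < tau c j0 -> npw p (tau c j0 - tau c i) <= 2^-1) ->
  (tau c j0 < 0 -> tau c i = 1) ->
  (forall j, y p s j = - ((npw p (tau c j))%:C)%C) ->
  natpow p (1 - w) = 1 + (p%:R - 1) / others i p s ->
  load (upd i s w) < 1.
Proof.
move=> p1 j0i hpos hneg sy wE.
have tauE j : tau s j = tau c j.
  have := congr1 (@normc R) (sy j); rewrite normcN normcR ger0_norm ?npw_ge0 //.
  rewrite normc_natpow Re_add Re_opp /npw => /expR_inj/mulIf; apply.
  by rewrite gt_eqF // ln_nat_gt0.
pose Y j := npw p (tau c j).
pose W := \prod_(j | j != i) (1 + Y j).
have Y0 j : 0 < Y j by exact: npw_gt0.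
have W1 : 1 <= W by apply: prod_ge1 => j _; rewrite lerDl ltW.
have W0 : 0 < W := lt_le_trans ltr01 W1.
have WE : others i p s = (W%:C)%C.
  rewrite /others /W rmorph_prod; apply: eq_bigr => j _.
  by rewrite sy opprK rmorphD rmorph1.
have p1R : 0 < p%:R - 1 :> R by rewrite subr_gt0 ltr1n.
have yi : npw p (1 - complex.Re w) = 1 + (p%:R - 1) / W.
  have := congr1 (@normc R) wE; rewrite normc_natpow Re_add Re_opp => ->.
  have -> : 1 + (p%:R - 1) / others i p s = ((1 + (p%:R - 1) / W)%:C)%C.
    by rewrite WE rmorphD rmorph1 rmorphM rmorphB rmorph1 rmorph_nat fmorphV.
  by rewrite normcR gtr0_norm // addr_gt0 // divr_gt0.
have ti0 : 0 < 1 - complex.Re w.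
  by apply: (@ltr_npw p); rewrite npw0 yi ltrDl divr_gt0.
have -> : load (upd i s w) =
    (1 - complex.Re w) + \sum_(j | (j != i) && (0 < tau c j)) tau c j.
  rewrite /load (bigD1 i) //= /tau updE eqxx; congr (_ + _); first exact/max_idPr/ltW.
  rewrite big_mkcondr; apply: eq_bigr => j ji; rewrite updE (negbTE ji) -/(tau s j) tauE.
  by rewrite /Num.max.
rewrite -[ltRHS]tau_sum ltrD2r; apply: (@ltr_npw p); rewrite yi.
pose Q := npw p (tau c i); pose x := if 0 < tau c j0 then (Y j0)^-1 else Y j0.
pose T := \prod_(j | j != i) (if 0 < tau c j then Y j else 1).
have TE : T * Q = p%:R.
  rewrite /T -big_mkcondr /=.
  have -> : \prod_(j | (j != i) && (0 < tau c j)) Y j =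
      npw p (\sum_(j | (j != i) && (0 < tau c j)) tau c j).
    by rewrite /Y /npw mulr_suml expR_sum.
  by rewrite -npwD addrC tau_sum npw1 // ltnW.
have Q0 : 0 < Q by exact: npw_gt0.
have x0 : 0 < x by rewrite /x; case: ifP => _; rewrite ?invr_gt0.
have WT : T * (1 + x) <= W.
  rewrite /T /W (bigD1 j0) //= [leRHS](bigD1 j0) //= mulrAC.
  have -> : (if 0 < tau c j0 then Y j0 else 1) * (1 + x) = 1 + Y j0.
    rewrite /x; case: ifP => _; last by rewrite mul1r.
    by rewrite mulrDr mulr1 divff ?gt_eqF // addrC.
  rewrite ler_pM2l ?addr_gt0 //; apply: ler_prod => j _.
  by case: ifP => _; rewrite ?(ltW (Y0 j)) ?ler01 /= ?lerDr ?lerDl ?ler01 ?(ltW (Y0 j)).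
have Q1 : 1 < Q by rewrite /Q /npw -[ltLHS]expR0 ltr_expR mulr_gt0 // ln_nat_gt0.
rewrite -ltrBrDl ltr_pdivrMr //; apply: (@lt_le_trans _ _ ((Q - 1) * (T * (1 + x)))); last first.
  by rewrite ler_pM2l // subr_gt0.
have -> : (Q - 1) * (T * (1 + x)) = (p%:R - T) * (1 + x) by rewrite -TE; ring.
have [tj|tj] := ltP 0 (tau c j0); last first.
  have tj' : tau c j0 < 0 by rewrite lt_neqAle tau_neq0.
  have T1 : T = 1.
    apply: (mulIf (lt0r_neq0 Q0)); rewrite TE mul1r /Q hneg // npw1 // ltnW //.
  by rewrite T1 ltr_pMr // ltrDl.
have hq : 2 * T <= p%:R * x.
  rewrite /x tj -TE -mulrA mulrC ler_pM2l; last first.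
    by apply: prodr_gt0 => j _; case: ifP => _.
  have := hpos tj; rewrite npwD npwN -/(Y j0) -/Q ler_pdivrMr // => h.
  by rewrite ler_pdivlMr //; move: h; lra.
have T0 : 1 <= T.
  by apply: prod_ge1 => j _; case: ifP => // tj'; rewrite -[leLHS](npw0 p) ler_npw // ltW.
have x1 : x <= 1.
  by rewrite /x tj invf_le1 // -[leLHS](npw0 p) ler_npw // ltW.
have : T * x <= T by rewrite ler_piMr // (le_trans ler01).
by rewrite mulrDr mulr1 [(_ - _) * x]mulrBl; lra.
Qed.

End GraphInRegion.

(** * Poles and zeros *)

Section DenominatorsOnGraph.
Context {R : realType}.
Local Notation C := R[i].

(** By induction on the factors: if the first does not vanish identically, the
    open set can be shrunk to one where it has no zero, and there the product of
    the others vanishes. *)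
Lemma prod_zero_open (V : normedModType C) (I : eqType) (r : seq I) (f : I -> V -> C) (S : set V) :
  open S -> S !=set0 -> (forall x, x \in r -> forall s, S s -> differentiable (f x) s) ->
  (forall s, S s -> \prod_(x <- r) f x s = 0) ->
  exists2 x, x \in r & exists S', [/\ open S', S' !=set0, S' `<=` S & forall s, S' s -> f x s = 0].
Proof.
elim: r S => [|x r ih] S oS S0 fd h.
  by have [s Ss] := S0; have := h s Ss; rewrite big_nil => /eqP; rewrite oner_eq0.
have [fx0|] := pselect (forall s, S s -> f x s = 0).
  by exists x; [rewrite inE eqxx|exists S; split].
move=> /existsNP[s /not_implyP[Ss /eqP fs0]].
have fsx := fd x ltac:(by rewrite inE eqxx) s Ss.
have e0 : 0 < normc (f x s) by rewrite normc_gt0.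
have [d d0 hd] := differentiable_cont fsx e0.
have [e e1 he] : exists2 e : R, 0 < e & forall q, nrm (q - s) < e -> S q.
  by apply/nbhs_nrmP; apply: open_nbhs_nbhs.
have d1 : 0 < Num.min d e by rewrite lt_min d0.
have [||||z zr [S' [q1 q2 q3 q4]]] := ih [set q | nrm (q - s) < Num.min d e].
- rewrite (_ : [set q | _] = ball s ((Num.min d e)%:C)%C); first exact: ball_open.
  by apply/seteqP; split=> q /ball_nrm.
- by exists s; rewrite /= subrr nrm0.
- by move=> z zr q; rewrite /= lt_min => /andP[_ /he]; apply: fd; rewrite inE zr orbT.
- move=> q; rewrite /= lt_min => /andP[/hd q1 /he q2].
  have := h q q2; rewrite big_cons => /eqP; rewrite mulf_eq0 => /orP[/eqP q3|/eqP //].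
  by move: q1; rewrite q3 sub0r normcN ltxx.
exists z; first by rewrite inE zr orbT.
exists S'; split=> // q /q3 /=; by rewrite lt_min => /andP[_ /he].
Qed.

Lemma nrm_ball_open (V : normedModType C) (s : V) (r : R) : 0 < r ->
  open [set q | nrm (q - s) < r].
Proof.
move=> r0; rewrite (_ : [set q | _] = ball s ((r%:C)%C)); first by apply: ball_open; rewrite ltcR.
by apply/seteqP; split=> q /ball_nrm.
Qed.

Lemma isolated_zeros (d : C -> C) (w0 : C) :
  (forall w, -1 < complex.Re w -> differentiable d w) -> d 2%:R != 0 ->
  -1 < complex.Re w0 -> exists2 e : R, 0 < e &
    forall w, w != w0 -> normc (w - w0) < e -> d w != 0.
Proof.
move=> dd d2 w01; pose e := complex.Re w0 + 1.
have e0 : 0 < e by rewrite /e; lra.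
have inH w : normc (w - w0) < e -> -1 < complex.Re w.
  move=> /(le_lt_trans (normc_Re _)); rewrite Re_add Re_opp ltr_norml /e => /andP[]; lra.
have [//|/forallPNP h] := pselect (exists2 e : R, 0 < e & forall w, w != w0 -> normc (w - w0) < e -> d w != 0).
have [||rho rho0 hr] := @zeros_cluster R d w0 e e0.
- by move=> t /inH/dd/differentiable_cder.
- move=> r r0; have := h r r0 => /existsNP[w /not_implyP[w1 /not_implyP[w2 /negP]]].
  by rewrite negbK => /eqP w3; exists w.
suff : d 2%:R = 0 by move/eqP; rewrite (negbTE d2).
have m0 : 0 < Num.min rho e by rewrite lt_min rho0.
apply: (@identity_theorem R C d [set w : C | -1 < complex.Re w]
  [set w | nrm (w - w0) < Num.min rho e]).
- rewrite openE => w hw; apply/nbhs_nrmP; exists (complex.Re w + 1).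
    by move: hw => /=; lra.
  move=> q; rewrite nrm_normc => /(le_lt_trans (normc_Re _)).
  by rewrite Re_add Re_opp ltr_norml /= => /andP[]; lra.
- move=> x y /= x1 y1 t /andP[t0 t1].
  rewrite Re_add /GRing.scale /= Re_mul Re_add Re_opp /= mul0r subr0.
  have : 0 <= t * (complex.Re y + 1) by rewrite mulr_ge0 //; lra.
  have e1 : complex.Re x + t * (complex.Re y - complex.Re x) + 1 =
    (1 - t) * (complex.Re x + 1) + t * (complex.Re y + 1) by ring.
  have [t2|t2] := ltP t 1.
    have : 0 < (1 - t) * (complex.Re x + 1) by rewrite mulr_gt0 //; lra.
    by move: e1; set u := complex.Re x + _; set v := _ * _; set v' := _ * _; lra.
  have -> : t = 1 by apply/eqP; rewrite eq_le t1.
  by move: y1; lra.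
- by move=> z; exact: dd.
- exact: nrm_ball_open.
- by exists w0; rewrite /= subrr nrm0.
- by move=> w /=; rewrite nrm_normc lt_min => /andP[_ /inH].
- by move=> w /=; rewrite nrm_normc lt_min => /andP[/hr].
- suff h2 : -1 < complex.Re (2%:R : C) by [].
  by rewrite Re_nat; lra.
Qed.

(** The zeros of [d] are isolated, and a continuous function with values in a
    discrete set is locally constant. *)
Lemma locally_constant_zero (V : normedModType C) (d : C -> C) (psi : V -> C) (S : set V) :
  (forall w, -1 < complex.Re w -> differentiable d w) -> d 2%:R != 0 ->
  open S -> S !=set0 -> (forall s, S s -> differentiable psi s) ->
  (forall s, S s -> -1 < complex.Re (psi s)) -> (forall s, S s -> d (psi s) = 0) ->
  exists s0 (r : R), [/\ S s0, 0 < r & forall s, nrm (s - s0) < r -> S s /\ psi s = psi s0].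
Proof.
move=> dd d2 oS [s0 Ss0] pd p1 dp.
have [e e0 he] := isolated_zeros dd d2 (p1 _ Ss0).
have [r r0 hr] := differentiable_cont (pd _ Ss0) e0.
have [e' e1 he'] : exists2 e : R, 0 < e & forall q, nrm (q - s0) < e -> S q.
  by apply/nbhs_nrmP; apply: open_nbhs_nbhs.
exists s0, (Num.min r e'); split=> //; first by rewrite lt_min r0.
move=> s; rewrite lt_min => /andP[/hr l1 /he' Ss]; split=> //.
apply/eqP/negPn/negP => ne; have := he _ ne l1.
by rewrite dp // eqxx.
Qed.

Context {n : nat}.
Local Notation y p s j := (natpow p (1 - (s : 'rV[C]_n) ord0 j)).

Lemma natpow_ell p (m : @mono n) (u : 'rV[C]_n) :
  natpow p (- ell m u) = natpow p (- (mdeg m)%:R) * \prod_j y p u j ^+ m.2 j.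
Proof.
rewrite /ell opprB addrC natpowD natpow_sum; congr (_ * _).
by apply: eq_bigr => j _; rewrite natpowMn.
Qed.

(** A linear form $\ell$ is not constant on the graph of zeros: otherwise
    $(1 - y + e)^a y^b = \kappa (1 - y)^a$, with $e = (p - 1) / \prod_{k \ne i, j} (1 - y_k)$
    and $a$, $b$ the exponents of $y_i$, $y_j$ in the monomial, for $y = y_j$ varying in
    an open set, hence for all $y \ne 0$. This is absurd at $y = 1$ if $a \ne 0$; if
    $a = 0$, the values $y = 1$ and $y = p$ give $1 = \kappa = p^b$. *)
Lemma ell_graph_nonconstant p (i : 'I_n) (m : @mono n) (phi : 'rV[C]_n -> C) s0 (r : R) :
  (1 < n)%N -> prime p -> 0 < r -> (exists j, m.2 j != 0%N) ->
  (forall s, nrm (s - s0) < r -> others i p s != 0 /\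
     natpow p (1 - phi s) = 1 + (p%:R - 1) / others i p s) ->
  ~ forall s, nrm (s - s0) < r -> ell m (upd i s (phi s)) = ell m (upd i s0 (phi s0)).
Proof.
move=> n1 pp r0 [j0 mj0] hphi hconst.
have p1 : (p%:R : C) - 1 != 0.
  by rewrite -(natrB _ (prime_gt0 pp)) pnatr_eq0 subn_eq0 -ltnNge prime_gt1.
have [j ji jm] : exists2 j : 'I_n, j != i & (m.2 i == 0%N -> m.2 j != 0%N).
  have [mi|mi] := boolP (m.2 i == 0%N).
    exists j0 => //; apply: contraNneq mj0 => ->; exact: mi.
  have [k ki] : exists k : 'I_n, k != i.
    have [E|E] := eqVneq i (Ordinal (ltnW n1)).
      by exists (Ordinal n1); rewrite E.
    by exists (Ordinal (ltnW n1)); rewrite eq_sym.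
  by exists k.
pose a := m.2 i; pose b := m.2 j.
pose c0 := \prod_(k | (k != i) && (k != j)) (1 - y p s0 k).
have s0r : nrm (s0 - s0) < r by rewrite subrr nrm0.
have c00 : c0 != 0.
  have [+ _] := hphi _ s0r; rewrite /others (bigD1 j) //=; apply: contraNneq => c0E.
  by rewrite [X in _ * X](_ : _ = c0) // c0E mulr0.
pose line (t : C) : 'rV[C]_n := s0 + t *: delta_mx ord0 j.
have lineE t k : line t ord0 k = s0 ord0 k + (if k == j then t else 0).
  by rewrite !mxE eqxx /=; case: eqVneq; rewrite ?mulr1 ?mulr0.
have line_near t : normc t < r -> nrm (line t - s0) < r.
  move=> tr; apply/(nrm_rowP _ r0) => k.
  rewrite mxE lineE [X in _ + X]mxE addrC addrA addNr add0r.
  by case: ifP => _; rewrite ?normc0.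
pose yt (t : C) := natpow p (1 - (s0 ord0 j + t)).
have othersE t : others i p (line t) = c0 * (1 - yt t).
  rewrite /others (bigD1 j) //= mulrC lineE eqxx; congr (_ * _).
  by apply: eq_bigr => k /andP[_ kj]; rewrite lineE (negbTE kj) addr0.
pose q := \prod_(k | (k != i) && (k != j)) y p s0 k ^+ m.2 k.
have q0 : q != 0 by apply/prodf_neq0 => k _; rewrite expf_neq0 // natpow_neq0.
pose kap := natpow p (- ell m (upd i s0 (phi s0))) / (natpow p (- (mdeg m)%:R) * q).
pose F (t : C) := (c0 * (1 - yt t) + (p%:R - 1)) ^+ a * yt t ^+ b - kap * (c0 * (1 - yt t)) ^+ a.
have F0 t : normc t < r -> F t = 0.
  move=> tr; have [W0 E] := hphi _ (line_near t tr).
  have := congr1 (fun z => natpow p (- z)) (hconst _ (line_near t tr)).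
  rewrite {1}natpow_ell (bigD1 i) //= (bigD1 j) //= !updE eqxx (negbTE ji) lineE eqxx.
  have -> : \prod_(k | (k != i) && (k != j)) y p (upd i (line t) (phi (line t))) k ^+ m.2 k = q.
    apply: eq_bigr => k /andP[ki kj]; by rewrite updE (negbTE ki) lineE (negbTE kj) addr0.
  rewrite E -/(yt t) -/a -/b => hk.
  have g0 : natpow p (- (mdeg m)%:R) != 0 :> C by exact: natpow_neq0.
  have kE : kap = (1 + (p%:R - 1) / others i p (line t)) ^+ a * yt t ^+ b.
    by rewrite /kap -hk; field; rewrite g0 q0.
  rewrite /F kE mulrAC -exprMn -othersE mulrDl mul1r divfK //.
  by rewrite subrr.
have Fd t : differentiable F t.
  have yd : differentiable yt t.
    apply: natpow_differentiable; apply: hol_sub; first exact: hol_cst.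
    by apply: hol_add; [exact: hol_cst|exact: hol_id].
  have cd : differentiable (fun t => c0 * (1 - yt t)) t.
    apply: hol_mul; first exact: hol_cst.
    by apply: hol_sub; [exact: hol_cst|exact: yd].
  have pd (f : C -> C) k : differentiable f t -> differentiable (fun t => f t ^+ k) t.
    move=> fd; elim: k => [|k ih]; first by under eq_fun do rewrite expr0; exact: hol_cst.
    by under eq_fun do rewrite exprS; exact: hol_mul.
  have h1 := pd _ a (hol_add cd (hol_cst (p%:R - 1) t)).
  exact: (hol_sub (hol_mul h1 (pd _ b yd)) (hol_mul (hol_cst kap t) (pd _ a cd))).
have Fz t : F t = 0.
  apply: (@identity_theorem R C F setT [set w | nrm (w - 0) < r]) => //.
  - exact: openT.
  - exact: nrm_ball_open.
  - by exists 0; rewrite /= subrr nrm0.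
  - by move=> w /=; rewrite nrm_normc subr0; exact: F0.
have y1 : yt (1 - s0 ord0 j) = 1.
  by rewrite /yt [s0 ord0 j + _]addrC subrK subrr natpow0.
have := Fz (1 - s0 ord0 j); rewrite /F y1 subrr mulr0 add0r expr1n mulr1.
have [a0|a0] := eqVneq a 0%N; last first.
  by rewrite expr0n (negbTE a0) mulr0 subr0 => /eqP; rewrite expf_eq0 (negbTE p1) andbF.
rewrite a0 !expr0 mulr1 => /eqP; rewrite subr_eq0 => /eqP k1.
have yp : yt (- s0 ord0 j) = p%:R.
  by rewrite /yt addrN subr0 natpow1 // prime_gt0.
have := Fz (- s0 ord0 j); rewrite /F yp a0 !expr0 mul1r mulr1 -k1 => /eqP.
rewrite subr_eq0 -natrX pnatr_eq1 => /eqP E.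
have : (1 ^ b < p ^ b)%N by rewrite ltn_exp2r ?prime_gt1 // lt0n jm // -/a a0.
by rewrite exp1n E.
Qed.

(** Hence the denominators of the continuation do not vanish identically on the
    graph of zeros. *)
Lemma denom_graph_neq0 K p (i : 'I_n) (phi : 'rV[C]_n -> C) (S : set 'rV[C]_n) :
  (1 < n)%N -> prime p -> open S -> S !=set0 ->
  (forall s, S s -> [/\ differentiable phi s, others i p s != 0,
     natpow p (1 - phi s) = 1 + (p%:R - 1) / others i p s & region K (upd i s (phi s))]) ->
  exists2 s, S s & denom K (upd i s (phi s)) != 0.
Proof.
move=> n1 pp oS S0 hS.
have [//|h] := pselect (exists2 s, S s & denom K (upd i s (phi s)) != 0); exfalso.
have z s : S s -> denom K (upd i s (phi s)) = 0.
  by move=> Ss; apply/eqP/negPn/negP => ne; apply: h; exists s.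
have [] := @prod_zero_open _ _ (poles K) (fun m s => den m (upd i s (phi s))) S oS S0 _ z.
  move=> m mK s /hS[pd _ _ rK]; apply: upd_comp_differentiable pd _.
  by apply: den_differentiable; [exact: region_load rK|exact: poles_admissible mK].
move=> m mK [S1 [open1 n01 s1 z1]].
have am := poles_admissible mK.
have psid s : S1 s -> differentiable (fun s => ell m (upd i s (phi s))) s.
  by move=> /s1/hS[pd _ _ _]; apply: upd_comp_differentiable pd _; exact: ell_differentiable.
have psi1 s : S1 s -> -1 < complex.Re (ell m (upd i s (phi s))).
  by move=> /s1/hS[_ _ _ /region_load l]; have [] := Re_ell_admissible l am.
have key (d : C -> C) S2 : open S2 -> S2 !=set0 -> S2 `<=` S1 ->
    (forall w, -1 < complex.Re w -> differentiable d w) -> d 2%:R != 0 ->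
    (forall s, S2 s -> d (ell m (upd i s (phi s))) = 0) -> False.
  move=> o2 n2 s2 dd d2 dz.
  have [s0 [r [Ss0 r0 hr]]] := locally_constant_zero dd d2 o2 n2
    (fun s h => psid s (s2 s h)) (fun s h => psi1 s (s2 s h)) dz.
  have hp s : nrm (s - s0) < r -> others i p s != 0 /\
      natpow p (1 - phi s) = 1 + (p%:R - 1) / others i p s.
    by move=> /hr[/s2/s1/hS[]].
  have hq s (h : nrm (s - s0) < r) := proj2 (hr s h).
  exact: (ell_graph_nonconstant n1 pp r0 (admissible_exp am) hp hq).
have affd (k : C) w : differentiable (fun w : C => k * w - 1) w.
  apply: hol_sub; last exact: hol_cst.
  by apply: hol_mul; [exact: hol_cst|exact: hol_id].
move: z1; rewrite /den; case: m.1.1 => z1; last first.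
  apply: (key (fun w => 1 * w - 1) S1) => //.
  by move=> s /z1; rewrite mul1r.
have [] := @prod_zero_open _ _ [:: true; false]
  (fun (t : bool) s => if t then 2 * ell m (upd i s (phi s)) - 1 else xi (ell m (upd i s (phi s))))
  S1 open1 n01.
- move=> [] _ s Ss.
    by apply: hol_sub; [apply: hol_mul; [exact: hol_cst|exact: psid]|exact: hol_cst].
  by apply: (hol_comp (psid s Ss)); apply: xi_differentiable; exact: psi1.
- by move=> s /z1; rewrite !big_cons big_nil mulr1.
move=> [] _ [S2 [open2 n2 s2 z2]].
  apply: (key (fun w => 2 * w - 1) S2) => //.
have x2 : xi (2%:R : C) != 0 by apply: xi_neq0; rewrite Re_nat; lra.
exact: (key (@xi R) S2 open2 n2 s2 (@xi_differentiable R) x2 z2).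
Qed.

End DenominatorsOnGraph.

(** * The natural boundary *)

Section NaturalBoundary.
Context {R : realType} {n : nat}.
Local Notation C := R[i].
Local Notation V := 'rV[C]_n.
Implicit Types (s : V) (p : nat).

Lemma nrm_ball_convex (W : normedModType C) (s : W) (r : R) :
  segment_convex [set q | nrm (q - s) < r].
Proof.
move=> x y /= xr yr t /andP[t0 t1].
have r0 : 0 < r := le_lt_trans (nrm_ge0 _) xr.
have -> : x + ((t%:C)%C : C) *: (y - x) - s =
    (((1 - t)%:C)%C : C) *: (x - s) + ((t%:C)%C : C) *: (y - s).
  have -> : y - x = (y - s) - (x - s) by rewrite opprB addrA subrK.
  rewrite addrAC scalerBr rmorphB rmorph1 scalerBl scale1r /=.
  by rewrite addrA addrAC.
apply: le_lt_trans (ler_nrmD _ _) _; rewrite !nrmZ !normcR !ger0_norm ?subr_ge0 //.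
have h2 : 0 <= t * (r - nrm (y - s)) by rewrite mulr_ge0 // subr_ge0 ltW.
have e1 : r - ((1 - t) * nrm (x - s) + t * nrm (y - s)) =
  (1 - t) * (r - nrm (x - s)) + t * (r - nrm (y - s)) by ring.
rewrite -subr_gt0 e1; have [t2|t2] := ltP t 1.
  by rewrite ltr_wpDr // mulr_gt0 // subr_gt0.
have -> : t = 1 by apply/eqP; rewrite eq_le t1.
by rewrite subrr mul0r add0r mul1r subr_gt0.
Qed.

Lemma inv_ln_small (A e : R) : 0 < e -> exists P1 : nat, forall p, (P1 <= p)%N -> A / ln p%:R < e.
Proof.
move=> e0; pose X := expR (`|A| / e); exists (Num.truncn X).+1 => p pP.
have pX : X < p%:R by apply: lt_le_trans (truncnS_gt X) _; rewrite ler_nat.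
have X0 : 0 < X by exact: expR_gt0.
have lp : `|A| / e < ln p%:R.
  by rewrite -(expRK (`|A| / e)) ltr_ln // posrE (lt_trans X0).
have l0 : 0 < ln (p%:R : R) by apply: le_lt_trans lp; rewrite divr_ge0 // ltW.
rewrite ltr_pdivrMr // (le_lt_trans (ler_norm A)) //.
by move: lp; rewrite ltr_pdivrMr // mulrC.
Qed.

(** The description of the zeros near a boundary point requires $\tau_j \ne 0$ for
    $j \ne i$, and [negative_point_load] an index $j_0$ with $\tau_{j_0} < \tau_i$.
    For $i$ maximizing $\tau_i$, a small displacement of the point along the
    boundary achieves both. *)
Lemma generic_boundary_point s1 (r : R) : (1 < n)%N -> load s1 = 1 -> 0 < r ->
  exists (c : V) (i j0 : 'I_n), [/\ nrm (c - s1) < r,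
    forall j, j != i -> tau c j != 0, 0 < tau c i,
    tau c i + \sum_(j | (j != i) && (0 < tau c j)) tau c j = 1 &
    [/\ j0 != i, 0 < tau c j0 -> tau c j0 < tau c i & tau c j0 < 0 -> tau c i = 1]].
Proof.
move=> n1 l1 r0.
have [i hi] : exists i : 'I_n, forall j, tau s1 j <= tau s1 i.
  by case: (@Order.TotalTheory.arg_maxP _ _ _ (Ordinal n1) xpredT (tau s1) isT) => i _ hi; exists i => j; exact: hi.
have ti : 0 < tau s1 i.
  rewrite ltNge; apply/negP => ti; move: l1; rewrite /load big1 => [/esym/eqP|j _].
    by rewrite oner_eq0.
  by apply/max_idPl; exact: le_trans (hi j) ti.
pose J := [pred j | (j != i) && (0 < tau s1 j)].
(* each nonnegative tau_j is lowered by dl, and tau_i compensates for those that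
     stay positive *)
pose dl := Num.min (r / n.+2%:R) (\big[Num.min/1]_(j in J) tau s1 j / 2).
have m0 : 0 < \big[Num.min/(1:R)]_(j in J) tau s1 j.
  by apply: (big_ind (fun x => 0 < x)) => // [x x' h h'|j /andP[_ ->]] //; rewrite lt_min h.
have d0 : 0 < dl by rewrite lt_min !divr_gt0 ?ltr0n.
have dJ j : J j -> dl < tau s1 j.
  move=> jJ; have : \big[Num.min/(1:R)]_(j in J) tau s1 j <= tau s1 j by exact: bigmin_le_cond.
  have : dl <= \big[Num.min/1]_(j in J) tau s1 j / 2 by rewrite /dl ge_min lexx orbT.
  by move: m0; lra.
pose e j : R := if j == i then - (dl *+ #|J|) else if 0 <= tau s1 j then dl else 0.
pose c : V := \row_j (s1 ord0 j + ((e j)%:C)%C).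
have tc j : tau c j = tau s1 j - e j by rewrite /tau mxE Re_add /= opprD addrA.
have tci : tau c i = tau s1 i + dl *+ #|J| by rewrite tc /e eqxx opprK.
have tcj j : j != i -> tau c j = if 0 <= tau s1 j then tau s1 j - dl else tau s1 j.
  by move=> ji; rewrite tc /e (negbTE ji); case: ifP; rewrite ?subr0.
have tcJ j : j != i -> (0 < tau c j) = (0 < tau s1 j).
  move=> ji; have [tj|tj] := ltP 0 (tau s1 j).
    by rewrite tcj // (ltW tj) subr_gt0 dJ //= ji.
  by apply/negbTE; rewrite -leNgt tcj //; case: ifP => _; lra.
have tnz j : j != i -> tau c j != 0.
  move=> ji; have [tj|tj] := ltP 0 (tau s1 j); first by rewrite gt_eqF // tcJ.
  by rewrite tcj //; case: (leP 0 (tau s1 j)) => tj'; rewrite lt_eqF //; lra.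
have ti' : 0 < tau c i by rewrite tci ltr_wpDr // mulrn_wge0 // ltW.
have sumE : tau c i + \sum_(j | (j != i) && (0 < tau c j)) tau c j = 1.
  have -> : \sum_(j | (j != i) && (0 < tau c j)) tau c j = \sum_(j in J) (tau s1 j - dl).
    rewrite (eq_bigl (mem J)); last first.
      by move=> j; rewrite !inE; case: (boolP (j != i)) => //= /tcJ ->.
    by apply: eq_bigr => j /andP[ji tj]; rewrite tcj // ltW.
  rewrite sumrB sumr_const tci -l1 addrACA subrr addr0.
  rewrite /load [RHS](bigD1 i) //=; congr (_ + _); first by rewrite (max_idPr _) // ltW.
  rewrite (eq_bigl (fun j => (j != i) && (0 < tau s1 j))) // big_mkcondr; apply: eq_bigr => j _; by rewrite /Num.max.
have nc : nrm (c - s1) < r.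
  apply/(nrm_rowP _ r0) => j; rewrite !mxE addrAC subrr add0r normcR.
  have en : dl * n.+1%:R < r.
    have : dl <= r / n.+2%:R by rewrite /dl ge_min lexx.
    rewrite ler_pdivlMr ?ltr0n // => h; apply: lt_le_trans h.
    by rewrite ltr_pM2l // ltr_nat.
  apply: le_lt_trans en; rewrite /e; case: ifP => _.
    rewrite normrN ger0_norm ?mulrn_wge0 ?(ltW d0) // -[dl *+ _]mulr_natr ler_pM2l // ler_nat.
    by rewrite (leq_trans (max_card _)) // card_ord.
  case: ifP => _; last by rewrite normr0 mulr_ge0 ?ltW.
  by rewrite gtr0_norm // ler_peMr ?(ltW d0) // ler1n.
have [/existsP[j0 /andP[j0i j0J]]|/existsPn noJ] := boolP [exists j0, J j0].
  exists c, i, j0; split=> //; split=> // [_|h].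
    rewrite tcj // (ltW j0J) tci; apply: (@lt_le_trans _ _ (tau s1 i)).
      by apply: lt_le_trans (hi j0); rewrite ltrBlDr ltrDl.
    by rewrite lerDl mulrn_wge0 // ltW.
  by have := lt_trans h; rewrite -(tcJ _ j0i) in j0J; move=> /(_ _ j0J); rewrite ltxx.
have [j0 j0i] : exists j0 : 'I_n, j0 != i.
  have [E|E] := eqVneq i (Ordinal (ltnW n1)).
    by exists (Ordinal n1); rewrite E.
  by exists (Ordinal (ltnW n1)); rewrite eq_sym.
exists c, i, j0; split=> //; split=> // [h|_].
  by have := noJ j0; rewrite /= j0i -(tcJ _ j0i) h.
move: sumE; rewrite big_pred0 ?addr0 // => j.
by apply/negbTE; have := noJ j; rewrite /=; case: (boolP (j != i)) => //= /tcJ ->.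
Qed.

(** The quotient $g/h$ cannot coincide with the continuation on an open set near a
    boundary point. For large [p] the function [g] vanishes on the part inside the
    domain of the graph of zeros at [p], because a numerator vanishes there and
    the denominator does not vanish identically; hence on the whole graph. On each
    complex line in the direction of $s_i$, the points of these graphs cluster, as
    $p \to \infty$, at a point of a complex hyperplane; so [g] is zero on these lines,
    then everywhere, and so is a numerator, which is impossible. *)
Theorem no_extension s1 (r : R) K0 (O : set V) (g h : V -> C) :
  (1 < n)%N -> load s1 = 1 -> 0 < r ->
  (forall z, nrm (z - s1) < r -> differentiable g z) ->
  (forall z, nrm (z - s1) < r -> differentiable h z) ->
  open O -> (exists2 z, O z & h z != 0) ->
  (forall z, O z -> nrm (z - s1) < r /\ region K0 z) ->
  (forall z, O z -> g z * denom K0 z = h z * numer K0 z) -> False.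
Proof.
move=> n1 l1 r0 gd hd oO [z0 Oz0 hz0] sO gh.
pose U := [set z | nrm (z - s1) < r].
have oU : open U by exact: nrm_ball_open.
have cU : segment_convex U by exact: nrm_ball_convex.
have denom_not0 K (S : set V) : open S -> S !=set0 -> S `<=` region K -> ~ forall z, S z -> denom K z = 0.
  move=> oS nS sS dz; have := denom_neq0 K (@right_half_nonempty R n).
  rewrite (identity_theorem (@region_open R n K) (@region_convex R n K)
    (fun z rz => denom_differentiable K (region_load rz)) oS nS sS dz) ?eqxx //.
  exact: region_right (@right_half_nonempty R n).
have numer_not0 K (S : set V) : open S -> S !=set0 -> S `<=` region K -> ~ forall z, S z -> numer K z = 0.
  move=> oS nS sS dz.
  have := numer_denom K (abs_conv_gt2 (@right_half_nonempty R n)).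
  rewrite (identity_theorem (@region_open R n K) (@region_convex R n K)
    (@numer_differentiable R n K) oS nS sS dz); last first.
    exact: region_right (@right_half_nonempty R n).
  move=> /esym/eqP; rewrite mulf_eq0 (negbTE (denom_neq0 K (@right_half_nonempty R n))) /=.
  apply/negP; apply: multi_series_real_neq0; first exact: abs_conv_gt2 (@right_half_nonempty R n).
  by move=> i; rewrite mxE Im_nat.
have nO : O !=set0 by exists z0.
(* the relation extends to all regions, which the points close to the boundary need *)
have rel K : (K0 <= K)%N -> forall z, U z -> region K z -> g z * denom K z = h z * numer K z.
  move=> KK z Uz rz; apply/eqP; rewrite -subr_eq0; apply/eqP.
  pose G z := g z * denom K z - h z * numer K z.
  have Gd w : U w -> region K w -> differentiable G w.
    move=> Uw rw; apply: hol_sub; apply: hol_mul; first [exact: gd|exact: hd|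
      exact: numer_differentiable|apply: denom_differentiable; exact: region_load rw].
  have [||[] _ [S [oS nS sS zS]]] := @prod_zero_open R _ _ [:: true; false]
      (fun (t : bool) z => if t then denom K0 z else G z) O oO nO.
  - move=> [] _ w /sO[Uw rw]; first by apply: denom_differentiable; exact: region_load rw.
    by apply: Gd => //; exact: region_sub rw.
  - move=> w Ow; have [_ rw] := sO w Ow; rewrite !big_cons big_nil mulr1 /G.
    have -> : denom K0 w * (g w * denom K w - h w * numer K w) =
      (g w * denom K0 w) * denom K w - h w * (numer K w * denom K0 w) by ring.
    by rewrite gh // -cross //; ring.
  - by case: (denom_not0 K0 S oS nS) => // w /sS/sO[].
  - apply: (@identity_theorem R _ G (U `&` region K) S); [..|exact: (conj Uz rz)].
    + by apply: openI => //; exact: region_open.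
    + by move=> x x' [h1 h2] [h3 h4] t t01; split; [exact: cU|exact: region_convex].
    + by move=> w [h1 h2]; exact: Gd.
    + exact: oS.
    + exact: nS.
    + by move=> w /sS/sO[h1 h2]; split; [exact: h1|exact: region_sub h2].
    + exact: zS.
have [r2 r20] : exists2 r2 : R, 0 < r2 & r2 = r / 2 by exists (r / 2); rewrite ?divr_gt0.
move=> r2E; have [c [i [j0 [cs1 tnz ti tsum [j0i jlt jeq]]]]] := generic_boundary_point n1 l1 r20.
have cU' z : nrm (z - c) < r2 -> U z.
  move=> zc; rewrite /U /=; have -> : z - s1 = (z - c) + (c - s1) by rewrite addrA subrK.
  by apply: le_lt_trans (ler_nrmD _ _) _; move: zc cs1; rewrite r2E; lra.
have [r1 [B [P0 [r10 graph]]]] := zero_graph tnz ti tsum.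
pose rho := Num.min r1 (r2 / 2 / n.+1%:R).
have rho0 : 0 < rho by rewrite lt_min r10 !divr_gt0 ?ltr0n.
have r24 : 0 < r2 / 2 by rewrite divr_gt0.
have rho_r2 : rho <= r2 / 2.
  apply: (@le_trans _ _ (r2 / 2 / n.+1%:R)); first by rewrite /rho ge_min lexx orbT.
  by rewrite ler_pdivrMr ?ltr0n // ler_peMr ?ler1n // ltW.
have tst_near s : nrm (s - c) < rho -> normc (boundary_coord c i s - c ord0 i) < r2 / 2.
  move=> sc; rewrite /boundary_coord addrAC subrr sub0r normcN.
  apply: le_lt_trans (ler_normc_sum _ _ _) _.
  apply: (@le_lt_trans _ _ (nrm (s - c) *+ n)).
    apply: (@le_trans _ _ (\sum_(j < n | (j != i) && (0 < tau c j)) nrm (s - c))).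
      by apply: ler_sum => j _; apply: le_trans (coord_le_nrm (s - c) j); rewrite !mxE.
    by rewrite sumr_const ler_wpMn2l ?nrm_ge0 // (leq_trans (max_card _)) // card_ord.
  apply: (@le_lt_trans _ _ (nrm (s - c) *+ n.+1)); first by rewrite ler_wpMn2l ?nrm_ge0.
  rewrite -[ltLHS]mulr_natr -ltr_pdivlMr ?ltr0n //; apply: (lt_le_trans sc).
  by rewrite /rho ge_min lexx orbT.
have [P1 hP1] := inv_ln_small B r24.
have [P2 hP2] := inv_ln_small (pi *+ 2) rho0.
have [P3 hP3] : exists P3 : nat, forall p, (P3 <= p)%N -> 0 < tau c j0 -> npw p (tau c j0 - tau c i) <= 2^-1.
  have [tj|tj] := ltP 0 (tau c j0); last by exists 0%N.
  have d0 : 0 < tau c i - tau c j0 by rewrite subr_gt0 jlt.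
  have h2 : 0 < 2^-1 :> R by rewrite invr_gt0.
  have [N hN] := npw_small d0 h2.
  exists N.+1 => p pN _; have := hN p.-1; rewrite -ltnS prednK; last exact: leq_ltn_trans pN.
  by move=> /(_ pN)/ltW; rewrite opprB.
pose PP := maxn (maxn P0 P1) (maxn P2 P3).
have gz p : prime p -> (PP <= p)%N -> exists phi : V -> C,
    (forall s, nrm (s - c) < rho -> [/\ phi s != boundary_coord c i s,
       normc (phi s - boundary_coord c i s) <= B / ln p%:R & g (upd i s (phi s)) = 0]).
  move=> pp; rewrite !geq_max => /andP[/andP[p0 p1] /andP[p2 p3]].
  have [phi [phid hphi phi_indep]] := graph p pp p0.
  have rr1 s : nrm (s - c) < rho -> nrm (s - c) < r1 by rewrite lt_min => /andP[].
  have near s : nrm (s - c) < rho -> nrm (upd i s (phi s) - c) < r2.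
    move=> sc; apply: upd_near; first by move: sc rho_r2 r20; lra.
    have [_ h1 _ _] := hphi _ (rr1 _ sc); have h2 := tst_near _ sc.
    have -> : phi s - c ord0 i = (phi s - boundary_coord c i s) + (boundary_coord c i s - c ord0 i).
      by rewrite addrA subrK.
    apply: le_lt_trans (ler_normcD _ _) _; have := hP1 _ p1; move: h1 h2; lra.
  exists phi => s sc; have [h1 h2 _ _] := hphi _ (rr1 _ sc); split=> //.
  (* a point of the graph inside the domain, and an open set of them *)
  have [sp [yneg spc]] := negative_point c (prime_gt1 pp).
  have sp_near : nrm (sp - c) < rho.
    by apply/(nrm_rowP _ rho0) => j; rewrite !mxE; apply: le_lt_trans (spc j) (hP2 _ p2).
  have [_ _ W0 yE] := hphi _ (rr1 _ sp_near).
  have := negative_point_load tnz ti tsum (prime_gt1 pp) j0i (hP3 _ p3) jeq yneg yE.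
  move=> /load_region[K1 rK1]; pose K := maxn K0 K1.
  have rK : region K (upd i sp (phi sp)) by apply: region_sub rK1; exact: leq_maxr.
  have gcont : {for sp, continuous (fun s => upd i s (phi s))}.
    apply: differentiable_continuous; apply: upd_differentiable; apply: phid; exact: rr1.
  have /gcont : nbhs (upd i sp (phi sp)) (region K).
    by apply: open_nbhs_nbhs; split => //; exact: region_open.
  move=> /nbhs_nrmP[e1 e10 he1].
  pose e2 := Num.min e1 (rho - nrm (sp - c)).
  have e20 : 0 < e2 by rewrite lt_min e10 subr_gt0.
  pose S := [set s | nrm (s - sp) < e2].
  have S_sub s' : S s' -> nrm (s' - c) < rho /\ region K (upd i s' (phi s')).
    rewrite /S /= lt_min => /andP[/he1 q1 q2]; split=> //.
    have -> : s' - c = (s' - sp) + (sp - c) by rewrite addrA subrK.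
    by apply: le_lt_trans (ler_nrmD _ _) _; move: q2; lra.
  have oS : open S by exact: nrm_ball_open.
  have nS : S !=set0 by exists sp; rewrite /S /= subrr nrm0.
  have gGd s' : nrm (s' - c) < rho -> differentiable (fun s => g (upd i s (phi s))) s'.
    move=> s'c; apply: upd_comp_differentiable; first exact: phid (rr1 _ s'c).
    by apply: gd; apply: cU'; exact: near.
  have [||[] _ [S' [oS' nS' sS' zS']]] := @prod_zero_open R _ _ [:: true; false]
      (fun (t : bool) s => if t then denom K (upd i s (phi s)) else g (upd i s (phi s))) S oS nS.
  - move=> [] _ s' /S_sub[q1 q2]; last exact: gGd.
    apply: upd_comp_differentiable; first exact: phid (rr1 _ q1).
    by apply: denom_differentiable; exact: region_load q2.
  - move=> s' /S_sub[q1 q2]; rewrite !big_cons big_nil mulr1 mulrC.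
    have [_ _ W0' yE'] := hphi _ (rr1 _ q1).
    rewrite (rel K (leq_maxl _ _)) //; last by apply: cU'; exact: near.
    by rewrite (numer_eq0 pp q2) ?mulr0 //; exact: hfac_graph.
  - have [|s' /zS' -> ] := @denom_graph_neq0 R n K p i phi S' n1 pp oS' nS'; last by rewrite eqxx.
    move=> s' /sS'/S_sub[q1 q2]; have [_ _ W0' yE'] := hphi _ (rr1 _ q1).
    by split=> //; exact: phid (rr1 _ q1).
  - apply: (@identity_theorem R _ (fun s => g (upd i s (phi s))) [set s | nrm (s - c) < rho] S') => //.
    + exact: nrm_ball_open.
    + exact: nrm_ball_convex.
    + by move=> s' /sS'/S_sub[].
(* zeros on the line through s clustering at the hyperplane *)
have g0 s : nrm (s - c) < rho -> g s = 0.
  move=> sc; rewrite -(upd_id i s); pose f x := g (upd i s x).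
  have sr2 : nrm (s - c) < r2 by move: sc rho_r2 r20; lra.
  have fd x : normc (x - c ord0 i) < r2 -> differentiable f x.
    move=> xc; apply: upd1_differentiable; apply: gd; apply: cU'; exact: upd_near.
  have tc := tst_near _ sc.
  have [||r3 r30 fz] := @zeros_cluster R f (boundary_coord c i s) (r2 / 2) r24.
  - move=> t ht; apply: differentiable_cder; apply: fd.
    have -> : t - c ord0 i = (t - boundary_coord c i s) + (boundary_coord c i s - c ord0 i).
      by rewrite addrA subrK.
    by apply: le_lt_trans (ler_normcD _ _) _; move: ht tc; lra.
  - move=> e e0; have [P4 hP4] := inv_ln_small B e0.
    have [p pP pp] := prime_above (maxn PP P4).
    move: pP; rewrite gtn_max => /andP[/ltnW pP /ltnW /hP4 pe].
    have [phi hphi] := gz p pp pP; have [q1 q2 q3] := hphi _ sc.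
    by exists (phi s); split=> //; apply: le_lt_trans q2 pe.
  have m0 : 0 < Num.min r3 (r2 / 2) by rewrite lt_min r30.
  apply: (@identity_theorem R C f [set t | nrm (t - c ord0 i) < r2]
    [set t | nrm (t - boundary_coord c i s) < Num.min r3 (r2 / 2)]) => //.
  - exact: nrm_ball_open.
  - exact: nrm_ball_convex.
  - exact: nrm_ball_open.
  - by exists (boundary_coord c i s); rewrite /= subrr nrm0.
  - move=> t /=; rewrite !nrm_normc lt_min => /andP[_ ht].
    have -> : t - c ord0 i = (t - boundary_coord c i s) + (boundary_coord c i s - c ord0 i).
      by rewrite addrA subrK.
    by apply: le_lt_trans (ler_normcD _ _) _; move: ht tc; lra.
  - by move=> t /=; rewrite nrm_normc lt_min => /andP[/fz].
  - rewrite /= nrm_normc; apply: le_lt_trans sr2.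
    by apply: le_trans (coord_le_nrm (s - c) i); rewrite !mxE.
have gU z : U z -> g z = 0.
  apply: (@identity_theorem R _ g U [set s | nrm (s - c) < rho]) => //.
  - exact: nrm_ball_open.
  - by exists c; rewrite /= subrr nrm0.
  - by move=> s sc; apply: cU'; move: sc rho_r2 r20 => /=; lra.
have [||[] _ [S [oS nS sS zS]]] := @prod_zero_open R _ _ [:: true; false]
    (fun (t : bool) z => if t then h z else numer K0 z) O oO nO.
- move=> [] _ w /sO[Uw rw]; first exact: hd.
  exact: numer_differentiable.
- move=> w Ow; rewrite !big_cons big_nil mulr1 -gh // gU ?mul0r //.
  by case: (sO w Ow).
- have [Uz0 _] := sO _ Oz0.
  move: hz0; rewrite (@identity_theorem R _ h U S oU cU hd oS nS _ zS z0 Uz0) ?eqxx //.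
  by move=> w /sS/sO[].
- by case: (numer_not0 K0 S oS nS) => // w /sS/sO[].
Qed.

End NaturalBoundary.

(** * The maximal domain of meromorphy *)

Section Continuation.
Context {R : realType} {n : nat}.
Local Notation C := R[i].
Local Notation V := 'rV[C]_n.
Implicit Types (s z : V).

(** The largest of the sums of the $\tau_i$ over subsets is that over the positive ones. *)
Lemma subset_sums_load s :
  (forall I : {set 'I_n}, -1 + #|I|%:R < \sum_(i in I) complex.Re (s ord0 i)) <-> load s < 1.
Proof.
have E (I : {set 'I_n}) : \sum_(i in I) complex.Re (s ord0 i) = #|I|%:R - \sum_(i in I) tau s i.
  rewrite -sum1_card natr_sum -sumrB; apply: eq_bigr => i _.
  by rewrite /tau opprB addrC subrK.
split=> [/(_ [set i | 0 < tau s i]%SET)|l1 I].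
  rewrite E /load; have -> : \sum_(i in [set i | 0 < tau s i]%SET) tau s i = \sum_i Num.max 0 (tau s i).
    by rewrite big_mkcond; apply: eq_bigr => i _; rewrite inE.
  lra.
rewrite E; have : \sum_(i in I) tau s i <= load s.
  rewrite big_mkcond; apply: ler_sum => i _.
  by case: ifP => _; rewrite le_max lexx ?orbT.
lra.
Qed.

Definition domain : set V := [set s | load s < 1].

Lemma domain_open : open domain.
Proof.
rewrite openE => s hs; have [K rK] := load_region hs.
have : nbhs s (region K) by apply: open_nbhs_nbhs; split => //; exact: region_open.
by apply: filterS => z; exact: region_load.
Qed.

Lemma domain_convex : segment_convex domain.
Proof.
move=> x y xM yM t t01; have [K1 r1] := load_region xM; have [K2 r2] := load_region yM.
apply: (@region_load _ _ (maxn K1 K2)); apply: region_convex => //.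
  exact: region_sub (leq_maxl _ _) _ r1.
exact: region_sub (leq_maxr _ _) _ r2.
Qed.

Lemma segment_connected_line (x v : V) :
  connected ((fun t : R => x + ((t%:C)%C : C) *: v) @` `[0, 1]).
Proof.
apply: connected_continuous_connected; first exact: segment_connected.
apply: continuous_subspaceT => t; apply/cvgrPdist_lt => e e0.
have e1 : 0 < complex.Re e by move: e0; rewrite ltcE => /andP[].
have eE : e = ((complex.Re e)%:C)%C.
  by apply: complex_eq => //=; move: e0; rewrite ltcE => /andP[/eqP].
have n0 : 0 < nrm v + 1 by rewrite ltr_wpDl // nrm_ge0.
have : nbhs t (ball t (complex.Re e / (nrm v + 1))) by apply: nbhsx_ballx; rewrite divr_gt0.
apply: filterS => u; rewrite /ball /= => tu.
rewrite opprD addrACA subrr add0r -scalerBl -rmorphB norm_nrm eE ltcR nrmZ normcR.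
move: tu; rewrite ltr_pdivlMr //; apply: le_lt_trans.
by rewrite ler_wpM2l // lerDl.
Qed.

(** The segments from a point of the domain are connected and cover it. *)
Lemma domain_connected : connected domain.
Proof.
pose x : V := const_mx 3%:R.
have xM : domain x by apply: (@region_load _ _ 0%N); apply: region_right; exact: right_half_nonempty.
have -> : domain = \bigcup_(y in domain) ((fun t : R => x + ((t%:C)%C : C) *: (y - x)) @` `[0, 1]).
  apply/seteqP; split=> [y yM|_ [y yM] [t /= t01 <-]].
    exists y => //; exists 1; first by rewrite /= in_itv /= ler01 lexx.
    by rewrite rmorph1 scale1r addrC subrK.
  by apply: domain_convex => //; move: t01; rewrite in_itv.
apply: bigcup_connected; last by move=> y _; exact: segment_connected_line.
exists x => y _; exists 0; first by rewrite /= in_itv /= lexx ler01.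
by rewrite rmorph0 scale0r addr0.
Qed.

Lemma frontier_load s : frontier domain s -> load s = 1.
Proof.
move=> [cl ni]; apply/eqP; rewrite eq_le; apply/andP; split; last first.
  rewrite leNgt; apply/negP => h; apply: ni.
  by have := domain_open; rewrite openE => /(_ s h).
apply/ler_addgt0Pr => e e0.
have d0 : 0 < e / n.+1%:R by rewrite divr_gt0 ?ltr0n.
have [z [zM]] : domain `&` [set z | nrm (z - s) < e / n.+1%:R] !=set0.
  by apply: cl; apply/nbhs_nrmP; exists (e / n.+1%:R).
rewrite /= -nrmN opprB ltr_pdivlMr ?ltr0n // => zs.
apply: le_trans (load_lip s z) _; apply: lerD; first exact: ltW.
apply: le_trans (ltW zs); rewrite mulrC ler_wpM2l ?nrm_ge0 // ler_nat //.
Qed.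

Lemma denom_not_zero_on K (S : set V) : open S -> S !=set0 -> S `<=` domain ->
  exists2 z, S z & denom K z != 0.
Proof.
move=> oS nS sS; have [//|h] := pselect (exists2 z, S z & denom K z != 0).
have := denom_neq0 K (@right_half_nonempty R n).
rewrite (identity_theorem domain_open domain_convex (@denom_differentiable R n K) oS nS sS _) ?eqxx //.
- by move=> z Sz; apply/eqP/negPn/negP => ne; apply: h; exists z.
- by apply: (@region_load _ _ 0%N); apply: region_right; exact: right_half_nonempty.
Qed.

Definition denoms K s : C := \prod_(j <- iota 0 K.+1) denom j s.

Lemma denoms_differentiable K s : domain s -> differentiable (denoms K) s.
Proof. by move=> sM; apply: hol_prod => j _; exact: denom_differentiable. Qed.

Lemma denoms_neq0 K j s : denoms K s != 0 -> (j <= K)%N -> denom j s != 0.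
Proof.
rewrite prodf_seq_neq0 => /allP h jK; apply: h.
by rewrite mem_iota /= add0n ltnS.
Qed.

Lemma open_neq0 (f : V -> C) (S : set V) : open S -> (forall z, S z -> differentiable f z) ->
  open [set z | S z /\ f z != 0].
Proof.
move=> oS fd; rewrite openE => z [Sz fz]; apply/nbhs_nrmP.
have /nbhs_nrmP[e e0 he] : nbhs z S by apply: open_nbhs_nbhs.
have n0 : 0 < normc (f z) by rewrite normc_gt0.
have [d d0 hd] := differentiable_cont (fd z Sz) n0.
exists (Num.min e d); first by rewrite lt_min e0.
move=> q; rewrite lt_min => /andP[/he Sq /hd fq]; split=> //.
by apply: contraTneq fq => ->; rewrite sub0r normcN ltxx.
Qed.

Lemma denoms_dense K (S : set V) : open S -> S !=set0 -> S `<=` domain ->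
  [set z | S z /\ denoms K z != 0] !=set0.
Proof.
move=> oS nS sS; have [//|h] := pselect ([set z | S z /\ denoms K z != 0] !=set0).
have [||j _ [S' [oS' nS' sS' zS']]] := @prod_zero_open _ _ _ (iota 0 K.+1) (fun j z => denom j z) S oS nS.
- by move=> j _ z /sS; exact: denom_differentiable.
- by move=> z Sz; apply/eqP/negPn/negP => ne; apply: h; exists z.
have [z /zS' -> ] := denom_not_zero_on j oS' nS' (subset_trans sS' sS).
by rewrite eqxx.
Qed.

(** The quotients [numer K / denom K] agree where both are defined, so that any
    choice of [K] at each point gives the same meromorphic function. *)
Definition first_region s : nat :=
  xget 0%N [set K | region K s /\ forall K', region K' s -> (K <= K')%N].

Lemma first_regionP s : load s < 1 -> region (first_region s) s /\
  forall K, region K s -> (first_region s <= K)%N.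
Proof.
move=> sM; rewrite /first_region; case: xgetP => [K _ //|h].
have ex : exists K : nat, 1 < K.+2%:R * (1 - load s).
  by have [K rK] := load_region sM; exists K.
by case: (ex_minnP ex) => K rK minK; case: (h K); split.
Qed.

Definition continuation s : C :=
  numer (first_region s) s / denom (first_region s) s.

Lemma continuation_quot K s : region K s -> denoms K s != 0 ->
  continuation s = numer K s / denom K s.
Proof.
move=> rK d0; have [r1 /(_ K rK) le1] := first_regionP (region_load rK).
apply/eqP; rewrite /continuation eqr_div; last 2 first.
  exact: denoms_neq0 d0 le1.
  exact: denoms_neq0 d0 (leqnn K).
by rewrite cross.
Qed.

Lemma conv_right s : abs_conv totient s -> forall i, 2 < complex.Re (s ord0 i).
Proof. by move=> /abs_convP[B sB] i; exact: abs_conv_Re_gt2 sB i. Qed.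

Lemma continuation_extends :
  mero_extension (@abs_conv R n totient) (multi_series totient) domain continuation.
Proof.
split.
- by move=> s /conv_right h; apply: (@region_load _ _ 0%N); exact: region_right.
- move=> p /load_region[K rK].
  exists (region K), (fun s => numer K s * denoms K s), (fun s => denom K s * denoms K s).
  have sub z : region K z -> domain z by exact: region_load.
  split; first by split; [exact: region_open|exact: rK|exact: sub].
  split.
  + move=> z rz; apply: hol_mul; first exact: numer_differentiable.
    exact: denoms_differentiable (sub _ rz).
  + move=> z rz; apply: hol_mul; first exact: denom_differentiable (sub _ rz).
    exact: denoms_differentiable (sub _ rz).
  + move=> z rz B nB.
    have oS : open (region K `&` B^°) by apply: openI; [exact: region_open|exact: open_interior].
    have [|w [[rw /interior_subset Bw] dw]] := denoms_dense K oS _ (fun w h => sub w h.1).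
      by exists z; split.
    exists w; split=> //; split=> //.
    by rewrite mulf_neq0 // (denoms_neq0 dw).
  + move=> z rz; rewrite mulf_eq0 negb_or => /andP[d1 d2].
    by rewrite (continuation_quot rz d2) -mulf_div divff // mulr1.
move=> s sD; have s2 := conv_right sD.
by rewrite /continuation numer_denom // [denom _ _ * _]mulrC mulfK // denom_neq0.
Qed.

Definition agreement (U : set V) (G : V -> C) : set V :=
  [set z | exists W, [/\ open W, W z, W `<=` U `&` domain & forall w, W w -> G w = continuation w]].

Lemma agreement_open U G : open (agreement U G).
Proof.
rewrite openE => z [W [oW Wz sW WG]].
have : nbhs z W by apply: open_nbhs_nbhs.
by apply: filterS => w Ww; exists W.
Qed.

(** Where a quotient $g/h$ agrees with the continuation, so do the cross products,
    away from the zeros of the denominators. *)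
Lemma local_relation (g h G : V -> C) K (U S S' : set V) :
  (forall z, S z -> h z != 0 -> G z = g z / h z) -> S `<=` region K ->
  (forall z, S z -> differentiable g z) -> (forall z, S z -> differentiable h z) ->
  open S' -> S' `<=` S `&` agreement U G ->
  [set z | S' z /\ h z != 0] !=set0 ->
  exists O, [/\ open O, O `<=` S', (exists2 z, O z & h z != 0) &
    forall z, O z -> g z * denom K z = h z * numer K z].
Proof.
move=> GE sK gd hd oS' sS' [z0 [S'z0 hz0]].
have S'd z : S' z -> domain z by move=> /sS'[/sK/region_load].
have oH : open [set z | S' z /\ h z != 0].
  by apply: open_neq0 => // z /sS'[/hd hz _].
have oO : open [set z | [set z | S' z /\ h z != 0] z /\ denoms K z != 0].
  by apply: open_neq0 => // z [/S'd zM _]; exact: denoms_differentiable.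
exists [set z | [set z | S' z /\ h z != 0] z /\ denoms K z != 0]; split=> //.
- by move=> z [[]].
- have [|w [[S'w hw] dw]] := denoms_dense K oH _ (fun w h => S'd w h.1).
    by exists z0.
  by exists w.
- move=> z [[S'z hz] dz]; have [Sz [W [_ Wz _ WG]]] := sS' z S'z.
  have := WG z Wz; rewrite (GE z Sz hz) (continuation_quot (sK z Sz) dz).
  have d0 := denoms_neq0 dz (leqnn K).
  by move/eqP; rewrite eqr_div // => /eqP ->; rewrite mulrC.
Qed.

Hypothesis n1 : (1 < n)%N.

(** [no_extension], with a local representation of [G] at the boundary point. *)
Lemma boundary_contradiction (U : set V) (G : V -> C) s : meromorphic_on U G ->
  U s -> load s = 1 -> ~ closure (agreement U G) s.
Proof.
move=> mG Us l1 cl; have [V0 [g [h [[oV V0s sV] [gd hd dense GE]]]]] := mG s Us.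
have /nbhs_nrmP[r r0 hr] : nbhs s V0 by apply: open_nbhs_nbhs.
have [z0 [Az0 /= z0r]] : agreement U G `&` [set z | nrm (z - s) < r] !=set0.
  by apply: cl; apply/nbhs_nrmP; exists r.
have [W [_ Wz0 sW _]] := Az0; have [_ /load_region[K rK]] := sW z0 Wz0.
pose S := [set z | nrm (z - s) < r] `&` region K.
have oS : open S by apply: openI; [exact: nrm_ball_open|exact: region_open].
pose S' := S `&` agreement U G.
have oS' : open S' by apply: openI => //; exact: agreement_open.
have [|||||O [oO sO nO gh]] := @local_relation g h G K U S S' _ _ _ _ oS' (@subset_refl _ _).
- by move=> z [/hr Vz _]; exact: GE.
- by move=> z [].
- by move=> z [/hr Vz _]; exact: gd.
- by move=> z [/hr Vz _]; exact: hd.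
- have [w [[_ hw] S'w]] : [set z | V0 z /\ h z != 0] `&` S' !=set0.
    by apply: (dense _ (hr _ z0r)); apply: open_nbhs_nbhs; split.
  by exists w.
apply: (no_extension n1 l1 r0 _ _ oO nO _ gh) => [z /hr/gd //|z /hr/hd //|].
by move=> z /sO[[]].
Qed.

(** The set of points where a continuation agrees with ours is relatively open and
    closed, hence reaches every boundary point of its domain of definition. *)
Lemma no_continuation (U : set V) (G : V -> C) s : is_domain U ->
  mero_extension (@abs_conv R n totient) (multi_series totient) U G ->
  U s -> load s = 1 -> False.
Proof.
move=> [_ oU cU] [DU mG GZ] Us l1.
pose A := U `&` closure (agreement U G).
suff AU : A = U.
  have [_ cl] : A s by rewrite AU.
  exact: (boundary_contradiction mG Us l1 cl).
apply: cU.
- exists (const_mx 3%:R); have x2 := @right_half_nonempty R n.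
  have xD := abs_conv_gt2 x2; split; first exact: DU.
  apply: subset_closure; exists right_half; split=> //; first exact: right_half_open.
    move=> w hw; split; first by apply/DU/abs_conv_gt2.
    by apply: (@region_load _ _ 0%N); exact: region_right.
  move=> w /abs_conv_gt2 hw; rewrite GZ //.
  by have [_ _ ->] := continuation_extends.
- exists A; last by rewrite /A setIA setIid.
  rewrite openE => p [Up clp].
  have pM : load p < 1.
    have : load p <= 1.
      apply/ler_addgt0Pr => e e0.
      have d0 : 0 < e / n.+1%:R by rewrite divr_gt0 ?ltr0n.
      have [z [[W [_ Wz sW _]] /= zp]] : agreement U G `&` [set z | nrm (z - p) < e / n.+1%:R] !=set0.
        by apply: clp; apply/nbhs_nrmP; exists (e / n.+1%:R).
      have [_ zM] := sW z Wz; move: zp; rewrite -nrmN opprB ltr_pdivlMr ?ltr0n // => zp.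
      apply: le_trans (load_lip p z) _; apply: lerD; first exact: ltW.
      by apply: le_trans (ltW zp); rewrite mulrC ler_wpM2l ?nrm_ge0 // ler_nat.
    rewrite le_eqVlt => /orP[/eqP l1p|//].
    by case: (boundary_contradiction mG Up l1p clp).
  have [V0 [g [h [[oV V0p sV] [gd hd dense GE]]]]] := mG p Up.
  have [K rK] := load_region pM.
  have /nbhs_nrmP[r r0 hr] : nbhs p (V0 `&` region K).
    by apply: open_nbhs_nbhs; split=> //; apply: openI => //; exact: region_open.
  pose S := [set z | nrm (z - p) < r].
  have oS : open S by exact: nrm_ball_open.
  have Sp : S p by rewrite /S /= subrr nrm0.
  pose S' := S `&` agreement U G.
  have oS' : open S' by apply: openI => //; exact: agreement_open.
  have [w0 S'w0] : S' !=set0.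
    have [w [Aw Sw]] : agreement U G `&` S !=set0 by apply: clp; apply: open_nbhs_nbhs.
    by exists w.
  have [|||||O [oO sO [z0 Oz0 _] gh]] := @local_relation g h G K U S S' _ _ _ _ oS' (@subset_refl _ _).
  - by move=> z /hr[Vz _]; exact: GE.
  - by move=> z /hr[].
  - by move=> z /hr[Vz _]; exact: gd.
  - by move=> z /hr[Vz _]; exact: hd.
  - have [w [[_ hw] S'w]] : [set z | V0 z /\ h z != 0] `&` S' !=set0.
      apply: (dense w0); first by case: S'w0 => /hr[].
      by apply: open_nbhs_nbhs; split.
    by exists w.
  have rel z : S z -> g z * denom K z = h z * numer K z.
    move=> Sz; apply/eqP; rewrite -subr_eq0; apply/eqP.
    apply: (@identity_theorem R _ (fun z => g z * denom K z - h z * numer K z) S O oS _ _ oO _ _ _ z Sz).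
    + exact: nrm_ball_convex.
    + move=> w /hr[Vw rw]; apply: hol_sub; apply: hol_mul;
        first [exact: gd|exact: hd|exact: numer_differentiable|
          apply: denom_differentiable; exact: region_load rw].
    + by exists z0.
    + by move=> w /sO[].
    + by move=> w /gh ->; rewrite subrr.
  apply/nbhs_nrmP; exists r; first exact: r0.
  move=> q Sq; have [Vq rq] := hr q Sq; split; first exact: sV.
  move=> B nB.
  have oT : open [set z | (S `&` B^°) z /\ h z != 0].
    apply: open_neq0; first by apply: openI => //; exact: open_interior.
    by move=> z [/hr[Vz _] _]; exact: hd.
  have sT : [set z | (S `&` B^°) z /\ h z != 0] `<=` domain.
    by move=> z [[/hr[_ rz] _] _]; exact: region_load rz.
  have nT : [set z | (S `&` B^°) z /\ h z != 0] !=set0.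
    have [w [[Vw hw] [Sw Bw]]] : [set z | V0 z /\ h z != 0] `&` (S `&` B^°) !=set0.
      apply: (dense q Vq); apply: filterI; first exact: open_nbhs_nbhs.
      by apply: open_nbhs_nbhs; split; [exact: open_interior|].
    by exists w.
  have [w [[[Sw Bw] hw] dw]] := denoms_dense K oT nT sT.
  exists w; split; last exact: interior_subset.
  exists [set z | [set z | S z /\ h z != 0] z /\ denoms K z != 0]; split.
  + apply: open_neq0; first by apply: open_neq0 => // z /hr[Vz _]; exact: hd.
    by move=> z [/hr[_ rz] _]; apply: denoms_differentiable; exact: region_load rz.
  + by [].
  + move=> z [[/hr[Vz rz] _] _]; split; [exact: sV|exact: region_load rz].
  + move=> z [[Sz hz] dz]; have [Vz rz] := hr z Sz.
    rewrite (GE z Vz hz) (continuation_quot rz dz); apply/eqP.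
    by rewrite eqr_div ?(denoms_neq0 dz) // rel // mulrC.
- exists (closure (agreement U G)) => //; exact: closed_closure.
Qed.

End Continuation.

Theorem theorem3 (R : realType) (n : nat) (n_gt1 : (1 < n)%N) :
  let Z : 'rV[R[i]]_n -> R[i] := igusa_zeta laurentZ in
  let D : set 'rV[R[i]]_n := igusa_conv laurentZ in
  let M : set 'rV[R[i]]_n :=
    [set s : 'rV[R[i]]_n | forall I : {set 'I_n},
       -1 + #|I|%:R < \sum_(i in I) complex.Re (s ord0 i)] in
  [/\ forall s, D s -> abs_conv totient s /\ Z s = multi_series totient s,
      max_domain_of_meromorphy D Z M &
      forall (s0 : 'rV[R[i]]_n) (r : R[i]) (U : set 'rV[R[i]]_n),
        frontier M s0 -> 0 < r -> is_domain U -> ball s0 r `<=` U ->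
        ~ exists G, mero_extension D Z U G].
Proof.
move=> Z D M.
have ZE : Z = multi_series totient by exact: igusa_zeta_laurent.
have DE : D = abs_conv totient by exact: igusa_conv_laurent.
have ME : M = @domain R n.
  by apply/seteqP; split=> s /subset_sums_load.
rewrite ZE DE ME; split=> [s //| |s0 r U fs0 r0 dU bU [G mG]].
  split.
    split; [|exact: domain_open|exact: domain_connected].
    exists (const_mx 3%:R); apply: (@region_load _ _ 0%N).
    by apply: region_right; exact: right_half_nonempty.
  exists continuation; split; first exact: continuation_extends.
  move=> s0 r U fs0 r0 dU bU [G [mG [W [oW sW dW WG]]]].
  have Us0 : U s0 by apply: bU; right; apply: ballxx; rewrite ?ltcR.
  apply: (boundary_contradiction n_gt1 mG Us0 (frontier_load fs0)).
  have WA : W `<=` agreement U G.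
    move=> w Ww; exists W; split=> // z Wz; split; last exact: sW.
    by apply: bU; left; exact: sW.
  have [cl _] := fs0.
  have dA : domain `<=` closure (agreement U G).
    by apply: subset_trans dW _; exact: closure_subset.
  exact: (@closed_closure _ (agreement U G) s0 (closure_subset dA cl)).
by apply: (no_continuation n_gt1 dU mG _ (frontier_load fs0)); apply: bU; exact: ballxx.
Qed.
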